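(* Let $(G_n)_{n\ge1}$ be a sequence of finite graphs such that $|V(G_n)|\to\infty$ as $n\to\infty$ and, for some positive constant $\delta$, $|E(G_n)|\ge\delta|V(G_n)|$ for all $n$ large enough. Furthermore, assume that the maximum degrees of $(G_n)_{n\ge1}$ are bounded above by some constant $D$ and that $(G_n)_{n\ge1}$ has uniformly sub-exponential volume growth, i.e. for any $\alpha>0$ there exists $K$ such that $\Psi_{G_n}(R)\le K\exp(\alpha R)$ for all $n,R\ge1$. Consider the disordered monomer-dimer model on each $G_n$, with edge weight and vertex weight distributions not depending on $n$. Suppose that $\mathbf{E}|w_e|^{2+\epsilon}+\mathbf{E}|\nu_x|^{2+\epsilon}<\infty$ for some $\epsilon>0$ and that $w_e$ is non-degenerate (its distribution is not a point mass). Then $$\frac{F_n-\mathbf{E}F_n}{\sqrt{\mathrm{Var}(F_n)}}\stackrel{d}{\to}N(0,1)\quad\text{as }n\to\infty,$$ where $F_n=\log Z_{G_n}$ is the free energy associated with $\mu_{G_n}$ and $\stackrel{d}{\to}$ denotes convergence in distribution.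
   Context: Let $G=(V(G),E(G))$ be a finite graph. A (partial) matching of $G$ is a set of edges of $G$ no two of which share a vertex; $\mathcal{M}_G$ is the set of all matchings of $G$ (including the empty one). For $x\in V(G)$ and $M\in\mathcal{M}_G$, $x\notin M$ means that $x$ is not an endpoint of any edge of $M$ (it is unmatched). The edges carry i.i.d. real weights $(w_e)_{e\in E(G)}$ and the vertices carry i.i.d. real weights $(\nu_x)_{x\in V(G)}$; the edge weights are independent of the vertex weights, and the two distributions may differ. The disordered monomer-dimer model on $G$ (with inverse temperature normalized to $1$, absorbed in the weights) is the random Gibbs measure $\mu_G(M)=Z_G^{-1}\exp(\sum_{e\in M}w_e+\sum_{x\notin M}\nu_x)$, $M\in\mathcal{M}_G$, with partition function $Z_G=\sum_{M\in\mathcal{M}_G}\exp(\sum_{e\in M}w_e+\sum_{x\notin M}\nu_x)$. The free energy is $F=\log Z_G$. $\mathbf{E},\mathrm{Var}$ refer to the randomness of the weights. For $x\in V(G)$, $\mathbb{B}^x_R$ is the subgraph of $G$ induced by all vertices at graph distance at most $R$ from $x$, and the volume growth function is $\Psi_G(R)=\max_{x\in V(G)}|V(\mathbb{B}^x_R)|$. *)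

(* Defs.v *)
From HB Require Import structures.
From mathcomp Require Import all_boot all_order all_algebra.
From mathcomp Require Import all_classical all_reals all_analysis.
From mathcomp Require Import measurable_realfun.

Set Implicit Arguments.
Unset Strict Implicit.
Unset Printing Implicit Defensive.

Import Order.TTheory GRing.Theory Num.Theory.
Import numFieldNormedType.Exports.

Record sgraph := SGraph {
  vertex :> finType;
  adj : rel vertex;
  adj_sym : symmetric adj;
  adj_irr : irreflexive adj
}.

Section Graphs.
Variable G : sgraph.

Definition edges : {set {set G}} :=
  [set [set u.1; u.2] | u : G * G & adj u.1 u.2]%SET.

Definition edge : finType := {e : {set G} | e \in edges}.

Definition degree (x : G) : nat := #|[set y | adj x y]%SET|.

Definition max_degree : nat := \max_(x : G) degree x.

Definition walk (k : nat) (x y : G) : bool :=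
  [exists p : k.-tuple G, path (@adj G) x p && (last x p == y)].

Lemma connect_walk (x y : G) : connect (@adj G) x y -> exists k, walk k x y.
Proof.
case/connectP => p xp ->; exists (size p); apply/existsP.
by exists (in_tuple p); rewrite /= xp eqxx.
Qed.

(* The graph distance; None stands for infinity. *)
Definition gdist (x y : G) : option nat :=
  if @idP (connect (@adj G) x y) is ReflectT xy then
    Some (ex_minn (connect_walk xy))
  else None.

Definition gball (x : G) (r : nat) : {set G} :=
  [set y | if gdist x y is Some k then (k <= r)%N else false]%SET.

Definition volume_growth (r : nat) : nat := \max_(x : G) #|gball x r|.

Definition matching (M : {set edge}) : bool :=
  [forall e in M, forall f in M, (e != f) ==> [disjoint val e & val f]].

Definition unmatched (M : {set edge}) (x : G) : bool :=
  [forall e in M, x \notin val e].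

End Graphs.

Local Open Scope classical_set_scope.
Local Open Scope ring_scope.

Section Model.
Context {R : realType} {G : sgraph}.

Definition partition_function (w : edge G -> R) (nu : G -> R) : R :=
  \sum_(M : {set edge G} | matching M)
    expR (\sum_(e in M) w e + \sum_(x | unmatched M x) nu x).

Context {d : measure_display} {Omega : measurableType d}
  {P : probability Omega R}.
Variables (w : edge G -> {RV P >-> R}) (nu : G -> {RV P >-> R}).

Definition weights (i : edge G + G) : {RV P >-> R} :=
  match i with inl e => w e | inr x => nu x end.

Definition free_energy (t : Omega) : R :=
  ln (partition_function (fun e => w e t) (fun x => nu x t)).

Lemma measurable_bigsum (I : finType) (p : pred I) (h : I -> Omega -> R) :
  (forall i, measurable_fun [set: Omega] (h i)) ->
  measurable_fun [set: Omega] (fun t => \sum_(i | p i) h i t).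
Proof.
move=> mh; under eq_fun do rewrite -big_filter.
exact: measurable_sum.
Qed.

Lemma measurable_free_energy : measurable_fun [set: Omega] free_energy.
Proof.
rewrite /free_energy.
apply: (measurableT_comp (@measurable_ln R)).
apply: measurable_bigsum => M; apply: (measurableT_comp (@measurable_expR R)).
by apply: measurable_funD; apply: measurable_bigsum.
Qed.

HB.instance Definition _ :=
  isMeasurableFun.Build _ _ _ _ free_energy measurable_free_energy.

End Model.

Section Probability.
Context {R : realType}.

Section OneSpace.
Context {d : measure_display} {Omega : measurableType d}.
Variable P : probability Omega R.

(* Measures are total functions on [set T], so their equality is only required
   on measurable sets, here and in [point_mass]. *)
Definition has_law (X : {RV P >-> R})
    (mu : probability (measurableTypeR R) R) : Prop :=
  forall A : set R, measurable A -> distribution P X A = mu A.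

Definition mutually_independent (I : finType)
    (X : I -> {RV P >-> R}) : Prop :=
  forall (J : {set I}) (A : I -> set R), (forall i, measurable (A i)) ->
    P (\bigcap_(i in [set` J]) X i @^-1` A i) =
    (\prod_(i in J) P (X i @^-1` A i))%E.

(* Meaningful when X has finite mean and finite positive variance; it is 0
   if the variance is 0 or infinite. *)
Definition standardize (X : {RV P >-> R}) (t : Omega) : R :=
  (X t - fine 'E_P[X]) / Num.sqrt (fine 'V_P[X]).

Lemma measurable_standardize (X : {RV P >-> R}) :
  measurable_fun [set: Omega] (standardize X).
Proof. by apply: measurable_funM => //; apply: measurable_funB. Qed.

HB.instance Definition _ (X : {RV P >-> R}) :=
  isMeasurableFun.Build _ _ _ _ (standardize X) (measurable_standardize X).

End OneSpace.

Definition point_mass (mu : probability (measurableTypeR R) R) : Prop :=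
  exists c : R, forall A : set R, measurable A -> mu A = \d_c A.

(* The variables may live on different probability spaces. *)
Definition cvg_in_distribution (d : nat -> measure_display)
    (Omega : forall n, measurableType (d n))
    (P : forall n, probability (Omega n) R)
    (X : forall n, {RV (P n) >-> R})
    (mu : probability (measurableTypeR R) R) : Prop :=
  forall x : R, {for x, continuous (fun y : R => mu `]-oo, y]%classic)} ->
    cdf (X n) x @[n --> \oo] --> mu `]-oo, x]%classic.

End Probability.

(* [{RV P >-> R}] forgets P up to conversion, so P is made explicit. *)
Arguments has_law {R d Omega} P X mu.
Arguments mutually_independent {R d Omega} P {I} X.
Arguments standardize {R d Omega} P X t.
Arguments cvg_in_distribution {R d Omega} P X mu.

(* Main.v *)
Require Import Defs.
From HB Require Import structures.
From mathcomp Require Import all_boot all_order all_algebra.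
From mathcomp Require Import all_classical all_reals all_analysis.
From mathcomp Require Import measurable_realfun zify ring lra.

(** The free energy moves by at most [`|a - b|] when one weight is changed from a
    to b, since its derivative with respect to a weight is a Gibbs occupation
    probability ([log_partition_lipschitz]). Take an independent copy of all the
    weights and replace the weights by their copies one after the other. As
    exchanging the two copies of a single weight preserves the joint law, the
    covariance of two functions of the weights is a sum over the weights k of
    half the mean of a product of two increments, each of them due to the
    resampling of k ([ex_cov_resample]). For the free energy F and [g W], where W
    is the standardized free energy, a first-order expansion of g turns this
    identity into a bound on the mean of [g' W - W * g W] ([stein_bound]). The
    main term is the fluctuation of the sum of the [exchange_term]s around its
    mean, the variance v of F, divided by v; the remainder is of third order in
    the weights and is divided by [v * sqrt v]. Two facts make the bound small as
    the number n of weights grows: the sum of the exchange terms obeys a law of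
    large numbers, and v is at least of order n.

    Law of large numbers. A sum of bounded functions, each depending on the
    weights of a window of bounded size, has a variance of order n
    ([local_sum_concentration]). It remains to approximate every exchange term
    by such a function, in mean and with an error that is arbitrarily small but
    fixed. The increments of F are smooth functions of occupation probabilities
    ([ln_Zsub_jump]), so one has to see that these hardly depend on what lies
    beyond a large distance. The probability that a vertex is unmatched obeys a
    recursion over its neighbours ([ratio_vertex]). In logarithmic coordinates
    this recursion never expands distances, and it contracts them by a factor
    [theta] smaller than 1 at the good vertices, those with no weight above K in
    absolute value around them ([ratio_decay]). A path with few good vertices
    meets many extreme weights; degrees being bounded, the number of paths of
    length k is exponential in k, and for K large the product of the small
    probabilities of the extreme weights beats it ([ex_occupation_close],
    [decay_rate]). The moment of order above 2 controls the large amplitudes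
    that the bounded functions cut off.

    Variance. Around an edge e there is, with probability at least one half, no
    extreme weight. Then the occupation probability of e is bounded below, and
    the increment of F due to the weight of e is at least that of a fixed
    increasing function of this weight ([jump_edge_ge]). So the covariance of F
    with the sum over the edges of this function is at least of the order of the
    number of edges, as is the variance of that sum, because the distribution of
    the edge weights is not a point mass. The Cauchy-Schwarz inequality gives
    the lower bound for v ([variance_ge]), and the number of edges is of order n
    ([variance_linear]).

    Conclusion. The equation [g' x - x * g x = h x] has a bounded and
    continuously differentiable solution when h is Lipschitz, compactly
    supported and of Gaussian mean 0 ([stein_solution]), so the mean of [h W]
    tends to 0 for all these h. As the second moment of W is at most 1, they are
    enough to compare the distribution function of W with the normal one
    ([cdf_comparison]). *)

Set Implicit Arguments.
Unset Strict Implicit.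
Unset Printing Implicit Defensive.

Import Order.TTheory GRing.Theory Num.Theory.
Import numFieldNormedType.Exports.

Local Open Scope classical_set_scope.
Local Open Scope ring_scope.

(** * Integrable and square-integrable functions on a probability space *)

Section Expectation.
Context {R : realType} {d : measure_display} {T : measurableType d}.
Variable P : probability T R.
Implicit Types f g h : T -> R.

Definition itg f := P.-integrable setT (EFin \o f).

(** Measurability of f does not follow from that of its square. *)
Definition sqitg f := measurable_fun setT f /\ itg (fun t => f t ^+ 2).

Lemma itg_meas f : itg f -> measurable_fun setT f.
Proof. by move/measurable_int/measurable_EFinP. Qed.

Lemma itg_le f g : measurable_fun setT f -> (forall t, `|f t| <= g t) ->
  itg g -> itg f.
Proof.
move=> mf fg; apply: le_integrable => //; first exact/measurable_EFinP.
by move=> t _; rewrite lee_fin (le_trans (fg t))// ler_norm.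
Qed.

Lemma itg_cst k : itg (fun=> k).
Proof. exact: (@finite_measure_integrable_cst _ _ _ P setT k). Qed.

Lemma itg_bounded f K : measurable_fun setT f -> (forall t, `|f t| <= K) ->
  itg f.
Proof. by move=> mf fK; apply: (itg_le mf fK); exact: itg_cst. Qed.

Lemma itgD f g : itg f -> itg g -> itg (fun t => f t + g t).
Proof. by move=> hf hg; exact: (integrableD measurableT hf hg). Qed.

Lemma itgB f g : itg f -> itg g -> itg (fun t => f t - g t).
Proof. by move=> hf hg; exact: (integrableB measurableT hf hg). Qed.

Lemma itgZ k f : itg f -> itg (fun t => k * f t).
Proof. by move=> hf; exact: (integrableZl measurableT k hf). Qed.

Lemma itg_sum (I : Type) (s : seq I) (p : pred I) (F : I -> T -> R) :
  (forall i, p i -> itg (F i)) -> itg (fun t => \sum_(i <- s | p i) F i t).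
Proof.
move=> hF; apply: (eq_integrable _ (fun t => \sum_(i <- s | p i) (F i t)%:E)%E) => //.
  by move=> t _ /=; rewrite sumEFin.
exact: integrable_sum.
Qed.

Lemma itg_norm f : itg f -> itg (fun t => `|f t|).
Proof.
move=> hf; apply: (le_integrable _ _ _ hf) => //.
  by apply/measurable_EFinP/measurableT_comp => //; exact: itg_meas.
by move=> t _ /=; rewrite normr_id.
Qed.

Lemma ex_cst k : \int[P]_t k = k :> R.
Proof.
rewrite Rintegral_cst//; set p := fine _.
by rewrite (_ : p = 1) ?mulr1// /p [X in fine X](@probability_setT _ _ _ P).
Qed.

Lemma ex_le f g : itg f -> itg g -> (forall t, f t <= g t) ->
  \int[P]_t f t <= \int[P]_t g t.
Proof. by move=> hf hg fg; apply: le_Rintegral. Qed.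

Lemma exD f g : itg f -> itg g ->
  \int[P]_t (f t + g t) = \int[P]_t f t + \int[P]_t g t.
Proof. by move=> hf hg; rewrite RintegralD. Qed.

Lemma exB f g : itg f -> itg g ->
  \int[P]_t (f t - g t) = \int[P]_t f t - \int[P]_t g t.
Proof. by move=> hf hg; rewrite RintegralB. Qed.

Lemma exZ k f : itg f -> \int[P]_t (k * f t) = k * \int[P]_t f t.
Proof. by move=> hf; rewrite RintegralZl. Qed.

Lemma ex_sum (I : Type) (s : seq I) (p : pred I) (F : I -> T -> R) :
  (forall i, p i -> itg (F i)) ->
  \int[P]_t (\sum_(i <- s | p i) F i t) = \sum_(i <- s | p i) \int[P]_t F i t.
Proof.
move=> hF; elim: s => [|i s IH].
  by under eq_Rintegral do rewrite big_nil; rewrite big_nil ex_cst.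
under eq_Rintegral do rewrite big_cons; rewrite big_cons.
by case: (boolP (p i)) => // pi; rewrite exD ?IH//; [exact: hF|exact: itg_sum].
Qed.

Lemma ex_ge0 f : (forall t, 0 <= f t) -> 0 <= \int[P]_t f t.
Proof. by move=> f0; apply: Rintegral_ge0. Qed.

Lemma ex_norm_le f : itg f -> `|\int[P]_t f t| <= \int[P]_t `|f t|.
Proof. by move=> hf; apply: le_normr_Rintegral. Qed.

Lemma ex_normB_le f g h : itg f -> itg g -> itg h ->
  (forall t, `|f t - g t| <= h t) ->
  `|\int[P]_t f t - \int[P]_t g t| <= \int[P]_t h t.
Proof.
move=> hf hg hh fgh; rewrite -exB//.
have hB : itg (fun t => f t - g t) by exact: itgB.
by apply: (le_trans (ex_norm_le hB)); apply: ex_le => //; exact: itg_norm.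
Qed.

Lemma sqitg_meas f : sqitg f -> measurable_fun setT f.
Proof. by case. Qed.

Lemma sqitg_le f g : measurable_fun setT f -> (forall t, `|f t| <= g t) ->
  sqitg g -> sqitg f.
Proof.
move=> mf fg [_ hg]; split => //; apply: itg_le hg; first exact: measurable_funX.
by move=> t; rewrite normrX lerXn2r ?nnegrE// (le_trans _ (fg t)).
Qed.

Lemma sqitgM f g : sqitg f -> sqitg g -> itg (fun t => f t * g t).
Proof.
move=> [mf hf] [mg hg]; apply: itg_le (itgD hf hg); first exact: measurable_funM.
move=> t; rewrite normrM -(real_normK (num_real (f t))).
rewrite -(real_normK (num_real (g t))).
have := normr_ge0 (f t); have := normr_ge0 (g t).
move: (`|f t|) (`|g t|) => x y y0 x0; have := sqr_ge0 (x - y).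
by have := mulr_ge0 x0 y0; lra.
Qed.

Lemma sqitg_bounded f K : measurable_fun setT f -> (forall t, `|f t| <= K) ->
  sqitg f.
Proof.
move=> mf fK; apply: (sqitg_le mf fK); split; first exact: measurable_cst.
exact: itg_cst.
Qed.

Lemma sqitg_cst k : sqitg (fun=> k).
Proof. by apply: (@sqitg_bounded _ `|k|) => //; exact: measurable_cst. Qed.

Lemma sqitg_itg f : sqitg f -> itg f.
Proof.
move=> hf; have := sqitgM hf (sqitg_cst 1).
by apply: eq_integrable => //= t _; rewrite mulr1.
Qed.

Lemma sqitgD f g : sqitg f -> sqitg g -> sqitg (fun t => f t + g t).
Proof.
move=> [mf hf] [mg hg]; have mfg := measurable_funD mf mg; split => //.
apply: itg_le (itgZ 2 (itgD hf hg)); first exact: measurable_funX.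
move=> t; rewrite ger0_norm ?sqr_ge0//.
by have := sqr_ge0 (f t - g t); lra.
Qed.

Lemma sqitgZ k f : sqitg f -> sqitg (fun t => k * f t).
Proof.
move=> [mf hf]; split; first exact: measurable_funM.
move: (itgZ (k ^+ 2) hf); apply: eq_integrable => // t _.
by rewrite /= exprMn.
Qed.

Lemma sqitgB f g : sqitg f -> sqitg g -> sqitg (fun t => f t - g t).
Proof.
move=> hf hg; have := sqitgD hf (sqitgZ (-1) hg).
by congr sqitg; apply/funext => t; rewrite mulN1r.
Qed.

Lemma sqitg_sum (I : Type) (s : seq I) (p : pred I) (F : I -> T -> R) :
  (forall i, p i -> sqitg (F i)) -> sqitg (fun t => \sum_(i <- s | p i) F i t).
Proof.
move=> hF; elim: s => [|i s IH].
  by under eq_fun do rewrite big_nil; exact: sqitg_cst.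
under eq_fun do rewrite big_cons.
by case: (boolP (p i)) => // pi; apply: sqitgD => //; exact: hF.
Qed.

Lemma sqitg_norm f : sqitg f -> sqitg (fun t => `|f t|).
Proof.
move=> [mf hf]; split; first exact: measurableT_comp.
by apply: eq_integrable hf => // t _; rewrite /= real_normK ?num_real.
Qed.

(** The discriminant of the nonnegative quadratic form
    [E (a f + b g) ^ 2] in [(a, b)] is nonpositive. *)
Lemma ex_cauchy_schwarz f g : sqitg f -> sqitg g ->
  (\int[P]_t (f t * g t)) ^+ 2
    <= (\int[P]_t f t ^+ 2) * (\int[P]_t g t ^+ 2).
Proof.
move=> hf hg; set b := \int[P]_t (f t * g t).
set a := \int[P]_t f t ^+ 2; set c := \int[P]_t g t ^+ 2.
have hfg := sqitgM hf hg; have [_ hf2] := hf; have [_ hg2] := hg.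
have q (x y : R) : 0 <= x ^+ 2 * a + (2 * x * y) * b + y ^+ 2 * c.
  have i1 := itgZ (x ^+ 2) hf2; have i2 := itgZ (2 * x * y) hfg.
  rewrite -(exZ _ hf2) -(exZ _ hfg) -(exZ _ hg2) -(exD i1 i2).
  rewrite -(exD (itgD i1 i2) (itgZ (y ^+ 2) hg2)).
  by apply: ex_ge0 => t; rewrite [X in 0 <= X](_ : _ = (x * f t + y * g t) ^+ 2) ?sqr_ge0//; ring.
have a0 : 0 <= a by apply: ex_ge0 => t; exact: sqr_ge0.
have c0 : 0 <= c by apply: ex_ge0 => t; exact: sqr_ge0.
have [c_eq0|cN0] := eqVneq c 0.
  have [->|b0] := eqVneq b 0; first by rewrite expr0n/= mulr_ge0.
  have := q 1 (- (a + 1) / (2 * b)); rewrite c_eq0.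
  suff -> : 1 ^+ 2 * a + 2 * 1 * (- (a + 1) / (2 * b)) * b +
      (- (a + 1) / (2 * b)) ^+ 2 * 0 = -1 by rewrite ler0N1.
  by field.
have := q c (- b); rewrite -subr_ge0.
rewrite (_ : _ + _ = c * (a * c - b ^+ 2)); last ring.
by rewrite pmulr_rge0// lt_neqAle eq_sym cN0.
Qed.

Lemma ex_norm_sqrt_le f : sqitg f ->
  \int[P]_t `|f t| <= Num.sqrt (\int[P]_t f t ^+ 2).
Proof.
move=> hf; have := ex_cauchy_schwarz (sqitg_norm hf) (sqitg_cst 1).
rewrite expr1n ex_cst mulr1.
under eq_Rintegral do rewrite mulr1.
under [X in _ <= X]eq_Rintegral => t _ do rewrite (real_normK (num_real (f t))).
move=> h; rewrite -[leLHS]ger0_norm ?ex_ge0// -sqrtr_sqr.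
by rewrite ler_sqrt// ex_ge0// => t; exact: sqr_ge0.
Qed.

End Expectation.

(** * Independent families *)

Section Configurations.
Context {R : realType} (J : finType).

Definition boxes : set_system (J -> R) :=
  [set B | exists2 A : J -> set R, (forall j, measurable (A j)) &
           B = [set c | forall j, A j (c j)]].

(** The boxes generate the product sigma-algebra. *)
Definition cfg : measurableType boxes.-sigma := g_sigma_algebraType boxes.

Lemma measurable_coord (j : J) : measurable_fun setT (fun c : cfg => c j).
Proof.
move=> _ A mA; rewrite setTI; apply: sub_sigma_algebra.
exists (fun i => if i == j then A else setT).
  by move=> i; case: ifP => // _; exact: measurableT.
apply/seteqP; split=> c /=; first by move=> cA i; case: eqP => // ->.
by move=> /(_ j); rewrite eqxx.
Qed.

Lemma measurable_allset d (T : measurableType d) (X : J -> T -> R)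
    (A : J -> set R) : (forall j, measurable_fun setT (X j)) ->
  (forall j, measurable (A j)) -> measurable [set t | forall j, A j (X j t)].
Proof.
move=> mX mA.
rewrite [X in measurable X](_ : _ = \bigcap_(j in setT) (X j @^-1` A j)).
  apply: fin_bigcap_measurable; first exact: finite_finset.
  by move=> j _; rewrite -[X in measurable X]setTI; exact: mX.
by apply/seteqP; split=> t /= h j; [move=> _|]; exact: h.
Qed.

Lemma measurable_cfg d (T : measurableType d) (X : J -> T -> R) :
  (forall j, measurable_fun setT (X j)) ->
  measurable_fun setT (fun t => X^~ t : cfg).
Proof.
move=> mX; apply: (@measurability _ _ _ cfg _ _ boxes) => //.
move=> _ [_ [A mA ->] <-]; rewrite setTI; exact: measurable_allset.
Qed.

End Configurations.

Arguments cfg {R} J.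

Section Independence.
Context {R : realType}.

(** The product rule for all indices at once; it contains the rule for every
    subfamily, by taking the other [A j] to be the whole line. *)
Definition indep d (T : measurableType d) (P : probability T R) (J : finType)
    (X : J -> T -> R) :=
  (forall j, measurable_fun setT (X j)) /\
  forall A : J -> set R, (forall j, measurable (A j)) ->
    P [set t | forall j, A j (X j t)] = (\prod_j P (X j @^-1` A j))%E.

Definition same_law d1 (T1 : measurableType d1) (P1 : probability T1 R)
    (X : T1 -> R) d2 (T2 : measurableType d2) (P2 : probability T2 R)
    (Y : T2 -> R) :=
  forall A : set R, measurable A -> P1 (X @^-1` A) = P2 (Y @^-1` A).

Lemma indep_inj d (T : measurableType d) (P : probability T R)
    (J J' : finType) (X : J -> T -> R) (s : J' -> J) :
  injective s -> indep P X -> indep P (fun j => X (s j)).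
Proof.
move=> sI [mX iX]; split=> [j|A mA]; first exact: mX.
pose B j : set R := if [pick j' | s j' == j] is Some j' then A j' else setT.
have Bs j' : B (s j') = A j'.
  rewrite /B; case: pickP => [j'' /eqP/sI-> //|/(_ j')]; by rewrite eqxx.
have mB j : measurable (B j).
  by rewrite /B; case: pickP => // *; exact: measurableT.
transitivity (P [set t | forall j, B j (X j t)]).
  congr (P _); apply/seteqP; split => t /= h j.
    by rewrite /B; case: pickP => // j' /eqP <-; exact: h.
  by rewrite -Bs; exact: h.
rewrite iX// (bigID (mem (s @: finset.setT)%SET))/= [X in (_ * X)%E]big1 ?mule1.
  rewrite big_imset/=; last by move=> x y _ _; exact: sI.
  by apply: eq_big => [j|j _]; [rewrite inE|rewrite Bs].
move=> j /imsetP jN; rewrite /B; case: pickP => [j' /eqP sj'|_].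
  by exfalso; apply: jN; exists j'; rewrite ?inE.
by rewrite preimage_setT probability_setT.
Qed.

Section JointLaw.
Context (J : finType) d1 (T1 : measurableType d1) d2 (T2 : measurableType d2).
Variables (P1 : probability T1 R) (P2 : probability T2 R).
Variables (X : J -> T1 -> R) (Y : J -> T2 -> R).
Hypotheses (iX : indep P1 X) (iY : indep P2 Y).
Hypothesis XY : forall j, same_law P1 (X j) P2 (Y j).

(** The boxes are stable under intersection, hence the probabilities of boxes,
    which are fixed by the marginals, determine the joint law. *)
Lemma indep_law (E : set (cfg J)) : measurable E ->
  P1 [set t | E (X^~ t)] = P2 [set t | E (Y^~ t)].
Proof.
have [mX hX] := iX; have [mY hY] := iY => mE.
pose X' : {mfun T1 >-> cfg J} :=
  HB.pack (fun t => X^~ t) (isMeasurableFun.Build _ _ _ _ _ (measurable_cfg mX)).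
pose Y' : {mfun T2 >-> cfg J} :=
  HB.pack (fun t => Y^~ t) (isMeasurableFun.Build _ _ _ _ _ (measurable_cfg mY)).
change (distribution P1 X' E = distribution P2 Y' E).
apply: (@g_sigma_algebra_measure_unique _ R (cfg J) (@boxes R J) _ (fun=> setT)
  _ _ (distribution P1 X') (distribution P2 Y') _ _ _ E mE) => //.
- by move=> B bB; exact: sub_sigma_algebra.
- move=> _; exists (fun=> setT) => [_|]; first exact: measurableT.
  by apply/seteqP; split.
- by rewrite bigcup_const.
- move=> _ _ [A mA ->] [B mB ->]; exists (fun j => A j `&` B j).
    by move=> j; exact: measurableI.
  apply/seteqP; split=> c /=; first by move=> [a b] j; split; [exact: a|exact: b].
  by move=> h; split=> j; case: (h j).
- move=> _ [A mA ->]; rewrite /distribution /pushforward /=.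
  transitivity (\prod_j P1 (X j @^-1` A j))%E; first exact: hX.
  by under eq_bigr => j _ do rewrite (XY j (mA j)); exact/esym/hY.
- by move=> _; rewrite (le_lt_trans (probability_le1 _ _))// ltry.
Qed.

Lemma indep_integral (Phi : cfg J -> \bar R) : measurable_fun setT Phi ->
  (forall c, 0 <= Phi c)%E ->
  (\int[P1]_t Phi (X^~ t) = \int[P2]_t Phi (Y^~ t))%E.
Proof.
have [mX hX] := iX; have [mY hY] := iY => mPhi Phi0.
pose X' : {mfun T1 >-> cfg J} :=
  HB.pack (fun t => X^~ t) (isMeasurableFun.Build _ _ _ _ _ (measurable_cfg mX)).
pose Y' : {mfun T2 >-> cfg J} :=
  HB.pack (fun t => Y^~ t) (isMeasurableFun.Build _ _ _ _ _ (measurable_cfg mY)).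
have := @ge0_integral_distribution _ _ _ _ _ P1 X' Phi mPhi Phi0.
have := @ge0_integral_distribution _ _ _ _ _ P2 Y' Phi mPhi Phi0.
rewrite /comp /= => <- <-; apply: eq_measure_integral => E mE _.
exact: indep_law.
Qed.

Lemma indep_itg (Phi : cfg J -> R) : measurable_fun setT Phi ->
  itg P1 (fun t => Phi (X^~ t)) -> itg P2 (fun t => Phi (Y^~ t)).
Proof.
move=> mPhi /integrableP[_ hi]; have [mY _] := iY; apply/integrableP; split.
  by apply/measurable_EFinP; apply: measurableT_comp mPhi (measurable_cfg mY).
rewrite -(indep_integral (Phi := fun c => `|(Phi c)%:E|%E))//.
by apply: measurableT_comp => //; exact/measurable_EFinP.
Qed.

(** The positive and the negative part are transferred separately, which covers
    functions that are not integrable. *)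
Lemma indep_ex (Phi : cfg J -> R) : measurable_fun setT Phi ->
  \int[P1]_t Phi (X^~ t) = \int[P2]_t Phi (Y^~ t).
Proof.
move=> mPhi; rewrite /Rintegral; congr fine.
rewrite integralE [RHS]integralE.
have mE : measurable_fun setT (EFin \o Phi) by exact/measurable_EFinP.
congr (_ - _)%E.
- rewrite (funepos_comp (EFin \o Phi) (fun t => X^~ t)).
  rewrite (funepos_comp (EFin \o Phi) (fun t => Y^~ t)).
  refine (@indep_integral (EFin \o Phi)^\+%E _ _); first exact: measurable_funepos.
  by move=> c; exact: funepos_ge0.
- rewrite (funeneg_comp (EFin \o Phi) (fun t => X^~ t)).
  rewrite (funeneg_comp (EFin \o Phi) (fun t => Y^~ t)).
  refine (@indep_integral (EFin \o Phi)^\-%E _ _); first exact: measurable_funeneg.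
  by move=> c; exact: funeneg_ge0.
Qed.

End JointLaw.

Section Doubling.
Context d (T : measurableType d) (P : probability T R).

Definition squareP : probability (T * T)%type R := (P \x P)%E.

Lemma squarePE (A B : set T) : measurable A -> measurable B ->
  squareP (A `*` B) = (P A * P B)%E.
Proof. by move=> mA mB; exact: product_measure1E. Qed.

Definition doubled (J : finType) (X : J -> T -> R) (j : J + J) (u : T * T) :=
  match j with inl j => X j u.1 | inr j => X j u.2 end.

Lemma doubled_law (J : finType) (X : J -> T -> R) :
  (forall j, measurable_fun setT (X j)) ->
  forall (j : J) (b : J + J), (b = inl j \/ b = inr j) ->
  same_law squareP (doubled X b) P (X j).
Proof.
move=> mX j b hb A mA.
have mXA : measurable (X j @^-1` A) by rewrite -[X in measurable X]setTI; exact: mX.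
case: hb => ->.
- rewrite (_ : _ @^-1` _ = (X j @^-1` A) `*` setT).
    by rewrite squarePE// ?probability_setT ?mule1//; exact: measurableT.
  by apply/seteqP; split=> -[x y] //= [].
- rewrite (_ : _ @^-1` _ = setT `*` (X j @^-1` A)).
    by rewrite squarePE// ?probability_setT ?mul1e//; exact: measurableT.
  by apply/seteqP; split=> -[x y] //= [].
Qed.

Lemma doubled_meas (J : finType) (X : J -> T -> R) :
  (forall j, measurable_fun setT (X j)) ->
  forall b, measurable_fun setT (doubled X b).
Proof.
move=> mX [j|j]; rewrite /doubled.
  by apply: measurableT_comp (mX j) _; exact: measurable_fst.
by apply: measurableT_comp (mX j) _; exact: measurable_snd.
Qed.

Lemma doubled_indep (J : finType) (X : J -> T -> R) :
  indep P X -> indep squareP (doubled X).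
Proof.
move=> [mX iX]; have mD := doubled_meas mX; split => // A mA.
rewrite (_ : [set _ | _] = [set t | forall j, A (inl j) (X j t)] `*`
    [set t | forall j, A (inr j) (X j t)]); last first.
  apply/seteqP; split=> -[x y] /=.
    by move=> h; split=> j; [exact: (h (inl j))|exact: (h (inr j))].
  by move=> [h1 h2] j; case: j => j; [exact: (h1 j)|exact: (h2 j)].
have mA1 : measurable [set t | forall j, A (inl j) (X j t)].
  exact: (measurable_allset (A := fun j => A (inl j))).
have mA2 : measurable [set t | forall j, A (inr j) (X j t)].
  exact: (measurable_allset (A := fun j => A (inr j))).
rewrite squarePE//.
rewrite (iX (fun j => A (inl j)))// (iX (fun j => A (inr j)))// big_sumType/=.
by congr (_ * _)%E; apply: eq_bigr => j _; apply/esym/(doubled_law mX) => //;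
  by [left|right].
Qed.

End Doubling.

End Independence.

Section IndependentProducts.
Context {R : realType} {d : measure_display} {T : measurableType d}.
Variable P : probability T R.

Lemma ex_square_prod (f g : T -> R) : itg P f -> itg P g ->
  \int[squareP P]_u (f u.1 * g u.2) = (\int[P]_t f t) * (\int[P]_t g t).
Proof.
move=> hf hg.
pose h (u : T * T) := (f u.1 * g u.2)%:E.
have mh : measurable_fun setT h.
  apply/measurable_EFinP/measurable_funM.
    by apply: measurableT_comp (itg_meas hf) _; exact: measurable_fst.
  by apply: measurableT_comp (itg_meas hg) _; exact: measurable_snd.
have Efin (k : T -> R) : itg P k -> (\int[P]_t (k t)%:E = (\int[P]_t k t)%:E)%E.
  by move=> hk; rewrite /Rintegral fineK//; exact: integrable_fin_num hk.
have hi : (squareP P).-integrable setT h.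
  apply/(integrable12ltyP P P mh).
  rewrite (eq_integral (fun x => (\int[P]_t `|g t| * `|f x|)%:E)); last first.
    move=> x _; rewrite mulrC -(exZ _ (itg_norm hg)).
    rewrite -(Efin _ (itgZ _ (itg_norm hg))).
    by apply: eq_integral => y _; rewrite /h /= normrM.
  by rewrite (Efin _ (itgZ _ (itg_norm hf))) ltry.
rewrite {1}/Rintegral -(integral12_prod_meas1 hi) /fubini_F /h /=.
rewrite (eq_integral (fun x => (\int[P]_t g t * f x)%:E)); last first.
  move=> x _; rewrite mulrC -(exZ _ hg) -(Efin _ (itgZ _ hg)).
  exact: eq_integral.
by rewrite (Efin _ (itgZ _ hf)) /= (exZ _ hf) mulrC.
Qed.

Definition depends_on (J : finType) (N : {set J}) (Phi : (J -> R) -> R) :=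
  forall c c' : J -> R, (forall j, j \in N -> c j = c' j) -> Phi c = Phi c'.

(** Redrawing the coordinates outside N from an independent copy does not
    change the joint law. *)
Lemma indep_exM (J : finType) (X : J -> T -> R) (N N' : {set J})
    (Phi Psi : cfg J -> R) :
  indep P X -> measurable_fun setT Phi -> measurable_fun setT Psi ->
  depends_on N Phi -> depends_on N' Psi -> (forall j, j \in N -> j \notin N') ->
  itg P (fun t => Phi (X^~ t)) -> itg P (fun t => Psi (X^~ t)) ->
  \int[P]_t (Phi (X^~ t) * Psi (X^~ t)) =
  (\int[P]_t Phi (X^~ t)) * (\int[P]_t Psi (X^~ t)).
Proof.
move=> iX mPhi mPsi dPhi dPsi dN hPhi hPsi.
pose s j : J + J := if j \in N then inl j else inr j.
have sI : injective s.
  by move=> x y; rewrite /s; case: ifP; case: ifP => // _ _ [].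
have iXs := indep_inj sI (doubled_indep iX).
have lXs j : same_law P (X j) (squareP P) (doubled X (s j)).
  suff h : same_law (squareP P) (doubled X (s j)) P (X j).
    by move=> A mA; rewrite (h A mA).
  by apply: doubled_law; [exact: (proj1 iX)|rewrite /s; case: ifP; [left|right]].
rewrite -ex_square_prod//.
rewrite (indep_ex iX iXs lXs (Phi := fun c => Phi c * Psi c)); last first.
  exact: measurable_funM.
apply: eq_Rintegral => u _; congr (_ * _).
  by apply: dPhi => j jN; rewrite /s jN.
apply: dPsi => j jN'; rewrite /s ifF//.
by apply/negP => /dN; rewrite jN'.
Qed.

End IndependentProducts.

(** * Covariances through one-coordinate resampling *)

Section Mixing.
Context {R : realType} {I : finType}.

(** The sum type [I + I] indexes a family on I followed by a second copy of
    it; A is the set of coordinates that are read in the second copy. *)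
Definition mix (A : {set I}) (i : I) : I + I := if i \in A then inr i else inl i.

Definition before (k : I) : {set I} :=
  [set i | (enum_rank i < enum_rank k)%N]%SET.

Lemma mix_inj (A : {set I}) : injective (mix A).
Proof. by move=> x y; rewrite /mix; case: ifP; case: ifP => // _ _ []. Qed.

Lemma notin_before k : k \notin before k.
Proof. by rewrite inE ltnn. Qed.

Lemma mix_set0 : mix finset.set0 = inl.
Proof. by apply/funext => i; rewrite /mix inE. Qed.

Lemma mix_setT : mix finset.setT = inr.
Proof. by apply/funext => i; rewrite /mix inE. Qed.

Lemma mix_out (A : {set I}) (k i : I) : i != k ->
  mix (k |: A)%SET i = mix A i.
Proof. by move=> ik; rewrite /mix in_setU1 (negbTE ik). Qed.

(** The sets [before k], in the order of the enumeration of I, increase by one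
    element at a time from the empty set to the full set. *)
Lemma telescope_mix (V : zmodType) (f : {set I} -> V) :
  \sum_k (f (before k) - f (k |: before k)%SET) =
  f finset.set0 - f finset.setT.
Proof.
pose B j : {set I} := [set i | (enum_rank i < j)%N]%SET.
rewrite (reindex (fun j : 'I_#|I| => enum_val j)) /=; last first.
  by exists enum_rank => ? _; [exact: enum_valK|exact: enum_rankK].
transitivity (\sum_(j < #|I|) (f (B j) - f (B j.+1))).
  apply: eq_bigr => j _; congr (f _ - f _).
    by apply/setP => i; rewrite !inE enum_valK.
  apply/setP => i; rewrite !inE enum_valK ltnS [RHS]leq_eqVlt; congr (_ || _).
  by apply/eqP/eqP => [->|/val_inj <-]; rewrite ?enum_valK ?enum_rankK.
rewrite -(big_mkord xpredT (fun j => f (B j) - f (B j.+1))).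
rewrite -[LHS]opprK -sumrN; under eq_bigr do rewrite opprB.
rewrite telescope_sumr// opprB; congr (f _ - f _); apply/setP => i; rewrite !inE//.
by rewrite ltn_ord.
Qed.

Definition coord_lipschitz (f : (I -> R) -> R) := forall (k : I) (c c' : I -> R),
  (forall i, i != k -> c i = c' i) -> `|f c - f c'| <= `|c k - c' k|.

(** The coordinates are set to 0 one after the other. *)
Lemma coord_lipschitz_growth f (c : I -> R) : coord_lipschitz f ->
  `|f c| <= `|f (fun=> 0)| + \sum_k `|c k|.
Proof.
move=> lf; pose e (b : I + I) : R := if b is inl k then c k else 0.
have /(_ (fun A => f (fun i => e (mix A i)))) := @telescope_mix R.
rewrite mix_set0 mix_setT /= => he.
rewrite -[X in `|X| <= _](subrK (f (fun=> 0))) addrC.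
apply: (le_trans (ler_normD _ _)); rewrite lerD2l.
rewrite -he; apply: (le_trans (ler_norm_sum _ _ _)); apply: ler_sum => k _.
apply: (le_trans (lf k _ _ _)) => [i ik|]; first by rewrite mix_out.
by rewrite /mix (negbTE (notin_before k)) setU11 /= subr0.
Qed.

End Mixing.

Section Resampling.
Context {R : realType} {d : measure_display} {T : measurableType d}.
Variable P : probability T R.
Context {I : finType}.
Variable X : I + I -> T -> R.
Hypothesis iX : indep P X.
Hypothesis lX : forall i, same_law P (X (inl i)) P (X (inr i)).
Implicit Types (f g : @cfg R I -> R) (A : {set I}) (k : I).

Definition at_mix f A t := f (fun i => X (mix A i) t).

Lemma same_law_mix A i : same_law P (X (inl i)) P (X (mix A i)).
Proof. by rewrite /mix; case: ifP => // _ B mB; exact: lX. Qed.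

Lemma measurable_at_mix f A : measurable_fun setT f ->
  measurable_fun setT (at_mix f A).
Proof.
move=> mf; have mX i : measurable_fun setT (X (mix A i)) by exact: (proj1 iX).
exact: measurableT_comp mf (measurable_cfg mX).
Qed.

Lemma ex_at_mix f A : measurable_fun setT f ->
  \int[P]_t at_mix f A t = \int[P]_t at_mix f finset.set0 t.
Proof.
move=> mf; apply/esym.
have := @indep_ex _ I _ _ _ _ P P _ _ (indep_inj (@mix_inj I finset.set0) iX)
  (indep_inj (@mix_inj I A) iX) _ f mf.
by apply => j; rewrite mix_set0; exact: same_law_mix.
Qed.

Lemma itg_at_mix f A : measurable_fun setT f ->
  itg P (at_mix f finset.set0) -> itg P (at_mix f A).
Proof.
move=> mf; apply: (@indep_itg _ I _ _ _ _ P P _ _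
  (indep_inj (@mix_inj I finset.set0) iX) (indep_inj (@mix_inj I A) iX) _ f mf).
by move=> j; rewrite mix_set0; exact: same_law_mix.
Qed.

Lemma sqitg_at_mix f A : measurable_fun setT f ->
  sqitg P (at_mix f finset.set0) -> sqitg P (at_mix f A).
Proof.
move=> mf [_ hf]; split; first exact: measurable_at_mix.
apply: (itg_at_mix (f := fun c => f c ^+ 2)) => //; exact: measurable_funX.
Qed.

Definition swap k (b : I + I) : I + I :=
  match b with
  | inl i => if i == k then inr i else inl i
  | inr i => if i == k then inl i else inr i
  end.

Lemma swapK k : involutive (swap k).
Proof. by move=> [i|i] /=; case: (eqVneq i k) => /= [->|/negbTE ik]; rewrite ?eqxx ?ik. Qed.

Lemma swap_mix k A : k \notin A -> swap k \o mix A = mix (k |: A)%SET.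
Proof.
move=> kA; apply/funext => i /=; rewrite /mix in_setU1.
case: (eqVneq i k) => [->|ik] /=; first by rewrite (negbTE kA)/= eqxx.
by case: ifP => _ /=; rewrite (negbTE ik).
Qed.

Lemma swap_mixU k A : k \notin A -> swap k \o mix (k |: A)%SET = mix A.
Proof.
by move=> kA; rewrite -swap_mix//; apply/funext => i /=; rewrite swapK.
Qed.

(** Exchanging the two copies of coordinate k preserves the joint law. *)
Lemma ex_swap k (Phi : @cfg R (I + I)%type -> R) : measurable_fun setT Phi ->
  \int[P]_t Phi (X^~ t) = \int[P]_t Phi (fun b => X (swap k b) t).
Proof.
move=> mPhi; apply: indep_ex => //; first exact: indep_inj (inv_inj (swapK k)) iX.
move=> [i|i] B mB /=; case: ifP => // _; first exact: lX.
exact/esym/lX.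
Qed.

Lemma measurable_mix_cfg f A : measurable_fun setT f ->
  measurable_fun setT (fun c : @cfg R (I + I)%type => f (fun i => c (mix A i))).
Proof.
move=> mf; apply: measurableT_comp mf (measurable_cfg _) => i.
exact: measurable_coord.
Qed.

(** Exchanging the two copies of k changes the sign of the increment of f and
    turns the value of g into the one with k resampled; the right-hand side is
    the mean of the two expressions. *)
Lemma ex_resample f g k A : k \notin A ->
  measurable_fun setT f -> measurable_fun setT g ->
  sqitg P (at_mix f finset.set0) -> sqitg P (at_mix g finset.set0) ->
  \int[P]_t (at_mix g finset.set0 t *
    (at_mix f A t - at_mix f (k |: A)%SET t)) =
  2^-1 * \int[P]_t ((at_mix g finset.set0 t - at_mix g [set k]%SET t) *
    (at_mix f A t - at_mix f (k |: A)%SET t)).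
Proof.
move=> kA mf mg hf hg.
have hfd : sqitg P (fun t => at_mix f A t - at_mix f (k |: A)%SET t).
  by apply: sqitgB; exact: sqitg_at_mix.
have hgk := sqitg_at_mix [set k]%SET mg hg.
have e : \int[P]_t (at_mix g finset.set0 t *
    (at_mix f A t - at_mix f (k |: A)%SET t)) =
  - \int[P]_t (at_mix g [set k]%SET t *
    (at_mix f A t - at_mix f (k |: A)%SET t)).
  rewrite (ex_swap k (Phi := fun c => g (fun i => c (mix finset.set0 i)) *
    (f (fun i => c (mix A i)) - f (fun i => c (mix (k |: A)%SET i))))); last first.
    by apply: measurable_funM; [|apply: measurable_funB]; exact: measurable_mix_cfg.
  rewrite -mulN1r -exZ; last exact: sqitgM.
  apply: eq_Rintegral => t _; rewrite mulN1r -mulrN opprB; congr (_ * (_ - _)).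
  - congr g; apply/funext => i; rewrite -[swap _ _]/((swap k \o _) i).
    by rewrite swap_mix ?inE// finset.setU0.
  - congr f; apply/funext => i; rewrite -[swap _ _]/((swap k \o _) i).
    by rewrite swap_mix.
  - congr f; apply/funext => i; rewrite -[swap _ _]/((swap k \o _) i).
    by rewrite swap_mixU.
under [in RHS]eq_Rintegral do rewrite mulrBl.
rewrite exB; [|exact: sqitgM..].
have half (x y : R) : x = - y -> x = 2^-1 * (x - y) by lra.
exact: half.
Qed.

(** The increments of f telescope from the first copy to the second copy of
    the whole family, which is independent of g. *)
Lemma ex_cov_resample f g :
  measurable_fun setT f -> measurable_fun setT g ->
  sqitg P (at_mix f finset.set0) -> sqitg P (at_mix g finset.set0) ->
  \int[P]_t (at_mix g finset.set0 t * at_mix f finset.set0 t) -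
    (\int[P]_t at_mix g finset.set0 t) * (\int[P]_t at_mix f finset.set0 t) =
  \sum_k 2^-1 * \int[P]_t ((at_mix g finset.set0 t - at_mix g [set k]%SET t) *
    (at_mix f (before k) t - at_mix f (k |: before k)%SET t)).
Proof.
move=> mf mg hf hg.
under eq_bigr => k _ do rewrite -(ex_resample (notin_before k))//.
rewrite -ex_sum => [|k _]; last first.
  by apply: sqitgM => //; apply: sqitgB; exact: sqitg_at_mix.
under [RHS]eq_Rintegral => t _ do
  rewrite -mulr_sumr (telescope_mix (fun A => at_mix f A t)) mulrBr.
rewrite exB; [|by apply: sqitgM => //; exact: sqitg_at_mix..].
congr (_ - _); rewrite -(ex_at_mix finset.setT mf) /at_mix.
rewrite -(@indep_exM _ _ _ P _ X
  [set b : I + I | if b is inl _ then true else false]%SET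
  [set b : I + I | if b is inl _ then false else true]%SET
  (fun c => g (fun i => c (mix finset.set0 i)))
  (fun c => f (fun i => c (mix finset.setT i))))//.
- exact: measurable_mix_cfg.
- exact: measurable_mix_cfg.
- by move=> c c' h; congr g; apply/funext => i; apply: h; rewrite mix_set0 inE.
- by move=> c c' h; congr f; apply/funext => i; apply: h; rewrite mix_setT inE.
- by move=> [i|i]; rewrite !inE.
- exact: sqitg_itg.
- by apply: sqitg_itg; exact: (sqitg_at_mix finset.setT).
Qed.

End Resampling.

(** * Stein's equation *)

Section SteinEquation.
Context {R : realType}.
Local Notation mu := (@lebesgue_measure R).
Local Notation pdf := (@normal_pdf R 0 1).

Lemma mean_value (f df : R -> R) (x y : R) :
  (forall z : R, is_derive z 1 f (df z)) ->
  exists2 z, `|x - z| <= `|x - y| & f y - f x = df z * (y - x).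
Proof.
move=> fdf; wlog xy : x y / x <= y => [hw|].
  case: (leP x y) => [/hw//|/ltW yx];
  have := @MVT_segment R f df y x yx (fun z _ => fdf z) _.
  case=> [|z]; last first.
    rewrite in_itv/= => /andP[yz zx] e; exists z; last by rewrite -opprB e; ring.
    by rewrite !ger0_norm ?subr_ge0// lerD2l lerN2.
  apply: derivable_within_continuous => u _; exact: ex_derive.
have := @MVT_segment R f df x y xy (fun z _ => fdf z) _.
case=> [|z]; last first.
  rewrite in_itv/= => /andP[yz zx] e; exists z => //.
  by rewrite distrC [leRHS]distrC !ger0_norm ?subr_ge0// lerD2r.
apply: derivable_within_continuous => u _; exact: ex_derive.
Qed.

Lemma lipschitz_continuous (h : R -> R) (L : R) : 0 <= L ->
  (forall x y, `|h x - h y| <= L * `|x - y|) -> continuous h.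
Proof.
move=> L0 hL x; apply/cvgrPdist_lt => e e0.
have L1 : 0 < L + 1 by rewrite ltr_wpDl.
have e1 : 0 < (L + 1)^-1 * e by rewrite mulr_gt0 ?invr_gt0.
have /cvgrPdist_lt/(_ _ e1) := @cvg_id _ (nbhs x).
apply: filterS => y; rewrite ltr_pdivlMl// => xy.
apply: (le_lt_trans (hL x y)); apply: le_lt_trans xy.
by rewrite ler_wpM2r// lerDl.
Qed.

Lemma lipschitz_derive (f df : R -> R) (C : R) :
  (forall z : R, is_derive z 1 f (df z)) -> (forall z, `|df z| <= C) ->
  forall x y, `|f x - f y| <= C * `|x - y|.
Proof.
move=> fdf dfC x y; have [z _ e] := mean_value y x fdf.
by rewrite e normrM ler_wpM2r.
Qed.

Lemma taylor1_lipschitz (f df : R -> R) (C : R) : 0 <= C ->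
  (forall z : R, is_derive z 1 f (df z)) ->
  (forall x y, `|df x - df y| <= C * `|x - y|) ->
  forall x y, `|f x - f y - df x * (x - y)| <= C * (x - y) ^+ 2.
Proof.
move=> C0 fdf dfC x y; have [z zxy e] := mean_value x y fdf.
have -> : f x - f y - df x * (x - y) = (df z - df x) * (x - y).
  by rewrite -[f x - f y]opprB e; ring.
rewrite normrM -[(x - y) ^+ 2]real_normK ?num_real// expr2 mulrA ler_wpM2r//.
by rewrite (le_trans (dfC _ _))// ler_wpM2l// distrC.
Qed.

Lemma pdf_gt0 x : 0 < pdf x.
Proof.
rewrite normal_pdfE ?oner_neq0//.
by rewrite mulr_gt0 ?expR_gt0// normal_peak_gt0 ?oner_neq0.
Qed.

Lemma pdf_inv x : (pdf x)^-1 = (normal_peak 1)^-1 * expR (x ^+ 2 / 2).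
Proof.
rewrite normal_pdfE ?oner_neq0// /normal_fun invfM -expRN.
by congr (_ * expR _); rewrite subr0 expr1n mulNr opprK.
Qed.

Lemma pdf_le1 x : pdf x <= 1.
Proof.
apply: (le_trans (normal_pdf_ub _ _ (oner_neq0 R))).
rewrite /normal_peak expr1n mul1r invf_le1.
  rewrite -[leLHS]sqrtr1 ler_sqrt; last by rewrite mulrn_wge0// pi_ge0.
  by have := @pi_ge2 R; lra.
by rewrite sqrtr_gt0 mulrn_wgt0// pi_gt0.
Qed.

Lemma integrable_pdfM (h : R -> R) (H : R) (D : set R) : measurable D ->
  measurable_fun setT h -> (forall x, `|h x| <= H) ->
  mu.-integrable D (EFin \o (fun x => h x * pdf x)).
Proof.
move=> mD mh hH; apply: (@integrableS _ _ _ _ setT) => //.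
apply: (le_integrable _ _ _ (integrableZl measurableT H (integrable_normal_pdf 0 1))) => //.
  by apply/measurable_EFinP/measurable_funM => //; exact: measurable_normal_pdf.
move=> x _ /=; rewrite lee_fin !normrM ler_wpM2r//.
by rewrite (le_trans (hH x))// ler_norm.
Qed.

Definition gauss_ex (h : R -> R) : R := \int[mu]_x (h x * pdf x).

Section Solution.
Variables (h : R -> R) (B L : R).
Hypotheses (B0 : 0 <= B) (L0 : 0 <= L).
Hypothesis hB : forall x, B <= `|x| -> h x = 0.
Hypothesis hL : forall x y, `|h x - h y| <= L * `|x - y|.
Hypothesis h1 : forall x, `|h x| <= L.
Hypothesis h_mean0 : gauss_ex h = 0.

Let h_cont : continuous h. Proof. exact: lipschitz_continuous L0 hL. Qed.

Let mh : measurable_fun setT h. Proof. exact: continuous_measurable_fun. Qed.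

Let F x : R := \int[mu]_(y in `]-oo, x]) (h y * pdf y).

Let F_derive (x : R) : is_derive x 1 F (h x * pdf x).
Proof.
have cont : {for x, continuous (fun y : R => h y * pdf y)}.
  by apply: cvgM; [exact: h_cont|exact: continuous_normal_pdf].
have [] := @continuous_FTC1 R (fun y => h y * pdf y) (BInfty _ true) x (x + 1) _ _ _ cont.
- by rewrite ltrDl.
- exact: (integrable_pdfM _ mh h1).
- by rewrite ltNyr.
by move=> dF eF; apply: DeriveDef => //; rewrite -eF derive1E.
Qed.

Let F_left (x : R) : x <= - B -> F x = 0.
Proof.
move=> xB; transitivity (\int[mu]_(y in `]-oo, x]) (0 : R)).
  apply: eq_Rintegral => y; rewrite inE/= in_itv/= => yx; rewrite hB ?mul0r//.
  by rewrite ler_normr lerNr (le_trans yx) ?orbT.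
by rewrite Rintegral_cst// mul0r.
Qed.

Let F_right (x : R) : B <= x -> F x = 0.
Proof.
move=> xB; rewrite -h_mean0 /gauss_ex /F Rintegral_mkcond.
apply: eq_Rintegral => y _; rewrite patchE; case: ifPn => // /negP.
rewrite inE/= in_itv/= => /negP; rewrite -ltNge => xy; rewrite hB ?mul0r//.
by rewrite ler_normr (le_trans xB) ?(ltW xy).
Qed.

Let G x : R := (pdf x)^-1 * F x.

Let pdf_inv_derive (x : R) : is_derive x 1 (fun y => (pdf y)^-1) (x * (pdf x)^-1).
Proof.
have -> : (fun y => (pdf y)^-1) = (normal_peak 1)^-1 *: (expR \o (fun y : R => y ^+ 2 / 2)).
  by apply/funext => y; rewrite pdf_inv.
rewrite pdf_inv mulrCA -[X in is_derive _ _ _ X]/(_ *: _).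
apply: is_deriveZ; rewrite mulrC; apply: is_derive1_comp.
have -> : (fun y : R => y ^+ 2 / 2) = 2^-1 *: (fun y : R => y ^+ 2).
  by apply/funext => y; rewrite mulrC.
have e : x = 2^-1 *: (x *: 1 + x *: 1) :> R.
  by rewrite /GRing.scale /= !mulr1; lra.
rewrite [X in is_derive _ _ _ X]e.
apply: is_deriveZ.
Qed.

Let G_derive (x : R) : is_derive x 1 G (x * G x + h x).
Proof.
have -> : x * G x + h x = (pdf x)^-1 *: (h x * pdf x) + F x *: (x * (pdf x)^-1).
  have := pdf_gt0 x; rewrite /G /GRing.scale /= => p0.
  by field; rewrite gt_eqF.
by apply: is_deriveM.
Qed.

Let G_out x : B <= `|x| -> G x = 0.
Proof.
rewrite ler_normr => /orP[|] xB; rewrite /G.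
  by rewrite F_right ?mulr0.
by rewrite F_left ?mulr0// lerNr.
Qed.

Let G_bounded : exists M, forall x, `|G x| <= M.
Proof.
have cG : {within `[(- B), B], continuous G}.
  by apply: derivable_within_continuous => u _; exact: ex_derive.
have BB : - B <= B by rewrite (le_trans _ B0)// oppr_le0.
have cN : {within `[(- B), B], continuous (fun x => `|G x|)}.
  by move=> x; apply: cvg_norm; exact: cG.
have [c _ hc] := EVT_max BB cN.
exists (`|G c|) => x; case: (leP B `|x|) => [/G_out ->|xB]; first by rewrite normr0.
by apply: hc; rewrite in_itv/= -ler_norml ltW.
Qed.

(** The solution [G x], the integral of [h * pdf] up to x divided by [pdf x],
    vanishes outside the support of h because h is centred; so compactness
    bounds G and its derivative [x * G x + h x]. *)
Lemma stein_solution : exists (g g' : R -> R) (C : R),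
  [/\ continuous g, continuous g', forall x, g' x - x * g x = h x &
   [/\ forall x, `|g x| <= C, forall x, `|g' x| <= C,
    forall x y, `|g x - g y| <= C * `|x - y| &
    forall x y, `|g x - g y - g' x * (x - y)| <= C * (x - y) ^+ 2]].
Proof.
have [M hM] := G_bounded; have M0 : 0 <= M by rewrite (le_trans _ (hM 0)).
pose g' x := x * G x + h x.
have xG x : `|x * G x| <= B * M.
  case: (leP B `|x|) => [/G_out ->|xB]; first by rewrite mulr0 normr0 mulr_ge0.
  by rewrite normrM ler_pM// ltW.
have g'b x : `|g' x| <= B * M + L.
  by rewrite (le_trans (ler_normD _ _))// lerD.
have BM0 : 0 <= B * M by rewrite mulr_ge0.
have BML0 : 0 <= B * M + L by rewrite addr_ge0.
have GL := lipschitz_derive G_derive g'b.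
have xGL x y : `|x * G x - y * G y| <= (M + B * (B * M + L)) * `|x - y|.
  wlog yB : x y / `|y| <= B => [hw|].
    case: (leP `|y| B) => [/hw//|yB].
    case: (leP `|x| B) => [xB|xB].
      by rewrite distrC [`|x - y|]distrC; exact: hw.
    by rewrite !G_out ?(ltW xB) ?(ltW yB)// !mulr0 subr0 normr0 mulr_ge0 ?addr_ge0 ?mulr_ge0.
  rewrite (_ : _ - _ = (x - y) * G x + y * (G x - G y)); last by ring.
  rewrite [leRHS]mulrDl; apply: (le_trans (ler_normD _ _)); apply: lerD.
    by rewrite normrM mulrC ler_wpM2r.
  by rewrite normrM -mulrA ler_pM.
set C := M + B * (B * M + L) in xGL.
have C0 : 0 <= C by rewrite addr_ge0 ?mulr_ge0.
have g'L x y : `|g' x - g' y| <= (C + L) * `|x - y|.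
  rewrite /g' opprD addrACA [leRHS]mulrDl.
  by apply: (le_trans (ler_normD _ _)); apply: lerD.
have cG : continuous G.
  by move=> x; apply/differentiable_continuous/derivable1_diffP; exact: ex_derive.
exists G, g', (M + (B * M + L) + (C + L)); split => //.
- move=> x; apply: cvgD; last exact: h_cont.
  by apply: cvgM; [exact: cvg_id|exact: cG].
- by move=> x; rewrite /g' addrAC subrr add0r.
have CL0 : 0 <= C + L by rewrite addr_ge0.
split.
- by move=> x; rewrite (le_trans (hM x))//; lra.
- by move=> x; rewrite (le_trans (g'b x))//; lra.
- move=> x y; rewrite (le_trans (GL x y))// ler_wpM2r//; lra.
- move=> x y; rewrite (le_trans (taylor1_lipschitz _ G_derive g'L x y))// ler_wpM2r ?sqr_ge0//; lra.
Qed.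

End Solution.

End SteinEquation.

(** * Comparison of distribution functions through test functions *)

Section GaussianComparison.
Context {R : realType}.
Local Notation mu := (@lebesgue_measure R).
Local Notation pdf := (@normal_pdf R 0 1).

(** The same constant L serves as a Lipschitz constant and as a bound. *)
Definition test_fun (h : R -> R) := exists B L : R,
  [/\ 0 <= B, 0 <= L, forall x, B <= `|x| -> h x = 0,
      forall x y, `|h x - h y| <= L * `|x - y| & forall x, `|h x| <= L].

Lemma test_fun_measurable h : test_fun h -> measurable_fun setT h.
Proof.
move=> [B [L [_ L0 _ hL _]]]; apply: continuous_measurable_fun.
exact: lipschitz_continuous hL.
Qed.

Lemma test_funB h1 h2 k : test_fun h1 -> test_fun h2 ->
  test_fun (fun x => h1 x - k * h2 x).
Proof.
move=> [B1 [L1 [B10 L10 hB1 hL1 h11]]] [B2 [L2 [B20 L20 hB2 hL2 h12]]].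
exists (B1 + B2), (L1 + `|k| * L2); split.
- by rewrite addr_ge0.
- by rewrite addr_ge0// mulr_ge0.
- move=> x Bx; rewrite hB1 ?hB2 ?mulr0 ?subr0//.
    by rewrite (le_trans _ Bx)// lerDr.
  by rewrite (le_trans _ Bx)// lerDl.
- move=> x y; rewrite (_ : _ - _ - _ = (h1 x - h1 y) - k * (h2 x - h2 y)); last by ring.
  rewrite [leRHS]mulrDl; apply: (le_trans (ler_normB _ _)); apply: lerD => //.
  by rewrite normrM -mulrA ler_wpM2l.
- move=> x; apply: (le_trans (ler_normB _ _)); apply: lerD => //.
  by rewrite normrM ler_wpM2l.
Qed.

(** The function that is 1 between a and b, is 0 from the distance eta to them on
    and is affine in between. *)
Definition trapezoid (a b eta y : R) : R :=
  Num.max 0 (Num.min 1 (Num.min ((y - a) / eta + 1) ((b - y) / eta + 1))).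

Lemma clip_lipschitz (x y : R) :
  `|Num.max 0 (Num.min 1 x) - Num.max 0 (Num.min 1 y)| <= `|x - y|.
Proof.
wlog xy : x y / x <= y => [hw|].
  by case: (leP x y) => [/hw//|/ltW/hw]; rewrite distrC [leRHS]distrC.
rewrite [leRHS]distrC [leRHS]ger0_norm ?subr_ge0// ler_norml.
rewrite /Num.max /Num.min; case: (ltP 1 x) => ?; case: (ltP 1 y) => ?.
- by case: (ltP 0 1) => ?; apply/andP; split; lra.
- by case: (ltP 0 1) => ?; case: (ltP 0 y) => ?; apply/andP; split; lra.
- by case: (ltP 0 1) => ?; case: (ltP 0 x) => ?; apply/andP; split; lra.
- by case: (ltP 0 y) => ?; case: (ltP 0 x) => ?; apply/andP; split; lra.
Qed.

Lemma min_opposite_lipschitz (u w t : R) :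
  `|Num.min u w - Num.min (u + t) (w - t)| <= `|t|.
Proof.
rewrite ler_norml /Num.min.
have := ler_norm t; have := ler_norm (- t); rewrite normrN => ? ?.
by case: (ltP u w) => ?; case: (ltP (u + t) (w - t)) => ?; apply/andP; split; lra.
Qed.

Section Trapezoid.
Variables (a b eta : R).
Hypothesis eta0 : 0 < eta.

Lemma trapezoid_ge0 y : 0 <= trapezoid a b eta y.
Proof. by rewrite /trapezoid le_max lexx. Qed.

Lemma trapezoid_le1 y : trapezoid a b eta y <= 1.
Proof. by rewrite /trapezoid ge_max ler01 ge_min lexx. Qed.

Lemma trapezoid_norm_le1 y : `|trapezoid a b eta y| <= 1.
Proof. by rewrite ger0_norm ?trapezoid_ge0 ?trapezoid_le1. Qed.

Lemma trapezoid1 y : a <= y <= b -> trapezoid a b eta y = 1.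
Proof.
move=> /andP[ay yb]; rewrite /trapezoid (min_l (y := Num.min _ _)) ?max_r//.
by rewrite le_min !lerDr !mulr_ge0 ?subr_ge0// invr_ge0 ltW.
Qed.

Lemma trapezoid0 y : y <= a - eta \/ b + eta <= y -> trapezoid a b eta y = 0.
Proof.
move=> ho; apply: max_l; rewrite !ge_min -!lerBrDr sub0r.
case: ho => h; apply/orP; right; apply/orP; [left|right];
by rewrite ler_pdivrMr// mulN1r; lra.
Qed.

Lemma test_fun_trapezoid : test_fun (trapezoid a b eta).
Proof.
have e0 : 0 <= eta^-1 by rewrite invr_ge0 ltW.
exists (`|a| + `|b| + eta), (eta^-1 + 1); split.
- by rewrite !addr_ge0// ltW.
- by rewrite addr_ge0.
- move=> y hy; apply: trapezoid0.
  have := ler_norm b; have := ler_norm (- a); rewrite normrN => *.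
  move: hy; rewrite ler_normr => /orP[|] ?; [right|left].
    by have := normr_ge0 a; lra.
  by have := normr_ge0 b; lra.
- move=> x y; rewrite /trapezoid.
  have -> : (y - a) / eta + 1 = (x - a) / eta + 1 + (y - x) / eta by ring.
  have -> : (b - y) / eta + 1 = (b - x) / eta + 1 - (y - x) / eta by ring.
  apply: (le_trans (clip_lipschitz _ _)).
  apply: (le_trans (min_opposite_lipschitz _ _ _)).
  rewrite normrM [X in _ * X]ger0_norm// mulrC distrC ler_wpM2r//.
  by rewrite lerDl.
- by move=> y; rewrite (le_trans (trapezoid_norm_le1 y))// lerDr.
Qed.

End Trapezoid.

Lemma gauss_ex_le (f g : R -> R) (C : R) :
  measurable_fun setT f -> measurable_fun setT g ->
  (forall x, `|f x| <= C) -> (forall x, `|g x| <= C) ->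
  (forall x, f x <= g x) -> gauss_ex f <= gauss_ex g.
Proof.
move=> mf mg fC gC fg; apply: le_Rintegral => //.
- exact: integrable_pdfM mf fC.
- exact: integrable_pdfM mg gC.
- by move=> x _; rewrite ler_wpM2r// ltW// pdf_gt0.
Qed.

Lemma gauss_exD (f g : R -> R) (C : R) :
  measurable_fun setT f -> measurable_fun setT g ->
  (forall x, `|f x| <= C) -> (forall x, `|g x| <= C) ->
  gauss_ex (fun x => f x + g x) = gauss_ex f + gauss_ex g.
Proof.
move=> mf mg fC gC; rewrite /gauss_ex -RintegralD//.
- by apply: eq_Rintegral => x _; rewrite mulrDl.
- exact: integrable_pdfM mf fC.
- exact: integrable_pdfM mg gC.
Qed.

Lemma gauss_exZ k (f : R -> R) (C : R) :
  measurable_fun setT f -> (forall x, `|f x| <= C) ->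
  gauss_ex (fun x => k * f x) = k * gauss_ex f.
Proof.
move=> mf fC; rewrite /gauss_ex -RintegralZl//.
- by apply: eq_Rintegral => x _; rewrite mulrA.
- exact: integrable_pdfM mf fC.
Qed.

Lemma gauss_ex1 : gauss_ex (fun _ : R => 1 : R) = 1.
Proof.
rewrite /gauss_ex; under eq_Rintegral do rewrite mul1r.
by rewrite /Rintegral integral_normal_pdf.
Qed.

Lemma gauss_ex_indic (A : set R) : measurable A ->
  gauss_ex \1_A = fine (@normal_prob R 0 1 A).
Proof.
move=> mA; have -> : fine (normal_prob 0 1 A) = \int[mu]_(x in A) pdf x by [].
rewrite [RHS]Rintegral_mkcond /gauss_ex.
apply: eq_Rintegral => x _; rewrite patchE indicE.
by case: (x \in A); rewrite ?mul1r ?mul0r.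
Qed.

Lemma indic_le1 (U : Type) (A : set U) x : `|(\1_A x : R)| <= 1.
Proof. by rewrite indicE; case: (x \in A); rewrite ?normr1 ?normr0. Qed.

(** The density is at most 1. *)
Lemma normal_cdf_modulus x eta : 0 <= eta ->
  fine (@normal_prob R 0 1 `]-oo, x + eta]) <=
  fine (@normal_prob R 0 1 `]-oo, x]) + eta :> R.
Proof.
move=> eta0.
rewrite -!gauss_ex_indic//.
apply: (@le_trans _ _ (gauss_ex (fun y => \1_`]-oo, x] y + \1_`]x, x + eta] y))).
  apply: (@gauss_ex_le _ _ 2).
  - exact: measurable_indic.
  - by apply: measurable_funD; exact: measurable_indic.
  - by move=> y; rewrite (le_trans (indic_le1 _ _))// ler1n.
  - move=> y; apply: (le_trans (ler_normD _ _)).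
    by rewrite (_ : 2 = 1 + 1)// lerD// indic_le1.
  - move=> y; rewrite !indicE !mem_setE !in_itv/=.
    by case: (leP y x) => _; case: (leP y (x + eta)) => _ /=; rewrite ?addr0 ?add0r.
rewrite (gauss_exD (C := 1)); [|exact: measurable_indic|exact: measurable_indic|exact: indic_le1|exact: indic_le1].
rewrite lerD2l.
apply: (@le_trans _ _ (\int[mu]_y (\1_`]x, x + eta] y : R))).
  apply: le_Rintegral => //.
  - by apply: (@integrable_pdfM _ _ 1) => //; exact: indic_le1.
  - exact: integrable_indic_itv.
  - by move=> y _; rewrite ler_piMr// pdf_le1.
rewrite /Rintegral integral_indic// setIT.
rewrite [X in fine X](lebesgue_measure_itv `]x, (x + eta)]) /= lte_fin.
by case: ifP => _ //=; rewrite addrAC subrr add0r.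
Qed.

(** The second condition is what makes Chebyshev's inequality give the same
    tail bound for every variable of second moment at most 1. *)
Lemma gauss_tight (eps : R) : 0 < eps -> exists A : R,
  [/\ 0 < A, A ^- 2 <= eps & 1 - eps <= fine (@normal_prob R 0 1 `[- A, A]%classic)].
Proof.
move=> e0; pose I (n : nat) : set R := `[- n%:R, n%:R]%classic.
have cvgI : (normal_prob 0 1 \o I) n @[n --> \oo] --> (@normal_prob R 0 1 setT).
  have -> : setT = \bigcup_n I n.
    apply/esym/seteqP; split => // x _; exists (Num.truncn `|x|).+1 => //.
    by rewrite /I /= in_itv/= -ler_norml ltW// truncnS_gt.
  have mI n : measurable (I n) by exact: measurable_itv.
  apply: nondecreasing_cvg_mu => //; first exact: bigcupT_measurable.
  move=> m n mn; apply/subsetPset => x; rewrite /I /= !in_itv/= -!ler_norml => h.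
  by rewrite (le_trans h)// ler_nat.
rewrite probability_setT in cvgI; move/fine_cvgP : cvgI => [_ cvgI].
have h1 : \forall n \near \oo, 1 - eps < fine (normal_prob 0 1 (I n)).
  by apply: (cvgr_gt _ cvgI); rewrite ltrBlDr ltrDl.
have h2 : \forall n \near \oo, (n%:R : R) ^- 2 < eps.
  exists (Num.truncn (eps^-1 + 1)).+1 => // n /= hn.
  have : eps^-1 + 1 < n%:R.
    by rewrite (lt_le_trans (truncnS_gt _))// ler_nat.
  have ei : 0 < eps^-1 by rewrite invr_gt0.
  move=> hh; rewrite -[eps]invrK ltf_pV2 ?posrE// ?exprn_gt0//; last by lra.
  by rewrite expr2; nra.
have h3 : \forall n \near \oo, (0 < n)%N by exists 1%N.
near \oo => n; exists n%:R; split.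
- by rewrite ltr0n; near: n.
- by apply: ltW; near: n.
- by apply: ltW; near: n.
Unshelve. all: by end_near. Qed.

End GaussianComparison.

Lemma indic_ray (R : realType) (T : Type) (W : T -> R) (x : R) t :
  \1_(W @^-1` `]-oo, x]) t = (W t <= x)%R%:R :> R.
Proof. by rewrite indicE; congr (nat_of_bool _)%:R; apply/idP/idP; rewrite inE /= in_itv. Qed.

Section Plateau.
Context {R : realType}.
Implicit Types (x eps A : R).

Lemma itg_test_fun d (T : measurableType d) (P : probability T R) (W : T -> R)
    (h : R -> R) : measurable_fun setT W -> test_fun h ->
  itg P (fun t => h (W t)).
Proof.
move=> mW th; have [B [L [_ _ _ _ hL]]] := th.
apply: (@itg_bounded _ _ _ _ _ L) => //.
exact: measurableT_comp (test_fun_measurable th) mW.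
Qed.

Lemma itg_indic d (T : measurableType d) (P : probability T R) (B : set T) :
  measurable B -> itg P \1_B.
Proof.
by move=> mB; apply: (@itg_bounded _ _ _ _ _ 1); [exact: measurable_indic|exact: indic_le1].
Qed.

Lemma ex_indic d (T : measurableType d) (P : probability T R) (B : set T) :
  measurable B -> \int[P]_t \1_B t = fine (P B).
Proof. by move=> mB; rewrite /Rintegral integral_indic// setIT. Qed.

(** Subtracting from a test function the right multiple of a wide plateau
    centres it, at a cost controlled by the tails of W alone. *)
Lemma plateau_balance A eps (u : R -> R) : 0 < A -> 0 < eps <= 4^-1 ->
  A ^- 2 <= eps -> 1 - eps <= fine (@normal_prob R 0 1 `[- A, A]%classic) ->
  test_fun u -> (forall y, 0 <= u y <= 1) ->
  exists h : R -> R, [/\ test_fun h, gauss_ex h = 0 &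
    forall d (T : measurableType d) (P : probability T R) (W : T -> R),
    sqitg P W -> \int[P]_t W t ^+ 2 <= 1 ->
    `|\int[P]_t u (W t) - gauss_ex u - \int[P]_t h (W t)| <= 2 * eps].
Proof.
move=> A0 /andP[e0 e4] Ae hA tu u01.
have tv := test_fun_trapezoid (- A) A (@ltr01 R).
set v := trapezoid (- A) A 1 in tv.
have mv := test_fun_measurable tv; have mu := test_fun_measurable tu.
have v1 y : `|v y| <= 1 by exact: trapezoid_norm_le1.
have u1 y : `|u y| <= 1 by have /andP[? ?] := u01 y; rewrite ger0_norm.
have gv1 : gauss_ex v <= 1.
  rewrite -gauss_ex1; apply: (gauss_ex_le (C := 1)) => //.
    by move=> _; rewrite normr1.
  by move=> y; exact: trapezoid_le1.
have gve : 1 - eps <= gauss_ex v.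
  apply: (le_trans hA); rewrite -gauss_ex_indic//.
  apply: (gauss_ex_le (C := 1)) => //; first exact: indic_le1.
  move=> y; rewrite indicE mem_setE in_itv/=.
  case: (boolP (_ && _)) => h; last exact: trapezoid_ge0.
  by rewrite /v trapezoid1.
have gu1 : gauss_ex u <= 1.
  rewrite -gauss_ex1; apply: (gauss_ex_le (C := 1)) => //.
    by move=> _; rewrite normr1.
  by move=> y; have /andP[] := u01 y.
have gu0 : 0 <= gauss_ex u.
  apply: Rintegral_ge0 => y _; rewrite mulr_ge0 ?normal_pdf_ge0//.
  by have /andP[] := u01 y.
pose lam := gauss_ex u / gauss_ex v.
have gv0 : 0 < gauss_ex v by lra.
have lam_gv : lam * gauss_ex v = gauss_ex u by rewrite divfK// gt_eqF.
have lam0 : 0 <= lam by rewrite mulr_ge0// invr_ge0 ltW.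
exists (fun y => u y - lam * v y); split; first exact: test_funB.
  rewrite -[LHS](_ : gauss_ex (fun y => u y + (- lam) * v y) = _); last first.
    by congr gauss_ex; apply/funext => y; rewrite mulNr.
  rewrite (gauss_exD (C := 1 + lam)) //.
  - rewrite (gauss_exZ _ mv v1) mulNr lam_gv subrr//.
  - exact: measurable_funM.
  - by move=> y; rewrite (le_trans (u1 y))// lerDl.
  - move=> y; rewrite normrM normrN (ger0_norm lam0).
    by rewrite (@le_trans _ _ lam)// ?lerDr// ler_piMr.
move=> d T P W hW W1; have [mW hW2] := hW.
have iu := itg_test_fun P mW tu; have iv := itg_test_fun P mW tv.
rewrite (exB iu (itgZ lam iv)) (exZ _ iv).
set Ev := \int[P]_t v (W t).
have Ev1 : Ev <= 1.
  rewrite -(ex_cst P 1); apply: ex_le => //; first exact: itg_cst.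
  by move=> t; exact: trapezoid_le1.
have Eve : 1 - eps <= Ev.
  apply: (@le_trans _ _ (\int[P]_t (1 - A ^- 2 * W t ^+ 2))).
    rewrite (exB (itg_cst P 1) (itgZ _ hW2)) ex_cst (exZ _ hW2) lerD2l lerN2.
    by rewrite (le_trans _ Ae)// ler_piMr// invr_ge0 sqr_ge0.
  apply: ex_le => //; first exact: itgB (itg_cst P 1) (itgZ _ hW2).
  move=> t; case: (boolP (- A <= W t <= A)) => h.
    rewrite /v trapezoid1// gerBl mulr_ge0 ?sqr_ge0// invr_ge0 sqr_ge0//.
  apply: (le_trans _ (trapezoid_ge0 _ _ _ _)).
  rewrite subr_le0 mulrC ler_pdivlMr ?exprn_gt0// mul1r.
  rewrite -ler_norml -ltNge in h.
  by rewrite -(real_normK (num_real (W t))) lerXn2r ?nnegrE// ltW.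
rewrite (_ : _ - _ - _ = lam * (Ev - gauss_ex v)); last by rewrite mulrBr lam_gv; ring.
have lam2 : lam <= 2 by rewrite /lam ler_pdivrMr//; lra.
rewrite normrM (ger0_norm lam0) ler_pM//.
by rewrite ler_norml; apply/andP; split; lra.
Qed.

(** Up to the small mass on the left of [- A], the indicator function of the
    ray lies between two trapezoids whose Gaussian means are close to its own;
    [plateau_balance] centres them. *)
Lemma cdf_comparison x eps : 0 < eps <= 4^-1 ->
  exists h1 h2 : R -> R, [/\ test_fun h1, test_fun h2,
    gauss_ex h1 = 0, gauss_ex h2 = 0 &
    forall d (T : measurableType d) (P : probability T R) (W : T -> R),
    sqitg P W -> \int[P]_t W t ^+ 2 <= 1 ->
    fine (@normal_prob R 0 1 `]-oo, x]) - 5 * eps + \int[P]_t h1 (W t)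
    <= fine (P (W @^-1` `]-oo, x])) <=
    fine (@normal_prob R 0 1 `]-oo, x]) + 5 * eps + \int[P]_t h2 (W t)].
Proof.
move=> /andP[e0 e4]; have [A [A0 Ae hA]] := gauss_tight e0.
have e04 : 0 < eps <= 4^-1 by rewrite e0.
pose u1 := trapezoid (- A) (x - eps) eps; pose u2 := trapezoid (- A) x eps.
have u01 a b y : 0 <= trapezoid a b eps y <= 1.
  by rewrite trapezoid_ge0 trapezoid_le1.
have t1 := test_fun_trapezoid (- A) (x - eps) e0.
have t2 := test_fun_trapezoid (- A) x e0.
have [h1 [th1 gh1 hh1]] := plateau_balance A0 e04 Ae hA t1 (u01 _ _).
have [h2 [th2 gh2 hh2]] := plateau_balance A0 e04 Ae hA t2 (u01 _ _).
exists h1, h2; split => // d T P W hW W1.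
have [mW hW2] := hW.
have mB : measurable (W @^-1` `]-oo, x]) by rewrite -[X in measurable X]setTI; exact: mW.
have i1 := itg_test_fun P mW t1; have i2 := itg_test_fun P mW t2.
have := hh1 _ _ P W hW W1; rewrite ler_norml => /andP[k1 k1'].
have := hh2 _ _ P W hW W1; rewrite ler_norml => /andP[k2 k2'].
have m1 := test_fun_measurable t1; have m2 := test_fun_measurable t2.
have P2 : fine (P (W @^-1` `]-oo, x])) <= eps + \int[P]_t u2 (W t).
  rewrite -ex_indic//.
  apply: (@le_trans _ _ (\int[P]_t (A ^- 2 * W t ^+ 2 + u2 (W t)))).
    apply: ex_le => [||t]; [exact: itg_indic|exact: itgD (itgZ _ hW2) i2|].
    have aW : 0 <= A ^- 2 * W t ^+ 2.
      by rewrite mulr_ge0 ?sqr_ge0// invr_ge0 sqr_ge0.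
    have u20 : 0 <= u2 (W t) by exact: trapezoid_ge0.
    rewrite indic_ray.
    case: (leP (W t) x) => Wx /=; last first.
      exact: addr_ge0.
    case: (leP (- A) (W t)) => AW.
      by rewrite /u2 trapezoid1 ?AW// lerDr.
    apply: (@le_trans _ _ (A ^- 2 * W t ^+ 2)); last by rewrite lerDl.
    rewrite mulrC ler_pdivlMr ?exprn_gt0// mul1r -(sqrrN (W t)).
    by rewrite lerXn2r ?nnegrE; lra.
  rewrite (exD (itgZ _ hW2) i2) (exZ _ hW2) lerD2r.
  by rewrite (le_trans _ Ae)// ler_piMr// invr_ge0 sqr_ge0.
have P1 : \int[P]_t u1 (W t) <= fine (P (W @^-1` `]-oo, x])).
  rewrite -ex_indic//; apply: ex_le => [||t]; [by []|exact: itg_indic|].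
  rewrite indic_ray.
  case: (leP (W t) x) => Wx /=; first exact: trapezoid_le1.
  by rewrite /u1 trapezoid0//; right; lra.
have G2 : gauss_ex u2 <= fine (@normal_prob R 0 1 `]-oo, x]) + eps.
  apply: le_trans (normal_cdf_modulus x (ltW e0)).
  rewrite -gauss_ex_indic//; apply: (gauss_ex_le (C := 1)) => //.
  - by move=> y; exact: trapezoid_norm_le1.
  - exact: indic_le1.
  move=> y; rewrite indicE mem_setE /= in_itv /=.
  case: (leP y (x + eps)) => Wx /=; first exact: trapezoid_le1.
  by rewrite /u2 trapezoid0//; right; lra.
have G1 : fine (@normal_prob R 0 1 `]-oo, x]) <= gauss_ex u1 + 2 * eps.
  have := normal_cdf_modulus (x - eps) (ltW e0); rewrite subrK => h.
  apply: (le_trans h); rewrite mulr_natl mulr2n addrA lerD2r.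
  have mI : measurable `[- A, A]%classic by exact: measurable_itv.
  rewrite -lerBlDr; apply: (@le_trans _ _ (gauss_ex (\1_`]-oo, (x - eps)]) + gauss_ex \1_`[(- A), A]%classic - 1)).
    by rewrite !gauss_ex_indic//; lra.
  rewrite lerBlDr -gauss_ex1.
  rewrite -(gauss_exD (C := 1)) //; [|exact: measurable_indic..|exact: indic_le1|exact: indic_le1].
  rewrite -(gauss_exD (C := 1)) //; last 2 first.
  - by move=> y; exact: trapezoid_norm_le1.
  - by move=> y; rewrite normr1.
  apply: (gauss_ex_le (C := 2)).
  - by apply: measurable_funD; exact: measurable_indic.
  - exact: measurable_funD.
  - move=> y; rewrite (le_trans (ler_normD _ _))// (_ : 2 = 1 + 1)// lerD// indic_le1//.
  - move=> y; rewrite (le_trans (ler_normD _ _))// (_ : 2 = 1 + 1)// lerD ?normr1//.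
    exact: trapezoid_norm_le1.
  move=> y; rewrite !indicE !mem_setE /= !in_itv /=.
  have u0 := trapezoid_ge0 (- A) (x - eps) eps y.
  case: (leP y (x - eps)) => yx /=; last by case: (_ && _) => /=; rewrite /u1; lra.
  case: (boolP (_ && _)) => /= [/andP[Ay _]|_]; last by rewrite /u1; lra.
  by rewrite /u1 trapezoid1 ?Ay.
by apply/andP; split; rewrite /u1 /u2 in P1 P2 G1 G2; lra.
Qed.

End Plateau.

(** * Normal approximation for functions of independent coordinates *)

Section LocalSums.
Context {R : realType} {d : measure_display} {T : measurableType d}.
Variable P : probability T R.

(** Terms whose sets of coordinates are disjoint are uncorrelated, so that the
    variance of the sum is of order [#|K| * B]. *)
Lemma local_sum_concentration (J K : finType) (X : J -> T -> R)
    (u : K -> @cfg R J -> R) (N : K -> {set J}) (C : R) (B : nat) :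
  indep P X -> 0 <= C ->
  (forall k, measurable_fun setT (u k)) -> (forall k c, `|u k c| <= C) ->
  (forall k, depends_on (N k) (u k)) ->
  (forall k, (#|[set l | N k :&: N l != finset.set0]%SET| <= B)%N) ->
  \int[P]_t `|\sum_k u k (X^~ t) - \sum_k \int[P]_t u k (X^~ t)|
    <= 2 * C * Num.sqrt (#|K| * B)%:R.
Proof.
move=> iX C0 mu uC du NB.
have mX := measurable_cfg (proj1 iX).
pose U k t := u k (X^~ t).
have mU k : measurable_fun setT (U k) by exact: measurableT_comp (mu k) mX.
have UC k t : `|U k t| <= C by exact: uC.
have iU k : itg P (U k) by exact: itg_bounded (mU k) (UC k).
pose V k t := U k t - \int[P]_t U k t.
have EC k : `|\int[P]_t U k t| <= C.
  apply: (le_trans (ex_norm_le (iU k))); rewrite -[leRHS](ex_cst P).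
  by apply: ex_le => //; [exact: itg_norm|exact: itg_cst].
have VC k t : `|V k t| <= 2 * C.
  by rewrite (le_trans (ler_normB _ _))// mulr_natl mulr2n lerD.
have mV k : measurable_fun setT (V k).
  by apply: measurable_funB => //; exact: measurable_cst.
have sV k : sqitg P (V k) by exact: sqitg_bounded (mV k) (VC k).
rewrite (_ : (fun t => _) = (fun t => `|\sum_k V k t|)); last first.
  by apply/funext => t; rewrite -sumrB.
apply: (le_trans (ex_norm_sqrt_le (sqitg_sum _ (fun k _ => sV k)))).
rewrite -[2 * C]ger0_norm ?mulr_ge0// -sqrtr_sqr -sqrtrM ?sqr_ge0//.
rewrite ler_sqrt ?mulr_ge0 ?sqr_ge0//.
rewrite (_ : (fun t => _) = (fun t => \sum_k \sum_l V k t * V l t)); last first.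
  apply/funext => t; rewrite expr2 mulr_suml; apply: eq_bigr => k _.
  by rewrite mulr_sumr.
rewrite ex_sum => [|k _]; last by apply: itg_sum => l _; exact: sqitgM.
have VV0 k l : N k :&: N l = finset.set0 -> \int[P]_t (V k t * V l t) = 0.
  move=> kl; rewrite /V /U.
  rewrite (@indep_exM _ _ _ P J X (N k) (N l)
    (fun c => u k c - \int[P]_t u k (X^~ t))
    (fun c => u l c - \int[P]_t u l (X^~ t)) iX).
  - by rewrite (exB (iU k) (itg_cst P _)) ex_cst subrr mul0r.
  - by apply: measurable_funB => //; exact: measurable_cst.
  - by apply: measurable_funB => //; exact: measurable_cst.
  - by move=> c c' h; rewrite (du k c c').
  - by move=> c c' h; rewrite (du l c c').
  - move=> j jk; apply/negP => jl.
    by move/setP : kl => /(_ j); rewrite !inE jk jl.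
  - exact: sqitg_itg (sV k).
  - exact: sqitg_itg (sV l).
rewrite [leRHS](_ : _ = \sum_(k : K) (2 * C) ^+ 2 * B%:R); last first.
  by rewrite sumr_const natrM -[RHS]mulr_natr -mulrA [B%:R * _]mulrC.
apply: ler_sum => k _; rewrite ex_sum => [|l _]; last exact: sqitgM.
apply: (@le_trans _ _ (\sum_(l | N k :&: N l != finset.set0) (2 * C) ^+ 2)).
  rewrite [leLHS](bigID (fun l => N k :&: N l != finset.set0))/=.
  rewrite [X in _ + X]big1 ?addr0; last by move=> l /negPn/eqP; exact: VV0.
  apply: ler_sum => l _; rewrite -[leRHS](ex_cst P); apply: ex_le => //.
  - exact: sqitgM.
  - exact: itg_cst.
  - move=> t; apply: (le_trans (ler_norm _)); rewrite normrM expr2.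
    by apply: ler_pM.
rewrite sumr_const -[X in X <= _]mulr_natr ler_wpM2l ?sqr_ge0// ler_nat.
by apply: leq_trans (NB k); rewrite cardsE.
Qed.

End LocalSums.

Section SteinBound.
Context {R : realType} {d : measure_display} {T : measurableType d}.
Variable P : probability T R.
Context {I : finType}.
Variable X : I + I -> T -> R.
Hypothesis iX : indep P X.
Hypothesis lX : forall i, same_law P (X (inl i)) P (X (inr i)).
Hypothesis sX : forall b, sqitg P (X b).
Variable f : @cfg R I -> R.
Hypothesis mf : measurable_fun setT f.
Hypothesis lf : coord_lipschitz f.

Local Notation F A := (at_mix X f A).

Definition amplitude k t : R := `|X (inl k) t| + `|X (inr k) t|.

Definition jump k (A : {set I}) t : R := F A t - F (k |: A)%SET t.

(** Its mean is the contribution of k to the variance of F. *)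
Definition exchange_term k t : R :=
  2^-1 * (jump k finset.set0 t * jump k (before k) t).

Lemma amplitude_ge0 k t : 0 <= amplitude k t.
Proof. by rewrite addr_ge0. Qed.

Lemma jump_le k (A : {set I}) t : k \notin A -> `|jump k A t| <= amplitude k t.
Proof.
move=> kA; apply: (le_trans (lf (k := k) _)) => [i ik|].
  by rewrite mix_out.
by rewrite /mix (negbTE kA) setU11 ler_normB.
Qed.

Lemma sqitg_amplitude k : sqitg P (amplitude k).
Proof. by apply: sqitgD; apply: sqitg_norm. Qed.

Lemma itg_amplitude_tail (K : R) k :
  itg P (fun t => amplitude k t ^+ 2 * (K < amplitude k t)%R%:R).
Proof.
have [ma ia2] := sqitg_amplitude k.
apply: (itg_le _ _ ia2) => [|t]; last first.
  rewrite normrM ger0_norm ?sqr_ge0// ler_piMr ?sqr_ge0//.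
  by case: (_ < _)%R; rewrite ?normr1 ?normr0.
apply: measurable_funM; first exact: measurable_funX.
rewrite (_ : (fun t => _) = \1_(amplitude k @^-1` `]K, +oo[)).
  by apply: measurable_indic; rewrite -[X in measurable X]setTI; exact: ma.
apply/funext => t; rewrite indicE; congr (nat_of_bool _)%:R.
by apply/idP/idP; rewrite inE /= in_itv /= andbT.
Qed.

Lemma sqitg_at_set0 : sqitg P (F finset.set0).
Proof.
have mF := measurable_at_mix (X := X) iX finset.set0 mf.
apply: (sqitg_le mF (g := fun t => `|f (fun=> 0)| + \sum_k `|X (inl k) t|)).
  by move=> t; rewrite /at_mix mix_set0; exact: coord_lipschitz_growth.
apply: sqitgD; first exact: sqitg_cst.
by apply: sqitg_sum => k _; exact: sqitg_norm.
Qed.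

Lemma sqitg_at A : sqitg P (F A).
Proof. by apply: sqitg_at_mix => //; exact: sqitg_at_set0. Qed.

Lemma sqitg_jump k A : sqitg P (jump k A).
Proof. by apply: sqitgB; exact: sqitg_at. Qed.

Lemma itg_exchange_term k : itg P (exchange_term k).
Proof. by apply: itgZ; apply: sqitgM; exact: sqitg_jump. Qed.

Let m := \int[P]_t F finset.set0 t.
Let v := \int[P]_t F finset.set0 t ^+ 2 - m ^+ 2.

Lemma ex_exchange_sum : \sum_k \int[P]_t exchange_term k t = v.
Proof.
rewrite /v /m; under eq_Rintegral do rewrite expr2.
rewrite expr2 (ex_cov_resample iX lX mf mf sqitg_at_set0 sqitg_at_set0).
apply: eq_bigr => k _; rewrite -exZ.
  by apply: eq_Rintegral => t _; rewrite /exchange_term /jump finset.setU0.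
by apply: sqitgM; apply: sqitgB; exact: sqitg_at.
Qed.

Section Bound.
Variables (eta c K M CU : R) (B : nat).
Variables (u : I -> @cfg R (I + I)%type -> R) (N : I -> {set I + I}).
Hypotheses (eta0 : 0 <= eta) (c0 : 0 < c) (K0 : 0 <= K) (CU0 : 0 <= CU).
Hypothesis I0 : (0 < #|I|)%N.
Hypothesis v_ge : c * #|I|%:R <= v.
Hypothesis amp2 : forall k, \int[P]_t amplitude k t ^+ 2 <= M.
Hypothesis amp_tail : forall k,
  \int[P]_t (amplitude k t ^+ 2 * (K < amplitude k t)%R%:R) <= eta.
Hypothesis mu : forall k, measurable_fun setT (u k).
Hypothesis u_le : forall k c, `|u k c| <= CU.
Hypothesis u_loc : forall k, depends_on (N k) (u k).
Hypothesis N_le : forall k,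
  (#|[set l | N k :&: N l != finset.set0]%SET| <= B)%N.
Hypothesis u_close : forall k,
  \int[P]_t `|exchange_term k t - u k (X^~ t)| <= eta.

Lemma itg_local k : itg P (fun t => u k (X^~ t)).
Proof.
apply: (@itg_bounded _ _ _ _ _ CU) => [|t]; last exact: u_le.
exact: measurableT_comp (mu k) (measurable_cfg (proj1 iX)).
Qed.

Lemma exchange_concentration :
  \int[P]_t `|\sum_k exchange_term k t - v| <=
  2 * eta * #|I|%:R + 2 * CU * Num.sqrt (#|I| * B)%:R.
Proof.
have iT := itg_exchange_term; have iU := itg_local.
pose r k t : R := `|exchange_term k t - u k (X^~ t)|.
have ir k : itg P (r k) by apply: itg_norm; exact: itgB.
pose w t : R := `|\sum_k u k (X^~ t) - \sum_k \int[P]_t u k (X^~ t)|.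
have iw : itg P w.
  by apply: itg_norm; apply: itgB; [exact: itg_sum|exact: itg_cst].
apply: (@le_trans _ _ (\int[P]_t (\sum_k r k t + (#|I|%:R * eta + w t)))).
  apply: ex_le => [||t].
  - by apply: itg_norm; apply: itgB; [exact: itg_sum|exact: itg_cst].
  - apply: itgD; first exact: itg_sum.
    by apply: itgD => //; exact: itg_cst.
  rewrite -ex_exchange_sum /w.
  have split3 (a a' b b' : R) : a - b = (a - a') + ((b' - b) + (a' - b')) by ring.
  rewrite (split3 _ (\sum_k u k (X^~ t)) _ (\sum_k \int[P]_t u k (X^~ t))).
  apply: (le_trans (ler_normD _ _)); apply: lerD.
    by rewrite -sumrB; exact: ler_norm_sum.
  apply: (le_trans (ler_normD _ _)); rewrite lerD2r -sumrB.
  apply: (le_trans (ler_norm_sum _ _ _)).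
  rewrite [leRHS](_ : _ = \sum_(k : I) eta); last by rewrite sumr_const mulr_natl.
  apply: ler_sum => k _; rewrite distrC; apply: le_trans (u_close k).
  by apply: ex_normB_le => //; exact: ir.
rewrite exD; [|exact: itg_sum|by apply: itgD => //; exact: itg_cst].
rewrite (exD (itg_cst P _) iw) ex_cst ex_sum// addrA lerD//.
  have -> : 2 * eta * #|I|%:R = #|I|%:R * eta + #|I|%:R * eta by ring.
  rewrite lerD2r.
  rewrite [leRHS](_ : _ = \sum_(k : I) eta); last by rewrite sumr_const mulr_natl.
  by apply: ler_sum => k _; exact: u_close.
exact: local_sum_concentration.
Qed.

Definition standardized t : R := (F finset.set0 t - m) / Num.sqrt v.

Variables (g g' : R -> R) (C : R).
Hypotheses (cg : continuous g) (cg' : continuous g').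
Hypotheses (gC : forall x, `|g x| <= C) (g'C : forall x, `|g' x| <= C).
Hypothesis gL : forall x y, `|g x - g y| <= C * `|x - y|.
Hypothesis g2 : forall x y, `|g x - g y - g' x * (x - y)| <= C * (x - y) ^+ 2.

(** In the resampling formula for the covariance of F and [g W], replace the
    increment of g by its first-order expansion. The main term is [g' W] times
    the exchange sum, which is close to its mean v; the error is of third order
    in the amplitudes, or of second order where they are large. *)
Lemma stein_bound :
  `|\int[P]_t (g' (standardized t) - standardized t * g (standardized t))| <=
  C * ((2 * eta * #|I|%:R + 2 * CU * Num.sqrt (#|I| * B)%:R) / v +
       #|I|%:R * (K * M / Num.sqrt v + 2 * eta) / v).
Proof.
have n0 : 0 < #|I|%:R :> R by rewrite ltr0n.
have v0 : 0 < v by apply: lt_le_trans v_ge; rewrite mulr_gt0.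
set s := Num.sqrt v; have s0 : 0 < s by rewrite sqrtr_gt0.
have sv : s ^+ 2 = v by rewrite sqr_sqrtr// ltW.
have C0 : 0 <= C by rewrite (le_trans _ (gC 0)).
have mg : measurable_fun setT g by exact: continuous_measurable_fun.
have mg' : measurable_fun setT g' by exact: continuous_measurable_fun.
pose G (x : @cfg R I) : R := g ((f x - m) / s).
have mG : measurable_fun setT G.
  apply: measurableT_comp mg _; apply: measurable_funM; last exact: measurable_cst.
  by apply: measurable_funB => //; exact: measurable_cst.
have sG A : sqitg P (at_mix X G A).
  by apply: (@sqitg_bounded _ _ _ _ _ C) => [|t]; [exact: (measurable_at_mix iX)|exact: gC].
pose W t := standardized t.
have mW : measurable_fun setT W.
  apply: measurable_funM; last exact: measurable_cst.
  apply: measurable_funB; last exact: measurable_cst.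
  exact: sqitg_meas (sqitg_at _).
have sg'W : sqitg P (fun t => g' (W t)).
  by apply: (@sqitg_bounded _ _ _ _ _ C) => [|t]; [exact: measurableT_comp mg' mW|exact: g'C].
have iWg : itg P (fun t => W t * at_mix X G finset.set0 t).
  apply: sqitgM => //; rewrite /W /standardized.
  under eq_fun do rewrite mulrC.
  by apply: sqitgZ; apply: sqitgB; [exact: sqitg_at|exact: sqitg_cst].
pose S t := \sum_k exchange_term k t.
have iS : itg P S by apply: itg_sum => k _; exact: itg_exchange_term.
have ig'J k : itg P (fun t => g' (W t) * exchange_term k t).
  apply: (itg_le _ _ (itgZ C (itg_norm (itg_exchange_term k)))) => [|t].
    by apply: measurable_funM; [exact: sqitg_meas sg'W|exact: itg_meas (itg_exchange_term k)].
  by rewrite normrM ler_wpM2r.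
pose J k := jump k finset.set0; pose J' k := jump k (before k).
have J'a k t : `|J' k t| <= amplitude k t by exact: jump_le (notin_before k).
have Ja k t : `|J k t| <= amplitude k t by apply: jump_le; rewrite inE.
(* The error of the first-order expansion of g when k alone is resampled. *)
pose rho k t := at_mix X G finset.set0 t - at_mix X G [set k]%SET t - g' (W t) * (J k t / s).
have Js k t : J k t / s = (F finset.set0 t - m) / s - (F [set k]%SET t - m) / s.
  by rewrite /J /jump finset.setU0 -mulrBl; congr (_ / _); ring.
have rho2 k t : `|rho k t| <= C * (J k t / s) ^+ 2.
  by rewrite /rho Js; exact: g2.
have rho1 k t : `|rho k t| <= 2 * C * `|J k t / s|.
  rewrite mulr_natl mulr2n mulrDl (le_trans (ler_normB _ _))// lerD//.
    by rewrite Js; exact: gL.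
  by rewrite normrM ler_wpM2r.
have srho k : sqitg P (rho k).
  have mrho : measurable_fun setT (rho k).
    apply: measurable_funB.
      by apply: measurable_funB; exact: sqitg_meas (sG _).
    apply: measurable_funM; first exact: sqitg_meas sg'W.
    by apply: measurable_funM; [exact: sqitg_meas (sqitg_jump k _)|exact: measurable_cst].
  apply: (sqitg_le mrho (rho1 k)); apply: sqitgZ; apply: sqitg_norm.
  by under eq_fun do rewrite mulrC; apply: sqitgZ; exact: sqitg_jump.
have srJ k : itg P (fun t => rho k t * J' k t).
  by apply: sqitgM => //; exact: sqitg_jump.
have cov := ex_cov_resample iX lX mf mG sqitg_at_set0 (sG _).
have key : \int[P]_t (g' (W t) - W t * at_mix X G finset.set0 t) =
    v^-1 * (\int[P]_t (g' (W t) * (v - S t))) -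
    \sum_k (2 * s)^-1 * \int[P]_t (rho k t * J' k t).
  have ig'S : itg P (fun t => g' (W t) * S t).
    by under eq_fun do rewrite mulr_sumr; exact: itg_sum.
  have e1 : \int[P]_t (g' (W t) * (v - S t)) =
      v * \int[P]_t g' (W t) - \sum_k \int[P]_t (g' (W t) * exchange_term k t).
    rewrite -exZ; last exact: sqitg_itg.
    rewrite -ex_sum// -exB; [|by apply: itgZ; exact: sqitg_itg|exact: itg_sum].
    by apply: eq_Rintegral => t _; rewrite mulrBr [_ * v]mulrC mulr_sumr.
  have e2 : \int[P]_t (W t * at_mix X G finset.set0 t) =
      s^-1 * (\int[P]_t (at_mix X G finset.set0 t * F finset.set0 t) -
              (\int[P]_t at_mix X G finset.set0 t) * m).
    have iGF : itg P (fun t => at_mix X G finset.set0 t * F finset.set0 t).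
      by apply: sqitgM => //; exact: sqitg_at.
    rewrite [_ * m]mulrC -exZ; last exact: sqitg_itg.
    rewrite -exB//; last by apply: itgZ; exact: sqitg_itg.
    rewrite -exZ; last by apply: itgB => //; apply: itgZ; exact: sqitg_itg.
    by apply: eq_Rintegral => t _; rewrite /W /standardized -/s; ring.
  have e3 k : \int[P]_t ((at_mix X G finset.set0 t - at_mix X G [set k]%SET t) *
      (F (before k) t - F (k |: before k)%SET t)) =
      \int[P]_t (rho k t * J' k t) +
      2 * s^-1 * \int[P]_t (g' (W t) * exchange_term k t).
    rewrite -exZ// -exD//; last exact: itgZ.
    apply: eq_Rintegral => t _; rewrite /rho /exchange_term /J' /J /jump.
    by field; rewrite gt_eqF.
  rewrite exB//; last exact: sqitg_itg.
  rewrite e1 mulrBr mulKf ?gt_eqF// -addrA -opprD; congr (_ - _).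
  rewrite e2 cov mulr_sumr mulr_sumr -big_split/=; apply: eq_bigr => k _.
  rewrite e3 mulrA mulrDr addrC -sv; congr (_ + _).
    by field; rewrite gt_eqF.
  by rewrite mulrA; congr (_ * _); field; rewrite gt_eqF.
rewrite -/W [X in `|X|]key.
apply: (le_trans (ler_normB _ _)); rewrite mulrDr lerD//.
  rewrite normrM ger0_norm ?invr_ge0 ?(ltW v0)// [X in _ <= _ * X]mulrC mulrCA.
  rewrite ler_wpM2l ?invr_ge0 ?(ltW v0)//.
  apply: (@le_trans _ _ (\int[P]_t (C * `|S t - v|))); last first.
    rewrite exZ; last by apply: itg_norm; apply: itgB => //; exact: itg_cst.
    by rewrite ler_wpM2l// exchange_concentration.
  have iSv : itg P (fun t => S t - v) by apply: itgB => //; exact: itg_cst.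
  have ig'v : itg P (fun t => g' (W t) * (v - S t)).
    apply: (itg_le _ _ (itgZ C (itg_norm iSv))) => [|t].
      apply: measurable_funM; first exact: sqitg_meas sg'W.
      by apply: measurable_funB; [exact: measurable_cst|exact: itg_meas iS].
    by rewrite normrM [`|S t - v|]distrC ler_wpM2r.
  apply: (le_trans (ex_norm_le ig'v)); apply: ex_le => [||t].
  - exact: itg_norm.
  - exact/itgZ/itg_norm.
  by rewrite normrM [`|S t - v|]distrC ler_wpM2r.
apply: (le_trans (ler_norm_sum _ _ _)).
rewrite [leRHS](_ : _ = \sum_(k : I) (C * (K * M / s + 2 * eta) / v)); last first.
  by rewrite sumr_const -[RHS]mulr_natl; ring.
apply: ler_sum => k _.
have sa := sqitg_amplitude k; have [ma ia2] := sa.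
have tail_itg := itg_amplitude_tail K k.
apply: (@le_trans _ _ ((2 * s)^-1 * \int[P]_t (C * (K * v^-1 * amplitude k t ^+ 2 +
    2 * s^-1 * (amplitude k t ^+ 2 * (K < amplitude k t)%R%:R))))).
  have s20 : 0 <= (2 * s)^-1 by rewrite invr_ge0 mulr_ge0// ltW.
  rewrite normrM (ger0_norm s20) ler_wpM2l//.
  apply: (le_trans (ex_norm_le (srJ k))); apply: ex_le => [||t].
  - exact: itg_norm.
  - by apply: itgZ; apply: itgD; apply: itgZ.
  have a0 := amplitude_ge0 k t; rewrite normrM.
  have s'0 : 0 <= s^-1 by rewrite invr_ge0 ltW.
  have JsE : `|J k t / s| = `|J k t| * s^-1 by rewrite normrM [`|s^-1|]ger0_norm.
  (* The quadratic bound on rho would leave a third power of the amplitude,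
     whose mean may be infinite; above K the linear bound replaces it. *)
  case: (ltP K (amplitude k t)) => Ka.
    rewrite mulr1; apply: (@le_trans _ _ (C * (2 * s^-1 * amplitude k t ^+ 2))).
      rewrite (_ : C * _ = (2 * C * (amplitude k t * s^-1)) * amplitude k t); last by ring.
      apply: ler_pM => //; apply: (le_trans (rho1 k t)).
      by rewrite JsE ler_wpM2l ?mulr_ge0// ler_wpM2r.
    rewrite ler_wpM2l// lerDr !mulr_ge0 ?sqr_ge0// invr_ge0 ltW//.
  rewrite mulr0 mulr0 addr0; apply: (@le_trans _ _ ((C * (amplitude k t ^+ 2 * v^-1)) * K)).
    apply: ler_pM => //; last exact: le_trans (J'a k t) Ka.
    apply: (le_trans (rho2 k t)); rewrite ler_wpM2l//.
    rewrite exprMn exprVn sv ler_wpM2r ?invr_ge0 ?(ltW v0)//.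
    by rewrite -(real_normK (num_real (J k t))) lerXn2r ?nnegrE.
  by rewrite le_eqVlt; apply/orP; left; apply/eqP; ring.
rewrite exZ; last by apply: itgD; apply: itgZ.
rewrite exD; [|exact: itgZ..].
rewrite (exZ _ ia2) (exZ _ tail_itg).
apply: (@le_trans _ _ ((2 * s)^-1 * (C * (K * v^-1 * M + 2 * s^-1 * eta)))).
  rewrite ler_wpM2l ?invr_ge0 ?mulr_ge0 ?(ltW s0)// ler_wpM2l// lerD// ler_wpM2l//.
    by rewrite mulr_ge0// invr_ge0 ltW.
  by rewrite mulr_ge0// invr_ge0 ltW.
have M0 : 0 <= M by rewrite (le_trans _ (amp2 k))// ex_ge0// => t; exact: sqr_ge0.
rewrite (_ : (2 * s)^-1 * _ = 2^-1 * (C * (K * M / s + 2 * eta) / v)).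
  rewrite ler_piMl// ?invf_le1 ?ler1n// !mulr_ge0 ?addr_ge0 ?mulr_ge0 ?invr_ge0 ?(ltW s0)// ltW//.
by rewrite -sv; field; rewrite gt_eqF.
Qed.

End Bound.

End SteinBound.

(** * The partition function on induced subgraphs *)

Section PartitionFunction.
Local Close Scope classical_set_scope.
Context {R : realType} {G : sgraph}.
Local Notation I := (edge G + G)%type.
Implicit Types (S A : {set G}) (c : I -> R) (x y : G) (M : {set edge G}).

(** Monomers and dimers are treated alike: i occupies the vertices [ends i],
    and a matching is an exact cover of the vertices. *)
Definition ends (i : I) : {set G} :=
  match i with inl e => val e | inr x => [set x] end.

Definition matchings_in S : {set {set edge G}} :=
  [set M | matching M && [forall e in M, val e \subset S]].

Definition energy c S M : R :=
  \sum_(e in M) c (inl e) + \sum_(x in S | unmatched M x) c (inr x).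

Definition Zsub c S : R := \sum_(M in matchings_in S) expR (energy c S M).

Definition occupied M (i : I) : bool :=
  match i with inl e => e \in M | inr x => unmatched M x end.

Lemma matchings_inP S M : reflect
  ((forall e f, e \in M -> f \in M -> e != f -> [disjoint val e & val f]) /\
   (forall e, e \in M -> val e \subset S)) (M \in matchings_in S).
Proof.
rewrite inE; apply: (iffP andP) => -[h1 h2]; split.
- move=> e f eM fM ef; move/forallP : h1 => /(_ e); rewrite eM => /forallP/(_ f).
  by rewrite fM ef.
- by move=> e eM; move/forallP : h2 => /(_ e); rewrite eM.
- by do 2 (apply/forallP => ?; apply/implyP => ?); apply/implyP; exact: h1.
- by apply/forallP => e; apply/implyP; exact: h2.
Qed.

Lemma edge_endP (e : edge G) x : x \in val e ->
  exists2 y, adj x y & val e = [set x; y].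
Proof.
case: e => e /= /imsetP[[u v]]; rewrite inE /= => uv -> /set2P[] ->.
  by exists v.
by exists u; [rewrite adj_sym|rewrite finset.setUC].
Qed.

Lemma unmatchedP M x : reflect (forall e, e \in M -> x \notin val e) (unmatched M x).
Proof. by apply: (iffP forall_inP). Qed.

Lemma partition_functionE (w : edge G -> R) (nu : G -> R) :
  partition_function w nu =
  Zsub (fun i => match i with inl e => w e | inr x => nu x end) finset.setT.
Proof.
rewrite /partition_function /Zsub; apply: eq_big => M.
  rewrite inE; case: (matching M) => //=; apply/esym/forall_inP => e _.
  exact: finset.subsetT.
move=> _; rewrite /energy; congr (expR (_ + _)); apply: eq_bigl => x.
by rewrite inE.
Qed.

Lemma Zsub_gt0 c S : 0 < Zsub c S.
Proof.
rewrite /Zsub (bigD1 finset.set0)/=; last first.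
  by apply/matchings_inP; split=> e; rewrite ?inE// => f; rewrite inE.
by rewrite ltr_pwDl ?expR_gt0// sumr_ge0// => M _; rewrite expR_ge0.
Qed.

Lemma Zsub_ext c c' S :
  (forall i, ends i \subset S -> c i = c' i) -> Zsub c S = Zsub c' S.
Proof.
move=> cc'; apply: eq_bigr => M /matchings_inP[_ MS].
rewrite /energy; congr (expR (_ + _)); apply: eq_bigr => i.
  by move=> iM; rewrite cc'//; exact: MS.
by move=> /andP[iS _]; rewrite cc'// finset.sub1set.
Qed.

Lemma measurable_Zsub S : measurable_fun [set: cfg I]%classic (fun c : @cfg R I => Zsub c S).
Proof.
apply: measurable_bigsum => M; apply: (measurableT_comp (@measurable_expR R)).
by apply: measurable_funD; apply: measurable_bigsum => i; exact: measurable_coord.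
Qed.

(** Each matching covers x by exactly one occupied monomer or dimer. *)
Lemma occupied_unique S M x : M \in matchings_in S -> x \in S ->
  exists i0 : I, forall i,
  [&& x \in ends i, ends i \subset S & occupied M i] = (i == i0).
Proof.
move=> /matchings_inP[disjM MS] xS; case: (boolP (unmatched M x)) => ux.
  exists (inr x) => -[e|y] /=.
    apply/negP => /and3P[xe _ eM].
    by move/unmatchedP : ux => /(_ e eM); rewrite xe.
  rewrite inE finset.sub1set; apply/and3P/eqP => [[/eqP ->//]|[->]].
  by rewrite eqxx.
have [e eM xe] : exists2 e, e \in M & x \in val e.
  move: ux => /forallPn[e]; rewrite negb_imply negbK => /andP[eM xe].
  by exists e.
exists (inl e) => -[f|y] /=.
  apply/and3P/eqP => [[xf _ fM]|[->]]; last by split => //; exact: MS.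
  congr inl; apply/eqP; apply: contraT => fe.
  have /pred0P/(_ x) := disjM _ _ fM eM fe.
  by rewrite /= xf xe.
apply/negP => /and3P[]; rewrite inE => /eqP <- _ ux'.
by rewrite ux' in ux.
Qed.

Lemma sum_occupied_vertex c S x : x \in S ->
  \sum_(M in matchings_in S | unmatched M x) expR (energy c S M) =
  expR (c (inr x)) * Zsub c (S :\ x).
Proof.
move=> xS; rewrite /Zsub mulr_sumr; apply: eq_big => M.
  apply/andP/matchings_inP => [[/matchings_inP[dM MS] /unmatchedP uM]|[dM MS]].
    split=> // e eM; apply/fintype.subsetP => y ye; rewrite !inE (fintype.subsetP (MS _ eM))// andbT.
    by apply: contraL ye => /eqP ->; exact: uM.
  split; last first.
    apply/unmatchedP => e eM; apply/negP => /(fintype.subsetP (MS _ eM)).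
    by rewrite !inE eqxx.
  apply/matchings_inP; split => // e /MS eS; apply: (fintype.subset_trans eS).
  exact: finset.subsetDl.
move=> /andP[_ uM]; rewrite -expRD /energy; congr expR.
rewrite (bigD1 x) ?xS//= addrCA; congr (_ + (_ + _)).
by apply: eq_bigl => y; rewrite !inE; case: (y == x); rewrite ?andbF ?andbT.
Qed.

Lemma sum_occupied_edge c S (e : edge G) : val e \subset S ->
  \sum_(M in matchings_in S | e \in M) expR (energy c S M) =
  expR (c (inl e)) * Zsub c (S :\: val e).
Proof.
move=> eS.
have e0 : exists x, x \in val e.
  by case: e {eS} => e /= /imsetP[[u v] _ ->]; exists u; rewrite !inE eqxx.
have eN M : M \in matchings_in (S :\: val e) -> e \notin M.
  move=> /matchings_inP[_ MS]; apply/negP => /MS /fintype.subsetP h.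
  by case: e0 => x xe; have := h x xe; rewrite inE xe.
rewrite (reindex_onto (fun M => e |: M) (fun M => M :\ e)) /=; last first.
  by move=> M /andP[_ eM]; rewrite finset.setD1K.
rewrite /Zsub mulr_sumr; apply: eq_big => M.
  rewrite setU11 andbT; apply/andP/idP => [[/matchings_inP[dM MS] /eqP hM]|hM].
    have eM : e \notin M by rewrite -hM !inE eqxx.
    apply/matchings_inP; split=> [f f' fM f'M|f fM].
      by apply: dM; rewrite inE ?fM ?f'M orbT.
    rewrite finset.subsetD MS ?inE ?fM ?orbT//=.
    apply: dM; rewrite ?inE ?eqxx ?fM ?orbT//.
    by apply: contraNneq eM => <-.
  have eM := eN M hM; split; last by rewrite finset.setU1K.
  case/matchings_inP : hM => dM MS; apply/matchings_inP; split=> [f f'|f].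
    rewrite !inE => /predU1P[->|fM] /predU1P[->|f'M]; rewrite ?eqxx//.
    - move=> _; have := MS _ f'M; rewrite finset.subsetD => /andP[_].
      by rewrite disjoint_sym.
    - by move=> _; have := MS _ fM; rewrite finset.subsetD => /andP[_].
    - exact: dM.
  rewrite !inE => /predU1P[->//|/MS]; rewrite finset.subsetD.
  by move=> /andP[].
move=> /andP[/andP[hM _] /eqP hMe].
have eM : e \notin M by rewrite -hMe !inE eqxx.
rewrite -expRD /energy; congr expR; rewrite big_setU1//= -addrA.
congr (_ + (_ + _)); apply: eq_bigl => y; rewrite !inE.
case: (boolP (y \in S)) => yS; rewrite ?andbF//= andbT.
apply/unmatchedP/andP => [h|[ye /unmatchedP h] f].
  split; first by apply: h; rewrite setU11.
  by apply/unmatchedP => f fM; apply: h; rewrite inE fM orbT.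
by rewrite !inE => /predU1P[->//|]; exact: h.
Qed.

(** The matchings are sorted by the monomer or dimer that covers x. *)
Lemma Zsub_rec c S x : x \in S ->
  Zsub c S = \sum_(i | (x \in ends i) && (ends i \subset S))
               expR (c i) * Zsub c (S :\: ends i).
Proof.
move=> xS; rewrite {1}/Zsub.
transitivity (\sum_(M in matchings_in S)
    \sum_(i | [&& x \in ends i, ends i \subset S & occupied M i])
      expR (energy c S M)).
  apply: eq_bigr => M hM; have [i0 h] := occupied_unique hM xS.
  by rewrite (big_pred1 i0).
rewrite (exchange_big_dep (fun i => (x \in ends i) && (ends i \subset S)))/=; last first.
  by move=> M i _ /and3P[-> ->].
apply: eq_bigr => -[e|y] /= /andP[xi iS].
  rewrite -sum_occupied_edge//; apply: eq_bigl => M.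
  by rewrite xi iS.
move: xi iS; rewrite inE => /eqP <- _; rewrite -sum_occupied_vertex//.
by apply: eq_bigl => M; rewrite inE eqxx finset.sub1set xS.
Qed.

End PartitionFunction.

(** * Decay of correlations along paths of good vertices *)

Section LogContraction.
Context {R : realType}.
Implicit Types (s theta delta : R).

(** Both endpoint values lie above the tangent at [- (theta * delta)]. *)
Lemma expR_convex theta delta : 0 <= theta <= 1 ->
  expR (- (theta * delta)) <= 1 - theta + theta * expR (- delta).
Proof.
move=> /andP[t0 t1]; set m := - (theta * delta).
have tangent u : expR m * (1 + (u - m)) <= expR u.
  by rewrite -[in leRHS](subrK m u) expRD mulrC ler_wpM2r ?expR_ge0// expR_ge1Dx.
have h0 := tangent 0; have h1 := tangent (- delta).
rewrite expR0 in h0.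
apply: (@le_trans _ _ ((1 - theta) * (expR m * (1 + (0 - m))) +
    theta * (expR m * (1 + (- delta - m))))).
  by rewrite le_eqVlt; apply/orP; left; apply/eqP; rewrite /m; ring.
by rewrite lerD// ?ler_wpM2l// -[leRHS]mulr1 ler_wpM2l// subr_ge0.
Qed.

(** The hypothesis on s bounds by theta the derivative [s / (1 + s)] of
    [ln (1 + s)] with respect to [ln s]. *)
Lemma log1p_contract s s' theta delta : 0 <= theta <= 1 -> 0 <= delta ->
  0 <= s -> 0 <= s' -> s <= theta * (1 + s) -> s' <= theta * (1 + s') ->
  s <= s' * expR delta -> s' <= s * expR delta ->
  `|ln (1 + s) - ln (1 + s')| <= theta * delta.
Proof.
move=> t01 d0; wlog ss' : s s' / s' <= s => [hw|].
  by move=> *; case: (leP s' s) => [/hw|/ltW/hw]; rewrite 1?distrC; apply.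
move=> s0 s'0 st _ sd _.
have s1 : 0 < 1 + s by rewrite ltr_pwDl.
have s'1 : 0 < 1 + s' by rewrite ltr_pwDl.
rewrite ger0_norm ?subr_ge0 ?ler_ln ?posrE ?lerD2l// -ln_div ?posrE//.
rewrite -ler_expR lnK ?posrE ?divr_gt0// ler_pdivrMr//.
rewrite -[X in X * _]invrK -expRN ler_pdivlMl ?expR_gt0//.
have e1 : expR (- delta) <= 1 by rewrite -expR0 ler_expR oppr_le0.
apply: (@le_trans _ _ ((1 - theta + theta * expR (- delta)) * (1 + s))).
  by rewrite ler_wpM2r ?expR_convex// ltW.
apply: (@le_trans _ _ (1 + s * expR (- delta))); last first.
  by rewrite lerD2l expRN ler_pdivrMr ?expR_gt0.
have : (1 - expR (- delta)) * s <= (1 - expR (- delta)) * (theta * (1 + s)).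
  by rewrite ler_wpM2l// subr_ge0.
by lra.
Qed.

Lemma log1p_bounded s s' L : 0 <= s <= L -> 0 <= s' <= L ->
  `|ln (1 + s) - ln (1 + s')| <= ln (1 + L).
Proof.
wlog ss' : s s' / s' <= s => [hw|].
  by move=> *; case: (leP s' s) => [/hw|/ltW/hw]; rewrite 1?distrC; apply.
move=> /andP[s0 sL] /andP[s'0 _].
have s1 : 0 < 1 + s by rewrite ltr_pwDl.
have s'1 : 0 < 1 + s' by rewrite ltr_pwDl.
have L1 : 0 < 1 + L by rewrite ltr_pwDl// (le_trans s0).
rewrite ger0_norm ?subr_ge0 ?ler_ln ?posrE ?lerD2l//.
rewrite lerBlDr (@le_trans _ _ (ln (1 + L)))// ?ler_ln ?posrE ?lerD2l//.
by rewrite lerDl ln_ge0// lerDl.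
Qed.

(** The slope of the logarithm is at least 1 on the unit interval. *)
Lemma dist_le_dist_ln (a b : R) : 0 < a <= 1 -> 0 < b <= 1 ->
  `|a - b| <= `|ln a - ln b|.
Proof.
wlog ab : a b / a <= b => [hw|].
  move=> a01 b01; case: (leP a b) => [/hw|/ltW/hw h]; first exact.
  by rewrite distrC [leRHS]distrC; exact: h.
move=> /andP[a0 a1] /andP[b0 b1].
rewrite [leLHS]distrC [leRHS]distrC !ger0_norm ?subr_ge0 ?ler_ln ?posrE//.
have h := expR_ge1Dx (ln a - ln b).
rewrite -ln_div ?posrE// lnK ?posrE ?divr_gt0// ler_pdivlMr// in h.
rewrite ln_div ?posrE// in h.
have l0 : 0 <= ln b - ln a by rewrite subr_ge0 ler_ln ?posrE.
by nra.
Qed.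

End LogContraction.

Section RatioDecay.
Context {R : realType} {G : sgraph}.
Local Notation I := (edge G + G)%type.
Variable c : I -> R.
Implicit Types (S A : {set G}) (x y v : G) (e : edge G).

Definition Zratio S A : R := Zsub c (S :\: A)%SET / Zsub c S.

Lemma ratio_gt0 S A : 0 < Zratio S A.
Proof. by rewrite divr_gt0 ?Zsub_gt0. Qed.

Definition dimer_sum S x : R := \sum_(e : edge G | (x \in val e) && (val e \subset S)%SET)
  expR (c (inl e)) * Zratio (S :\ x)%SET (val e :\ x)%SET.

Lemma dimer_sum_ge0 S x : 0 <= dimer_sum S x.
Proof. by apply: sumr_ge0 => e _; rewrite mulr_ge0 ?expR_ge0// ltW// ratio_gt0. Qed.

Lemma setDD1 (S A : {set G}) x : x \in A -> ((S :\ x) :\: (A :\ x) = S :\: A)%SET.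
Proof.
move=> xA; apply/setP => y; rewrite !inE.
by case: eqVneq => [->|]; rewrite ?xA ?andbF.
Qed.

(** The recursion for the partition function, divided by the partition function
    without x: the ratio at x is expressed by ratios at the neighbours of x. *)
Lemma ratio_vertex S x : x \in S ->
  Zratio S [set x]%SET = (expR (c (inr x)) + dimer_sum S x)^-1.
Proof.
move=> xS; have Z0 := Zsub_gt0 c (S :\ x)%SET.
rewrite -[LHS]invrK /Zratio; congr (_^-1); rewrite invf_div.
apply: (canLR (mulfK _)); first by rewrite gt_eqF.
rewrite (Zsub_rec c xS) mulrDl addrC big_sumType/=; congr (_ + _).
  rewrite mulr_suml; apply: eq_bigr => e /andP[xe eS].
  by rewrite -mulrA /Zratio setDD1// divfK// gt_eqF.
rewrite (big_pred1 x)// => y; rewrite inE finset.sub1set.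
by rewrite /= [RHS]eq_sym; case: eqVneq => [<-|//]; rewrite xS.
Qed.

Lemma ratio_vertex_le S x : x \in S -> Zratio S [set x]%SET <= expR (- c (inr x)).
Proof.
move=> xS; rewrite ratio_vertex// expRN lef_pV2 ?posrE ?expR_gt0//.
  by rewrite lerDl dimer_sum_ge0.
by rewrite ltr_pwDl ?expR_gt0 ?dimer_sum_ge0.
Qed.

(** The total weight of the dimers at x relative to that of the monomer at x. *)
Definition fugacity S x : R := expR (- c (inr x)) * dimer_sum S x.

Lemma fugacity_ge0 S x : 0 <= fugacity S x.
Proof. by rewrite mulr_ge0 ?expR_ge0 ?dimer_sum_ge0. Qed.

Lemma ln_ratio_vertex S x : x \in S ->
  ln (Zratio S [set x]%SET) = - c (inr x) - ln (1 + fugacity S x).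
Proof.
move=> xS; rewrite ratio_vertex// /fugacity.
have e0 := expR_gt0 (c (inr x)); have d0 := dimer_sum_ge0 S x.
have -> : expR (c (inr x)) + dimer_sum S x =
    expR (c (inr x)) * (1 + expR (- c (inr x)) * dimer_sum S x).
  by rewrite mulrDr mulr1 mulrA -expRD subrr expR0 mul1r.
have p0 : 0 < 1 + expR (- c (inr x)) * dimer_sum S x.
  by rewrite ltr_pwDl// mulr_ge0// expR_ge0.
by rewrite lnV ?posrE ?mulr_gt0// lnM ?posrE// expRK opprD.
Qed.

(** The recursion at v, bounded with the help of [ratio_vertex_le] at its
    neighbours, involves no other weights. *)
Definition near_weights v : {set I} :=
  [set i | [exists u in ends i, (u == v) || adj u v]]%SET.

Definition extreme (K : R) (i : I) : bool := (K < `|c i|)%R.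

Definition good K v : bool := [forall i in near_weights v, ~~ extreme K i].

Lemma goodP K v i : good K v -> i \in near_weights v -> `|c i| <= K.
Proof. by move=> /forall_inP h /h; rewrite -leNgt. Qed.

Lemma edge_set1 e x : x \in val e ->
  exists y, [/\ adj x y, val e = [set x; y]%SET & (val e :\ x)%SET = [set y]%SET].
Proof.
move=> /edge_endP[y xy eE]; exists y; split => //; rewrite eE.
apply/setP => z; rewrite !inE; case: eqVneq => [->|]//=.
by apply/esym/negbTE; apply: contraTneq xy => ->; rewrite adj_irr.
Qed.

Lemma card_incident x : (#|[set e : edge G | x \in val e]%SET| <= degree x)%N.
Proof.
rewrite -(card_imset _ val_inj).
pose f y : {set G} := [set x; y]%SET.
apply: (@leq_trans #|[set f y | y in [set y | adj x y]]%SET|); last exact: leq_imset_card.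
apply/subset_leq_card/fintype.subsetP => A /imsetP[e]; rewrite inE.
move=> /edge_endP[y xy eE] ->; apply/imsetP; exists y => //.
by rewrite inE.
Qed.

Section GoodVertex.
Variables (K L : R) (D : nat).
Hypothesis LE : L = D%:R * expR (3 * K).
Hypothesis degD : forall x, (degree x <= D)%N.

(** Each dimer at v contributes its own weight, the weight of v and, by
    [ratio_vertex_le], that of its other end, whence the factor 3. *)
Lemma fugacity_le S v : v \in S -> good K v -> fugacity S v <= L.
Proof.
move=> vS gv; have c_le i : i \in near_weights v -> c i <= K.
  by move=> /(goodP gv); apply: le_trans; exact: ler_norm.
have cN_le i : i \in near_weights v -> - c i <= K.
  by move=> /(goodP gv); apply: le_trans; rewrite -normrN ler_norm.
have nv : inr v \in near_weights v.
  by rewrite inE; apply/existsP; exists v; rewrite /= inE !eqxx.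
rewrite /fugacity /dimer_sum mulr_sumr LE.
apply: (@le_trans _ _ (\sum_(e : edge G | v \in val e) expR (3 * K))); last first.
  rewrite sumr_const -[leLHS]mulr_natl ler_wpM2r ?expR_ge0// ler_nat.
  by apply: leq_trans (degD v); apply: leq_trans (card_incident v); rewrite cardsE.
rewrite [leRHS](bigID (fun e : edge G => val e \subset S)%SET)/=.
rewrite -[leLHS]addr0; apply: lerD; last first.
  by apply: sumr_ge0 => *; exact: expR_ge0.
apply: ler_sum => e /andP[ve eS].
have [y [vy eE ->]] := edge_set1 ve.
have yS : y \in (S :\ v)%SET.
  rewrite !inE; apply/andP; split; last first.
    by apply: (fintype.subsetP eS); rewrite eE !inE eqxx orbT.
  by apply: contraTneq vy => ->; rewrite adj_irr.
have ne : inl e \in near_weights v.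
  by rewrite inE; apply/existsP; exists v; rewrite /= ve eqxx.
have ny : inr y \in near_weights v.
  by rewrite inE; apply/existsP; exists y; rewrite /= inE eqxx /= adj_sym vy orbT.
have -> : 3 * K = K + (K + K) by ring.
have r0 := ltW (ratio_gt0 (S :\ v)%SET [set y]%SET).
have er0 := mulr_ge0 (expR_ge0 (c (inl e))) r0.
rewrite !expRD; apply: ler_pM; rewrite ?expR_ge0 ?ler_expR ?cN_le//.
apply: ler_pM; rewrite ?expR_ge0 ?ler_expR ?c_le//.
by apply: (le_trans (ratio_vertex_le yS)); rewrite ler_expR cN_le.
Qed.

Lemma L_ge0 : 0 <= L.
Proof. by rewrite LE mulr_ge0 ?expR_ge0. Qed.

Definition theta : R := L / (1 + L).

Lemma theta01 : 0 <= theta < 1.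
Proof.
have L0 := L_ge0; have L1 : 0 < 1 + L by rewrite ltr_pwDl.
by rewrite /theta divr_ge0 ?(ltW L1)//= ltr_pdivrMr// mul1r ltrDr.
Qed.

Lemma fugacity_theta s : s <= L -> s <= theta * (1 + s).
Proof.
move=> sL; have L1 : 0 < 1 + L by rewrite ltr_pwDl// L_ge0.
rewrite /theta mulrAC ler_pdivlMr//; lra.
Qed.

Lemma dimer_sum_ratio (S S' : {set G}) x delta : x \in S -> x \in S' ->
  (forall y, adj x y -> (y \in S) = (y \in S')) ->
  (forall y, adj x y -> y \in (S :\ x)%SET ->
    `|ln (Zratio (S :\ x) [set y]%SET) - ln (Zratio (S' :\ x) [set y]%SET)| <= delta) ->
  fugacity S x <= fugacity S' x * expR delta /\
  fugacity S' x <= fugacity S x * expR delta.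
Proof.
move=> xS xS' SS' hd.
have eSS' (e : edge G) : x \in val e ->
    (val e \subset S)%SET = (val e \subset S')%SET.
  move=> /edge_endP[y xy ->]; rewrite !finset.subUset !finset.sub1set xS xS'.
  by rewrite SS'.
have rr (e : edge G) : x \in val e -> (val e \subset S)%SET ->
    Zratio (S :\ x) (val e :\ x)%SET <=
      Zratio (S' :\ x) (val e :\ x)%SET * expR delta /\
    Zratio (S' :\ x) (val e :\ x)%SET <=
      Zratio (S :\ x) (val e :\ x)%SET * expR delta.
  move=> xe eS; have [y [xy eE ->]] := edge_set1 xe.
  have yS : y \in (S :\ x)%SET.
    rewrite !inE; apply/andP; split; last first.
      by apply: (fintype.subsetP eS); rewrite eE !inE eqxx orbT.
    by apply: contraTneq xy => ->; rewrite adj_irr.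
  have := hd y xy yS; rewrite ler_norml => /andP[h1 h2].
  have r0 A B : 0 < Zratio A B := ratio_gt0 A B.
  have key (a b : R) : 0 < a -> 0 < b -> ln a - ln b <= delta -> a <= b * expR delta.
    move=> a0 b0 ab; rewrite -ler_ln ?posrE ?mulr_gt0 ?expR_gt0//.
    by rewrite lnM ?posrE ?expR_gt0// expRK; lra.
  by split; apply: key => //; lra.
split; rewrite /fugacity -mulrA ler_wpM2l ?expR_ge0// /dimer_sum mulr_suml.
  rewrite [leRHS](eq_bigl (fun e : edge G => (x \in val e) && (val e \subset S)%SET)).
    apply: ler_sum => e /andP[xe eS].
    by rewrite -mulrA ler_wpM2l ?expR_ge0//; case: (rr e xe eS).
  by move=> e; case: (boolP (x \in val e)) => //= xe; rewrite eSS'.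
rewrite [leLHS](eq_bigl (fun e : edge G => (x \in val e) && (val e \subset S)%SET)).
  apply: ler_sum => e /andP[xe eS].
  by rewrite -mulrA ler_wpM2l ?expR_ge0//; case: (rr e xe eS).
by move=> e; case: (boolP (x \in val e)) => //= xe; rewrite eSS'.
Qed.

(** At a good vertex the recursion contracts logarithms by [theta], at the
    others it does not expand them; so the influence of the difference between
    S and S' decays with the number of good vertices on the way there. *)
Lemma ratio_decay (k : nat) : forall (S S' : {set G}) x (t : nat),
  (S' \subset S)%SET -> x \in S' ->
  (forall p, (size p <= k)%N -> path (@adj G) x p -> {subset p <= S} ->
     {subset p <= S'}) ->
  (forall p, size p = k -> path (@adj G) x p -> uniq (x :: p) ->
     {subset p <= S} -> (t < count (good K) (x :: p))%N) ->
  `|ln (Zratio S [set x]%SET) - ln (Zratio S' [set x]%SET)| <=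
  theta ^+ t * ln (1 + L).
Proof.
have L0 := L_ge0; have /andP[th0 th1] := theta01.
have lnL0 : 0 <= ln (1 + L) by rewrite ln_ge0// lerDl.
elim: k => [|k IH] S S' x t S'S xS' agree many.
  have xS := fintype.subsetP S'S _ xS'.
  have /= := many [::] erefl isT isT (fun y => ltac:(by rewrite in_nil)).
  rewrite addn0; case: (boolP (good K x)) => // gx; case: t {many} => // _.
  rewrite expr0 mul1r !ln_ratio_vertex// opprD addrACA subrr add0r opprK.
  rewrite addrC distrC; apply: log1p_bounded; rewrite fugacity_ge0 fugacity_le//.
have xS := fintype.subsetP S'S _ xS'.
have SS' y : adj x y -> (y \in S) = (y \in S').
  move=> xy; apply/idP/idP => [yS|]; last exact: fintype.subsetP.
  apply: (agree [:: y]); rewrite /= ?xy ?inE ?eqxx// => z.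
  by rewrite inE => /eqP ->.
have recur t' : (forall q y, adj x y -> y \in (S :\ x)%SET -> size q = k ->
      path (@adj G) y q -> uniq (y :: q) -> {subset q <= (S :\ x)%SET} ->
      (t' < count (good K) (y :: q))%N) ->
    fugacity S x <= fugacity S' x * expR (theta ^+ t' * ln (1 + L)) /\
    fugacity S' x <= fugacity S x * expR (theta ^+ t' * ln (1 + L)).
  move=> many'; apply: dimer_sum_ratio => // y xy yS.
  apply: IH => [||p sp pp pS|p sp pp up pS].
  - exact: finset.setSD.
  - by move: yS; rewrite !inE SS'.
  - move=> z zp; have := pS z zp; rewrite !inE => /andP[-> _]/=.
    apply: (agree (y :: p)) => /=; rewrite ?xy//; last by rewrite inE zp orbT.
    move=> u; rewrite inE => /predU1P[->|/pS]; last by rewrite inE => /andP[].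
    by move: yS; rewrite inE => /andP[].
  - exact: many'.
have uniq_cons y q : y \in (S :\ x)%SET -> uniq (y :: q) ->
    {subset q <= (S :\ x)%SET} -> uniq (x :: y :: q).
  move=> yS uq qS; rewrite cons_uniq uq andbT inE negb_or.
  move: yS; rewrite !inE eq_sym => /andP[-> _]/=.
  by apply/negP => /qS; rewrite !inE eqxx.
have sub_cons y q : y \in (S :\ x)%SET -> {subset q <= (S :\ x)%SET} ->
    {subset y :: q <= S}.
  move=> yS qS u; rewrite inE => /predU1P[->|/qS]; last by rewrite inE => /andP[].
  by move: yS; rewrite inE => /andP[].
rewrite !ln_ratio_vertex// opprD addrACA subrr add0r opprK addrC distrC.
have f0 := fugacity_ge0 S x; have f'0 := fugacity_ge0 S' x.
case: (boolP (good K x)) => gx; last first.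
  case: (recur t) => [q y xy yS sq pq uq qS|h1 h2].
    have := many (y :: q); rewrite /= sq xy pq (negbTE gx).
    by move=> /(_ erefl isT (uniq_cons _ _ yS uq qS) (sub_cons _ _ yS qS)).
  rewrite -[leRHS]mul1r; apply: log1p_contract; rewrite ?ler01 ?lexx//; try lra.
  by rewrite mulr_ge0// exprn_ge0.
have fL := fugacity_le xS gx; have f'L := fugacity_le xS' gx.
case: t many => [|t] many.
  by rewrite expr0 mul1r; apply: log1p_bounded; rewrite ?f0 ?f'0.
case: (recur t) => [q y xy yS sq pq uq qS|h1 h2].
  have := many (y :: q); rewrite /= sq xy pq gx.
  by move=> /(_ erefl isT (uniq_cons _ _ yS uq qS) (sub_cons _ _ yS qS)).
rewrite exprS -mulrA; apply: log1p_contract => //.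
- by rewrite th0 ltW.
- by rewrite mulr_ge0// exprn_ge0.
- exact: fugacity_theta.
- exact: fugacity_theta.
Qed.

End GoodVertex.

End RatioDecay.

(** * Occupation probabilities and increments of the free energy *)

Section Occupation.
Context {R : realType} {G : sgraph}.
Local Notation I := (edge G + G)%type.
Implicit Types (c : I -> R) (S A : {set G}) (x y v : G) (i : I).

(** The Gibbs probability, on the subgraph induced by S, that i is occupied. *)
Definition occupation c S i : R := expR (c i) * Zratio c S (ends i).

Lemma ends_neq0 i : exists x, x \in ends i.
Proof.
case: i => [e|x]; last by exists x; rewrite inE.
case: e => e /= he; have /imsetP[[u v] _ ->] := he.
by exists u; rewrite !inE eqxx.
Qed.

Lemma occupation_gt0 c S i : 0 < occupation c S i.
Proof. by rewrite mulr_gt0 ?expR_gt0 ?ratio_gt0. Qed.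

Lemma occupation_le1 c S i : (ends i \subset S)%SET -> occupation c S i <= 1.
Proof.
move=> iS; have [x xi] := ends_neq0 i.
have xS := fintype.subsetP iS _ xi.
rewrite /occupation /Zratio mulrA ler_pdivrMr ?Zsub_gt0// mul1r.
rewrite (Zsub_rec c xS) (bigD1 i)/= ?xi//.
rewrite lerDl sumr_ge0// => j _.
by rewrite mulr_ge0 ?expR_ge0// ltW// Zsub_gt0.
Qed.

Lemma occupation01 c S i : (ends i \subset S)%SET ->
  0 < occupation c S i <= 1.
Proof. by move=> iS; rewrite occupation_gt0 occupation_le1. Qed.

(** The increase of the logarithm of the partition function when the weight of
    a monomer or dimer that is occupied with probability p grows by alpha. *)
Definition log_tilt (alpha p : R) : R := ln (1 + (expR alpha - 1) * p).

Lemma tilt_ge (alpha p : R) : 0 <= p <= 1 ->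
  expR (- `|alpha|) <= 1 + (expR alpha - 1) * p.
Proof.
move=> /andP[p0 p1]; have e0 := expR_gt0 alpha.
case: (leP 0 alpha) => a0.
  have e1 : 1 <= expR alpha by rewrite -expR0 ler_expR.
  apply: (@le_trans _ _ 1); last by rewrite lerDl mulr_ge0// subr_ge0.
  by rewrite -[leRHS]expR0 ler_expR oppr_le0.
rewrite ltr0_norm// opprK.
have e1 : expR alpha <= 1 by rewrite -expR0 ler_expR ltW.
nra.
Qed.

Lemma tilt_le (alpha p : R) : 0 <= p <= 1 ->
  1 + (expR alpha - 1) * p <= expR `|alpha|.
Proof.
move=> /andP[p0 p1]; have e0 := expR_gt0 alpha.
case: (leP 0 alpha) => a0.
  have e1 : 1 <= expR alpha by rewrite -expR0 ler_expR.
  by rewrite ger0_norm//; nra.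
have e1 : expR alpha <= 1 by rewrite -expR0 ler_expR ltW.
apply: (@le_trans _ _ 1); first by nra.
by rewrite -expR0 ler_expR.
Qed.

Lemma tilt_gt0 (alpha p : R) : 0 <= p <= 1 -> 0 < 1 + (expR alpha - 1) * p.
Proof. by move=> /(tilt_ge alpha); apply: lt_le_trans; exact: expR_gt0. Qed.

Lemma log_tilt_le (alpha p : R) : 0 <= p <= 1 -> `|log_tilt alpha p| <= `|alpha|.
Proof.
move=> p01; have t0 := tilt_gt0 alpha p01.
rewrite ler_norml; apply/andP; split; rewrite -ler_expR lnK ?posrE//.
  exact: tilt_ge.
exact: tilt_le.
Qed.

Lemma log_tilt_lipschitz (alpha p q : R) : 0 <= p <= 1 -> 0 <= q <= 1 ->
  `|log_tilt alpha p - log_tilt alpha q| <= expR (2 * `|alpha|) * `|p - q|.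
Proof.
move=> p01 q01.
wlog pq : p q p01 q01 / log_tilt alpha q <= log_tilt alpha p => [hw|].
  case: (leP (log_tilt alpha q) (log_tilt alpha p)) => [|/ltW] h; first exact: hw.
  by rewrite distrC [`|p - q|]distrC; exact: hw.
rewrite ger0_norm ?subr_ge0//; rewrite /log_tilt.
have tp := tilt_gt0 alpha p01; have tq := tilt_gt0 alpha q01.
have gq := tilt_ge alpha q01.
set u := 1 + _ * p in tp *; set v := 1 + _ * q in tq gq *.
rewrite -ln_div ?posrE//.
have h := expR_ge1Dx (ln (u / v)); rewrite lnK ?posrE ?divr_gt0// in h.
apply: (@le_trans _ _ (u / v - 1)); first by lra.
have -> : u / v - 1 = v^-1 * ((expR alpha - 1) * (p - q)).
  by rewrite /u /v in tq *; field; rewrite gt_eqF.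
apply: (le_trans (ler_norm _)); rewrite !normrM mulrA ler_wpM2r//.
have -> : expR (2 * `|alpha|) = expR `|alpha| * expR `|alpha|.
  by rewrite -expRD; congr expR; ring.
apply: ler_pM => //.
  rewrite ger0_norm ?invr_ge0 ?(ltW tq)// -[leRHS]invrK -expRN.
  by rewrite lef_pV2 ?posrE ?expR_gt0.
rewrite ler_norml; have := ler_norm alpha; have := ler_norm (- alpha).
rewrite normrN -ler_expR => h1; rewrite -ler_expR => h2.
have e0 := expR_gt0 alpha; have e1 : 1 <= expR `|alpha| by rewrite -expR0 ler_expR.
by apply/andP; split; lra.
Qed.

(** In the recursion at a vertex of i, only the term of i contains its weight. *)
Lemma ln_Zsub_jump c c' S i : (ends i \subset S)%SET ->
  (forall j, j != i -> c j = c' j) ->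
  ln (Zsub c S) - ln (Zsub c' S) = log_tilt (c i - c' i) (occupation c' S i).
Proof.
move=> iS cc'; have [x xi] := ends_neq0 i.
have xS := fintype.subsetP iS _ xi.
have Zi j : x \in ends j -> Zsub c (S :\: ends j)%SET = Zsub c' (S :\: ends j)%SET.
  move=> xj; apply: Zsub_ext => l /fintype.subsetP lS; apply: cc'.
  by apply: contraTneq xi => <-; apply/negP => /lS; rewrite inE xj.
rewrite -ln_div ?posrE ?Zsub_gt0// /log_tilt; congr ln.
have Z'0 := Zsub_gt0 c' S.
apply: (canLR (mulfK _)); first by rewrite gt_eqF.
rewrite /occupation /Zratio mulrDl mul1r -!mulrA mulVf ?gt_eqF// mulr1.
rewrite [in RHS](Zsub_rec c' xS) (Zsub_rec c xS).
rewrite (bigD1 i) ?xi//= [in RHS](bigD1 i) ?xi//= Zi//.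
rewrite (eq_bigr (fun j => expR (c' j) * Zsub c' (S :\: ends j)%SET)); last first.
  by move=> j /andP[/andP[xj _] ji]; rewrite cc'// Zi.
rewrite mulrA mulrBl mul1r -expRD subrK; ring.
Qed.

Lemma measurable_occupation S i :
  measurable_fun setT (fun c : @cfg R I => occupation c S i).
Proof.
apply: measurable_funM.
  by apply: (measurableT_comp (@measurable_expR R)); exact: measurable_coord.
apply: measurable_funM; first exact: measurable_Zsub.
rewrite (_ : (fun _ => _) = (fun c : @cfg R I => expR (- ln (Zsub c S)))).
  apply: (measurableT_comp (@measurable_expR R)).
  apply: measurableT_comp => //; apply: (measurableT_comp (@measurable_ln R)).
  exact: measurable_Zsub.
by apply/funext => c; rewrite expRN lnK// posrE Zsub_gt0.
Qed.

Definition log_partition c : R := ln (Zsub c finset.setT).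

Lemma measurable_log_partition :
  measurable_fun setT (fun c : @cfg R I => log_partition c).
Proof. by apply: (measurableT_comp (@measurable_ln R)); exact: measurable_Zsub. Qed.

Lemma log_partition_lipschitz : coord_lipschitz (fun c : I -> R => log_partition c).
Proof.
move=> i c c' cc'; rewrite /log_partition (ln_Zsub_jump (finset.subsetT _) cc').
by apply: log_tilt_le; rewrite ltW ?occupation_gt0 ?occupation_le1 ?finset.subsetT.
Qed.

Lemma occupation_ext c c' S i : (ends i \subset S)%SET ->
  (forall j, (ends j \subset S)%SET -> c j = c' j) ->
  occupation c S i = occupation c' S i.
Proof.
move=> iS cc'; rewrite /occupation /Zratio cc'//; congr (_ * (_ / _)).
  apply: Zsub_ext => j jS; apply: cc'; apply: (fintype.subset_trans jS).
  exact: finset.subsetDl.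
exact: Zsub_ext.
Qed.

Fixpoint nb (r : nat) x : {set G} :=
  if r is r'.+1 then (x |: \bigcup_(y in [set y | adj x y]) nb r' y)%SET
  else [set x]%SET.

Lemma nb_self r x : x \in nb r x.
Proof. by case: r => [|r]; rewrite /= !inE eqxx. Qed.

Lemma path_nb r x p : (size p <= r)%N -> path (@adj G) x p ->
  {subset p <= nb r x}.
Proof.
elim: r x p => [|r IH] x [|y p]//= sp /andP[xy yp] z.
rewrite inE => zp; rewrite inE; apply/orP; right.
apply/bigcupP; exists y; first by rewrite inE.
by move: zp => /predU1P[->|zp]; [exact: nb_self|exact: (IH y p)].
Qed.

Lemma nbP r x y : y \in nb r x ->
  exists p, [/\ (size p <= r)%N, path (@adj G) x p & last x p = y].
Proof.
elim: r x => [|r IH] x /=; first by rewrite inE => /eqP ->; exists [::].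
rewrite !inE => /predU1P[->|]; first by exists [::].
move=> /bigcupP[z]; rewrite inE => xz /IH[p [sp zp <-]].
by exists (z :: p); split => //=; rewrite xz.
Qed.

Lemma nb_sym r x y : y \in nb r x -> x \in nb r y.
Proof.
move=> /nbP[p [sp xp <-]].
case: p sp xp => [|z p] sp xp; first exact: nb_self.
have := path_nb (r := r) (x := last x (z :: p)) (p := rev (belast x (z :: p))).
rewrite size_rev size_belast rev_path => /(_ sp); apply.
  by move: xp; congr path; apply/funext => u; apply/funext => w; rewrite adj_sym.
by rewrite mem_rev /= inE eqxx.
Qed.

Lemma card_bigcup_le (J K : finType) (Q : pred J) (F : J -> {set K}) :
  (#|\bigcup_(j | Q j) F j|%SET <= \sum_(j | Q j) #|F j|)%N.
Proof.
apply: (big_ind2 (fun (A : {set K}) n => (#|A| <= n)%N)) => //.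
  by rewrite cards0.
move=> A m B n Am Bn; apply: (leq_trans (leq_card_setU _ _)).
exact: leq_add.
Qed.

Lemma card_bigcup_const (J K : finType) (Q : {set J}) (F : J -> {set K}) (n : nat) :
  (forall j, j \in Q -> (#|F j| <= n)%N) ->
  (#|\bigcup_(j in Q) F j|%SET <= #|Q| * n)%N.
Proof.
move=> Fn; apply: (leq_trans (card_bigcup_le _ _)).
by rewrite -sum_nat_const; exact: leq_sum.
Qed.

Section Bounded.
Variable D : nat.
Hypothesis degD : forall x, (degree x <= D)%N.

Lemma card_nb r x : (#|nb r x| <= D.+1 ^ r)%N.
Proof.
elim: r x => [|r IH] x /=; first by rewrite cards1.
apply: (leq_trans (leq_card_setU _ _)); rewrite cards1 expnS mulSn leq_add//.
  by rewrite expn_gt0.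
apply: (leq_trans (card_bigcup_const (n := (D.+1 ^ r)%N) _)) => [y _|].
  exact: IH.
by rewrite leq_mul2r degD orbT.
Qed.

Definition covering x : {set I} := [set i | x \in ends i]%SET.

Lemma card_covering x : (#|covering x| <= D.+1)%N.
Proof.
have -> : covering x = ((@inl (edge G) G) @: [set e : edge G | x \in val e] :|:
                       [set inr x])%SET.
  apply/setP => -[e|y]; rewrite !inE.
    rewrite orbF mem_imset; last by move=> ? ? [].
    by rewrite inE.
  rewrite (_ : (inr y \in _) = false) /=; last first.
    by apply/negbTE/negP => /imsetP[].
  by rewrite eq_sym.
apply: (leq_trans (leq_card_setU _ _)); rewrite cards1 addn1 ltnS.
apply: (leq_trans (leq_imset_card _ _)).
exact: leq_trans (card_incident x) (degD x).
Qed.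

Lemma card_ends i : (#|ends i| <= 2)%N.
Proof.
case: i => [e|x] /=; last by rewrite cards1.
have [x xe] := ends_neq0 (inl e); have [y _ ->] := edge_endP xe.
by rewrite cards2; case: (_ != _).
Qed.

Lemma near_weights_cover v : near_weights v = (\bigcup_(u in nb 1 v) covering u)%SET.
Proof.
apply/setP => i; rewrite inE; apply/existsP/bigcupP.
  move=> [u /andP[ui uv]]; exists u; last by rewrite inE.
  case/orP : uv => [/eqP ->|vu]; first exact: nb_self.
  rewrite /= !inE; apply/orP; right; apply/bigcupP; exists u; rewrite inE//.
  by rewrite adj_sym.
move=> [u]; rewrite /= !inE => uv ui; exists u; rewrite ui /=.
case/predU1P : uv => [->|/bigcupP[z]]; first by rewrite eqxx.
by rewrite !inE => vz /eqP ->; rewrite adj_sym vz orbT.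
Qed.

Lemma card_near_weights v : (#|near_weights v| <= D.+1 * D.+1)%N.
Proof.
rewrite near_weights_cover.
apply: (leq_trans (card_bigcup_const (fun u _ => card_covering u))).
by rewrite leq_mul2r; have := card_nb 1 v; rewrite expn1 => h; apply/orP; right.
Qed.

Lemma card_near_weights_dual i :
  (#|[set v | i \in near_weights v]%SET| <= 2 * D.+1)%N.
Proof.
apply: (@leq_trans #|\bigcup_(u in ends i) nb 1 u|%SET).
  apply/subset_leq_card/fintype.subsetP => v; rewrite inE near_weights_cover.
  move=> /bigcupP[u uv]; rewrite inE => ui; apply/bigcupP; exists u => //.
  exact: nb_sym.
apply: (leq_trans (card_bigcup_const (n := D.+1) _)) => [u _|].
  by have := card_nb 1 u; rewrite expn1.
by rewrite leq_mul2r card_ends orbT.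
Qed.

Definition center i : G := xchoose (ends_neq0 i).

Lemma center_in i : center i \in ends i. Proof. exact: xchooseP. Qed.

Lemma ends_nb r i : (ends i \subset nb r.+1 (center i))%SET.
Proof.
have := center_in i; case: i => [e|x]; rewrite /ends; last first.
  by rewrite inE => /eqP ->; rewrite finset.sub1set nb_self.
move=> /edge_endP[y xy ->]; rewrite finset.subUset !finset.sub1set nb_self.
apply: (path_nb (p := [:: y])) => //=; first by rewrite xy.
by rewrite inE.
Qed.

(** The center of a ball that meets the one around [center i] is at most two
    radii away from it. *)
Lemma card_ball_overlap r i :
  (#|[set j | nb r (center i) :&: nb r (center j) != finset.set0]%SET|
   <= D.+1 ^ r * (D.+1 ^ r * D.+1))%N.
Proof.
apply: (@leq_trans #|\bigcup_(y in nb r (center i)) \bigcup_(z in nb r y) covering z|%SET).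
  apply/subset_leq_card/fintype.subsetP => j; rewrite inE => /set0Pn[y].
  rewrite inE => /andP[yi yj]; apply/bigcupP; exists y => //.
  apply/bigcupP; exists (center j); first exact: nb_sym.
  by rewrite inE center_in.
apply: (leq_trans (card_bigcup_const (n := (D.+1 ^ r * D.+1)%N) _)) => [y _|].
  apply: (leq_trans (card_bigcup_const (fun u _ => card_covering u))).
  by rewrite leq_mul2r card_nb orbT.
by rewrite leq_mul2r card_nb orbT.
Qed.

Section Decay.
Variables (K L : R).
Hypothesis LE : L = D%:R * expR (3 * K).

(** The ratio of an edge is the product of two ratios of vertices, whence the
    factor 2. *)
Lemma occupation_decay c (k t : nat) i :
  (forall u p, u \in ends i -> size p = k -> path (@adj G) u p ->
     uniq (u :: p) -> (t < count (good c K) (u :: p))%N) ->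
  `|occupation c finset.setT i - occupation c (nb k.+1 (center i)) i| <=
  2 * (theta L ^+ t * ln (1 + L)).
Proof.
move=> many; set S := nb k.+1 (center i); have iS : (ends i \subset S)%SET by exact: ends_nb.
have b0 : 0 <= theta L ^+ t * ln (1 + L).
  have L0 := L_ge0 LE; have /andP[th0 _] := theta01 LE.
  by rewrite mulr_ge0 ?exprn_ge0// ln_ge0// lerDl.
apply: (le_trans (dist_le_dist_ln (occupation01 c (finset.subsetT _)) (occupation01 c iS))).
have lnr A B : ln (expR (c i) * Zratio c A B) = c i + ln (Zratio c A B).
  have e0 := expR_gt0 (c i); have z0 := ratio_gt0 c A B.
  by rewrite lnM ?posrE// expRK.
rewrite /occupation !lnr opprD addrACA subrr add0r.
have xi := center_in i.
have decay x (A B : {set G}) : x \in ends i -> (B \subset A)%SET -> x \in B ->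
    (forall p, (size p <= k)%N -> path (@adj G) x p -> {subset p <= A} ->
     {subset p <= B}) ->
    `|ln (Zratio c A [set x]%SET) - ln (Zratio c B [set x]%SET)| <=
    theta L ^+ t * ln (1 + L).
  move=> xe BA xB hp; apply: (ratio_decay LE degD (k := k)) => // p sp xp up _.
  exact: many.
have xS : center i \in S by exact: nb_self.
have d1 : `|ln (Zratio c finset.setT [set center i]%SET) - ln (Zratio c S [set center i]%SET)| <=
    theta L ^+ t * ln (1 + L).
  apply: decay => //.
  move=> p sp xp _; apply: path_nb => //; exact: leqW.
move: xi iS d1 xS decay {lnr}; rewrite {}/S; case: i many => [e|x] many; last first.
  rewrite /= inE => /eqP -> _ d1 _ _; apply: (le_trans d1).
  by rewrite mulr_natl mulr2n lerDl.
set x := center (inl e) => xe iS d1 xS decay.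
have [y [xy eE exE]] := edge_set1 (xe : x \in val e).
have yx : y != x by apply: contraTneq xy => ->; rewrite adj_irr.
have Ze A : Zratio c A (ends (inl e)) = Zratio c A [set x]%SET * Zratio c (A :\ x)%SET [set y]%SET.
  rewrite /Zratio /= -exE setDD1//.
  by field; rewrite !gt_eqF ?Zsub_gt0.
have lnrr A B A' B' : ln (Zratio c A B * Zratio c A' B') =
    ln (Zratio c A B) + ln (Zratio c A' B').
  have z0 := ratio_gt0 c A B; have z'0 := ratio_gt0 c A' B'.
  by rewrite lnM ?posrE.
rewrite !Ze !lnrr opprD addrACA.
apply: (le_trans (ler_normD _ _)); rewrite mulr_natl mulr2n lerD//.
have yS : y \in nb k.+1 x.
  by apply: (fintype.subsetP iS); rewrite /= eE !inE eqxx orbT.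
apply: decay.
- by rewrite /= eE !inE eqxx orbT.
- exact/finset.setSD/finset.subsetT.
- by rewrite finset.in_setD1 yx.
- move=> p sp yp pA z zp; have zx : z != x.
    by have := pA z zp; rewrite !inE andbT.
  rewrite finset.in_setD1 zx; apply: (path_nb (p := y :: p)) => //=.
    by rewrite xy.
  by rewrite inE zp orbT.
Qed.

End Decay.

End Bounded.
End Occupation.

(** * Scarcity of extreme weights along paths *)

Section BadPaths.
Context {R : realType} {G : sgraph}.
Local Notation I := (edge G + G)%type.
Implicit Types (c : I -> R) (x y v : G) (i : I) (s p : seq G) (J : {set I}).
Variable D : nat.
Hypothesis degD : forall x, (degree x <= D)%N.

Fixpoint paths (k : nat) x : seq (seq G) :=
  if k is k'.+1 then
    flatten [seq [seq y :: p | p <- paths k' y] | y <- enum [set y | adj x y]%SET]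
  else [:: [::]].

Lemma mem_paths k x p : size p = k -> path (@adj G) x p -> p \in paths k x.
Proof.
elim: k x p => [|k IH] x [|y p]//= [sp] /andP[xy yp].
apply/flatten_mapP; exists y; first by rewrite mem_enum inE.
by apply: map_f; exact: IH.
Qed.

Lemma size_in_paths k x p : p \in paths k x -> size p = k.
Proof.
elim: k x p => [|k IH] x p /=; first by rewrite inE => /eqP ->.
by move=> /flatten_mapP[y _ /mapP[q qy ->]] /=; rewrite (IH y).
Qed.

Lemma size_paths k x : (size (paths k x) <= D ^ k)%N.
Proof.
elim: k x => [|k IH] x //=; rewrite size_flatten /shape -map_comp.
rewrite expnS (@leq_trans (degree x * D ^ k)%N)//; last by rewrite leq_mul2r degD orbT.
rewrite /degree cardE; elim: (enum _) => //= y ys IHy.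
by rewrite mulSn leq_add// size_map.
Qed.

Definition near_path s : {set I} := (\bigcup_(v in [set v | v \in s]) near_weights v)%SET.

Lemma card_near_path s : (#|near_path s| <= size s * (D.+1 * D.+1))%N.
Proof.
apply: (leq_trans (card_bigcup_const (fun v _ => card_near_weights degD v))).
by rewrite leq_mul2r cardsE card_size orbT.
Qed.

(** Every bad vertex sees an extreme weight, and a weight is seen from a
    bounded number of vertices. *)
Lemma extreme_subset (K : R) c s (t q : nat) : uniq s ->
  (count (good c K) s <= t)%N -> (t + q * (2 * D.+1) <= size s)%N ->
  exists J, [/\ (J \subset near_path s)%SET, #|J| = q &
                forall i, i \in J -> extreme c K i].
Proof.
move=> us ct ss.
pose bad := [set v | (v \in s) && ~~ good c K v]%SET.
pose E := [set i | (i \in near_path s) && extreme c K i]%SET.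
have bad_ge : (q * (2 * D.+1) <= #|bad|)%N.
  rewrite cardsE (@eq_card _ _ (mem (seq.filter (predC (good c K)) s))); last first.
    by move=> v; rewrite mem_filter andbC.
  rewrite (card_uniqP (filter_uniq _ us)) size_filter.
  by have := count_predC (good c K) s; lia.
have bad_le : (#|bad| <= #|E| * (2 * D.+1))%N.
  apply: leq_trans (card_bigcup_const (fun i _ => card_near_weights_dual degD i)).
  apply/subset_leq_card/fintype.subsetP => v; rewrite inE => /andP[vs].
  rewrite negb_forall => /existsP[i]; rewrite negb_imply negbK => /andP[iv ei].
  apply/bigcupP; exists i; last by rewrite inE.
  by rewrite inE ei andbT; apply/bigcupP; exists v => //; rewrite inE.
have qE : (q <= #|E|)%N.
  by have := leq_trans bad_ge bad_le; rewrite leq_mul2r.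
have /card_geqP[r [ur sr rE]] := qE.
exists [set i in r]%SET; split.
- by apply/fintype.subsetP => i; rewrite inE => /rE; rewrite inE => /andP[].
- by rewrite cardsE (card_uniqP ur).
- by move=> i; rewrite inE => /rE; rewrite inE => /andP[].
Qed.

Definition extreme_prod (K : R) c J : R := \prod_(i in J) (extreme c K i)%:R.

Lemma extreme_prod_ge0 K c J : 0 <= extreme_prod K c J.
Proof. by apply: prodr_ge0 => i _; rewrite ler0n. Qed.

(** A union bound for the event that some path of length k from x meets at
    least q extreme weights. *)
Definition bad_sum (K : R) (k q : nat) c x : R :=
  \sum_(p <- paths k x) \sum_(J in powerset (near_path (x :: p)) | #|J| == q)
    extreme_prod K c J.

Lemma bad_sum_ge0 K k q c x : 0 <= bad_sum K k q c x.
Proof. by do 2 (apply: sumr_ge0 => ? _); exact: extreme_prod_ge0. Qed.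

Lemma bad_sum_ge1 K t q c x p : size p = (t + q * (2 * D.+1))%N ->
  path (@adj G) x p -> uniq (x :: p) -> (count (good c K) (x :: p) <= t)%N ->
  1 <= bad_sum K (t + q * (2 * D.+1)) q c x.
Proof.
move=> sp xp up cp; have pk := mem_paths sp xp.
have [|J [Jn Jq JE]] := extreme_subset up cp (q := q); first by rewrite /= sp.
rewrite /bad_sum (big_rem p)//= -[X in X <= _]addr0; apply: lerD; last first.
  by do 2 (apply: sumr_ge0 => ? _); exact: extreme_prod_ge0.
rewrite (bigD1 J)/=; last by rewrite powersetE Jn Jq eqxx.
rewrite /extreme_prod big1 => [|i iJ]; last by rewrite JE.
by rewrite lerDl; apply: sumr_ge0 => ? _; exact: extreme_prod_ge0.
Qed.

(** Either all simple paths of length k from the ends of i have more than t good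
    vertices, or a bad sum is at least 1 and dominates the difference of two
    probabilities. *)
Lemma occupation_close (K L : R) (k t q : nat) c i :
  L = D%:R * expR (3 * K) ->
  k = (t + q * (2 * D.+1))%N ->
  `|occupation c finset.setT i - occupation c (nb k.+1 (center i)) i| <=
  2 * (theta L ^+ t * ln (1 + L)) + \sum_(u in ends i) bad_sum K k q c u.
Proof.
move=> LE kE.
have bs0 u : 0 <= bad_sum K k q c u by exact: bad_sum_ge0.
have L0 := L_ge0 LE; have /andP[th0 _] := theta01 LE.
have b0 : 0 <= 2 * (theta L ^+ t * ln (1 + L)).
  by rewrite !mulr_ge0 ?exprn_ge0// ln_ge0// lerDl.
case: (boolP [exists u in ends i, has (fun p => [&& path (@adj G) u p, uniq (u :: p) &
    (count (good c K) (u :: p) <= t)%N]) (paths k u)]) => [|hN].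
  move=> /exists_inP[u ui /hasP[p pk /and3P[up uu cp]]].
  have h1 : 1 <= bad_sum K k q c u.
    rewrite kE; apply: (bad_sum_ge1 (p := p)) => //; rewrite -kE.
    exact: size_in_paths pk.
  rewrite (bigD1 u)//=; apply: (@le_trans _ _ 1).
    have /andP[m0 m1] := occupation01 c (finset.subsetT (ends i)).
    have /andP[r0 r1] := occupation01 c (ends_nb k i).
    by rewrite ler_norml; apply/andP; split; lra.
  have : 0 <= \sum_(j in ends i | j != u) bad_sum K k q c j by apply: sumr_ge0.
  by lra.
apply: (@le_trans _ _ (2 * (theta L ^+ t * ln (1 + L)))); last first.
  by rewrite lerDl; apply: sumr_ge0.
apply: (occupation_decay degD LE) => u p ui sp up uu.
rewrite ltnNge; apply/negP => cp; move/negP : hN; apply.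
apply/exists_inP; exists u => //; apply/hasP; exists p; first exact: mem_paths.
by rewrite up uu.
Qed.

Lemma measurable_extreme (K : R) : measurable [set x : R | (K < `|x|)%R].
Proof.
rewrite (_ : [set x | _] = (fun x : R => `|x|) @^-1` `]K, +oo[); last first.
  by apply/seteqP; split=> x /=; rewrite in_itv/= andbT.
have mn : measurable_fun setT (fun x : R => `|x|) by exact: measurableT_comp.
by rewrite -[X in measurable X]setTI; exact: mn.
Qed.

Section Expectation.
Context {d : measure_display} {T : measurableType d}.
Variable P : probability T R.
Variables (Y : I -> T -> R) (K pr : R).
Hypothesis iY : indep P Y.
Hypothesis pr0 : 0 <= pr.
Hypothesis tailY : forall i, fine (P (Y i @^-1` [set x : R | (K < `|x|)%R])) <= pr.

Let A J i : set R := if i \in J then [set x : R | (K < `|x|)%R] else setT.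

Let mA J i : measurable (A J i).
Proof. by rewrite /A; case: ifP => // _; exact: measurable_extreme. Qed.

Let extreme_prodE J : (fun t => extreme_prod K (Y^~ t) J) =
  \1_[set t | forall i, A J i (Y i t)].
Proof.
apply/funext => t; rewrite indicE /extreme_prod.
case: (boolP (t \in _)) => [|/negP]; rewrite inE /= => h.
  rewrite big1// => i iJ; have := h i; rewrite /A iJ /= => ei.
  by rewrite /extreme ei.
have [i iJ ei] : exists2 i, i \in J & ~~ extreme (Y^~ t) K i.
  apply/exists_inP; apply: contra_notT h => /exists_inPn h i.
  by rewrite /A; case: ifP => // iJ; move: (h i iJ); rewrite negbK.
by rewrite (bigD1 i)//= (negbTE ei) mul0r.
Qed.

Let mE J : measurable [set t | forall i, A J i (Y i t)].
Proof. by apply: measurable_allset => //; exact: (proj1 iY). Qed.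

Lemma itg_extreme_prod J : itg P (fun t => extreme_prod K (Y^~ t) J).
Proof. by rewrite extreme_prodE; exact: itg_indic. Qed.

Lemma ex_extreme_prod J :
  \int[P]_t extreme_prod K (Y^~ t) J <= pr ^+ #|J|.
Proof.
rewrite extreme_prodE ex_indic// (proj2 iY)//.
have -> : (\prod_i P (Y i @^-1` A J i))%E =
    (\prod_i fine (P (Y i @^-1` A J i)))%:E.
  elim/big_ind2 : _ => // [? ? ? ? -> ->//|i _].
  by rewrite fineK// fin_num_measure// -[X in measurable X]setTI; exact: (proj1 iY).
rewrite /= (bigID (mem J))/= [X in _ * X]big1 ?mulr1; last first.
  by move=> i iJ; rewrite /A (negbTE iJ) preimage_setT probability_setT.
rewrite -prodr_const; apply: ler_prod => i iJ.
by rewrite fine_ge0//= /A iJ tailY.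
Qed.

Lemma ex_bad_sum k q x : itg P (fun t => bad_sum K k q (Y^~ t) x) /\
  \int[P]_t bad_sum K k q (Y^~ t) x <=
  (D ^ k * 2 ^ (k.+1 * (D.+1 * D.+1)))%:R * pr ^+ q.
Proof.
have i1 p : itg P (fun t => \sum_(J in powerset (near_path (x :: p)) | #|J| == q)
    extreme_prod K (Y^~ t) J).
  by apply: itg_sum => J _; exact: itg_extreme_prod.
split; first by apply: itg_sum => p _; exact: i1.
rewrite ex_sum//.
apply: (@le_trans _ _ (\sum_(p <- paths k x) (2 ^ (k.+1 * (D.+1 * D.+1)))%:R * pr ^+ q)).
  rewrite big_seq [leRHS]big_seq; apply: ler_sum => p pk.
  rewrite ex_sum => [|J _]; last exact: itg_extreme_prod.
  apply: (@le_trans _ _ (\sum_(J in powerset (near_path (x :: p)) | #|J| == q) pr ^+ q)).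
    by apply: ler_sum => J /andP[_ /eqP <-]; exact: ex_extreme_prod.
  rewrite sumr_const -[leLHS]mulr_natl ler_wpM2r ?exprn_ge0// ler_nat.
  apply: (@leq_trans #|powerset (near_path (x :: p))|).
    by apply/subset_leq_card/fintype.subsetP => J /andP[].
  rewrite card_powerset leq_exp2l//; apply: leq_trans (card_near_path _) _.
  by rewrite /= (size_in_paths pk).
rewrite big_const_seq count_predT iter_addr_0 -[leLHS]mulr_natl natrM -mulrA.
by rewrite ler_wpM2r ?mulr_ge0 ?exprn_ge0// ler_nat size_paths.
Qed.

Lemma ex_occupation_close (L : R) (k t q : nat) i :
  L = D%:R * expR (3 * K) ->
  k = (t + q * (2 * D.+1))%N ->
  \int[P]_w `|occupation (Y^~ w) finset.setT i -
              occupation (Y^~ w) (nb k.+1 (center i)) i| <=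
  2 * (theta L ^+ t * ln (1 + L)) +
  2 * ((D ^ k * 2 ^ (k.+1 * (D.+1 * D.+1)))%:R * pr ^+ q).
Proof.
move=> LE kE.
have mo S : measurable_fun setT (fun w => occupation (Y^~ w) S i).
  exact: measurableT_comp (measurable_occupation S i) (measurable_cfg (proj1 iY)).
have io (S : {set G}) : (ends i \subset S)%SET -> itg P (fun w => occupation (Y^~ w) S i).
  move=> iS; apply: (@itg_bounded _ _ _ _ _ 1) => // w.
  by rewrite ger0_norm ?occupation_le1// ltW// occupation_gt0.
have ib u : itg P (fun w => bad_sum K k q (Y^~ w) u) by case: (ex_bad_sum k q u).
apply: (@le_trans _ _ (\int[P]_w (2 * (theta L ^+ t * ln (1 + L)) +
    \sum_(u in ends i) bad_sum K k q (Y^~ w) u))).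
  apply: ex_le => [||w].
  - by apply: itg_norm; apply: itgB; apply: io; [exact: finset.subsetT|exact: ends_nb].
  - by apply: itgD; [exact: itg_cst|exact: itg_sum].
  exact: occupation_close.
rewrite exD; [|exact: itg_cst|exact: itg_sum].
rewrite ex_cst lerD2l ex_sum//.
apply: (@le_trans _ _ (\sum_(u in ends i)
    ((D ^ k * 2 ^ (k.+1 * (D.+1 * D.+1)))%:R * pr ^+ q))).
  by apply: ler_sum => u _; case: (ex_bad_sum k q u).
rewrite sumr_const -[leLHS]mulr_natl ler_wpM2r ?mulr_ge0 ?exprn_ge0//.
by rewrite ler_nat card_ends.
Qed.

End Expectation.

End BadPaths.

(** * Local approximation of the exchange terms *)

Section DecayRate.
Context {R : realType}.

Lemma expr_small (z eps : R) : 0 <= z < 1 -> 0 < eps ->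
  exists N : nat, forall t, (N <= t)%N -> z ^+ t <= eps.
Proof.
move=> /andP[z0 z1] e0.
have : (GRing.exp z) @ \oo --> (0 : R) by apply: cvg_expr; rewrite ger0_norm.
move/cvgrPdist_le => /(_ _ e0)[N _ hN]; exists N => t /hN.
by rewrite sub0r normrN ger0_norm// exprn_ge0.
Qed.

(** The threshold p0 beats the number of paths and of sets of weights along
    them; once K makes weights above K that rare, a long enough radius makes
    the truncation error small. *)
Lemma decay_rate (D : nat) : exists2 p0 : R, 0 < p0 &
  forall (K L eta : R), L = D%:R * expR (3 * K) -> 0 < eta ->
  exists k t q : nat, k = (t + q * (2 * D.+1))%N /\
    forall pr : R, 0 <= pr <= p0 ->
    2 * (theta L ^+ t * ln (1 + L)) +
    2 * ((D ^ k * 2 ^ (k.+1 * (D.+1 * D.+1)))%:R * pr ^+ q) <= eta.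
Proof.
pose a := (D.+1 * D.+1)%N; pose b := (1 + 2 * D.+1)%N.
pose M := (D ^ b * 2 ^ (b * a))%N.
exists (2 * (M%:R + 1))^-1; first by rewrite invr_gt0 mulr_gt0 ?ltr_wpDl.
move=> K L eta LE eta0.
have L0 := L_ge0 LE; have th01 := theta01 LE.
have lnL0 : 0 <= ln (1 + L) by rewrite ln_ge0// lerDl.
have [N1 h1] := expr_small th01 (eps := eta / (4 * (ln (1 + L) + 1))) ltac:(by
  rewrite divr_gt0// mulr_gt0// ltr_wpDl).
have half01 : 0 <= (2^-1 : R) < 1 by apply/andP; split; lra.
have pa0 : 0 < (2 ^ a)%:R :> R by rewrite ltr0n expn_gt0.
have [N2 h2] := expr_small half01 (eps := eta / (4 * (2 ^ a)%:R)) ltac:(by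
  rewrite divr_gt0// mulr_gt0).
pose t := (N1 + N2)%N; exists (t * b)%N, t, t.
split; first by rewrite /b mulnDr muln1.
move=> pr /andP[pr0 prM].
(* With q = t and k = t * b, the number of pairs of a path and a set of weights
   near it is at most 2 ^ a * M ^ t. *)
have -> : (D ^ (t * b) * 2 ^ ((t * b).+1 * (D.+1 * D.+1)))%N = (2 ^ a * M ^ t)%N.
  rewrite -/a mulSn expnD mulnCA expnMn -!expnM; congr (_ * (_ ^ _ * _ ^ _))%N; lia.
rewrite natrM [(M ^ t)%:R]natrX -mulrA -exprMn.
have Mpr : 0 <= M%:R * pr <= 2^-1.
  rewrite mulr_ge0//=; apply: (@le_trans _ _ (M%:R * (2 * (M%:R + 1))^-1)).
    by rewrite ler_wpM2l.
  have M0 : 0 <= M%:R :> R by rewrite ler0n.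
  rewrite ler_pdivrMr; last by lra.
  by lra.
have e1 : (M%:R * pr) ^+ t <= eta / (4 * (2 ^ a)%:R).
  case/andP : Mpr => M0 Mh; apply: le_trans (h2 t _); last by rewrite leq_addl.
  by rewrite lerXn2r ?nnegrE//; lra.
have e2 := h1 t (leq_addr _ _).
have f1 : (2 ^ a)%:R * (M%:R * pr) ^+ t <= eta / 4.
  apply: (@le_trans _ _ ((2 ^ a)%:R * (eta / (4 * (2 ^ a)%:R)))).
    by rewrite ler_wpM2l// ltW.
  by rewrite le_eqVlt; apply/orP; left; apply/eqP; field; rewrite gt_eqF.
have f2 : theta L ^+ t * ln (1 + L) <= eta / 4.
  apply: (@le_trans _ _ (eta / (4 * (ln (1 + L) + 1)) * ln (1 + L))).
    by rewrite ler_wpM2r.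
  rewrite mulrAC ler_pdivrMr ?mulr_gt0 ?ltr_wpDl//.
  nra.
by lra.
Qed.

End DecayRate.

Section LocalApproximation.
Context {R : realType} {G : sgraph}.
Local Notation I := (edge G + G)%type.
Variable D : nat.
Hypothesis degD : forall x : G, (degree x <= D)%N.
Context {d : measure_display} {T : measurableType d}.
Variable P : probability T R.
Variable X : I + I -> T -> R.
Hypothesis iX : indep P X.
Hypothesis lX : forall i, same_law P (X (inl i)) P (X (inr i)).
Hypothesis sX : forall b, sqitg P (X b).

Definition shift_of (b : I + I -> R) (k : I) : R := b (inl k) - b (inr k).

Definition local_jump (S : {set G}) (A : {set I}) (k : I) (b : I + I -> R) : R :=
  log_tilt (shift_of b k) (occupation (fun i => b (mix A i)) S k).

Lemma jump_log_partition k (A : {set I}) t : k \notin A ->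
  jump X (@log_partition R G) k A t =
  local_jump finset.setT (k |: A)%SET k (X^~ t).
Proof.
move=> kA; rewrite /jump /at_mix /log_partition /local_jump.
rewrite (ln_Zsub_jump (i := k) (finset.subsetT _)); last first.
  by move=> i ik; rewrite mix_out.
by rewrite /mix (negbTE kA) setU11.
Qed.

Lemma measurable_local_jump S A k :
  measurable_fun setT (fun b : @cfg R (I + I)%type => local_jump S A k b).
Proof.
have ms : measurable_fun setT (fun b : @cfg R (I + I)%type => shift_of b k).
  by apply: measurable_funB; exact: measurable_coord.
apply: (measurableT_comp (@measurable_ln R)).
apply: measurable_funD; first exact: measurable_cst.
apply: measurable_funM.
  apply: measurable_funB; last exact: measurable_cst.
  exact: (measurableT_comp (@measurable_expR R)).
exact: (measurable_mix_cfg A (measurable_occupation S k)).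
Qed.

Variables (K' : R) (r : nat).
Hypothesis K'0 : 0 <= K'.

Let B (k : I) : {set G} := nb r.+1 (center k).

Definition copy_of (b : I + I) : I := match b with inl i => i | inr i => i end.

Definition window k : {set I + I} := [set b | ends (copy_of b) \subset B k]%SET.

Definition small_pair k (b : I + I -> R) : R :=
  (`|b (inl k)| + `|b (inr k)| <= K')%R%:R.

(** A bounded substitute for the exchange term that reads only the weights in a
    ball around k. *)
Definition local_term k (b : @cfg R (I + I)%type) : R :=
  2^-1 * (local_jump (B k) [set k]%SET k b *
          local_jump (B k) (k |: before k)%SET k b) * small_pair k b.

Lemma measurable_small_pair k :
  measurable_fun setT (fun b : @cfg R (I + I)%type => small_pair k b).
Proof.
have ma : measurable_fun setT
    (fun b : @cfg R (I + I)%type => `|b (inl k)| + `|b (inr k)|).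
  by apply: measurable_funD; apply: measurableT_comp => //; exact: measurable_coord.
rewrite (_ : (fun b => _) = \1_((fun b : @cfg R (I + I)%type => `|b (inl k)| + `|b (inr k)|)
    @^-1` `]-oo, K'])).
  by apply: measurable_indic; rewrite -[X in measurable X]setTI; exact: ma.
by apply/funext => b; rewrite indic_ray.
Qed.

Lemma measurable_local_term k : measurable_fun setT (local_term k).
Proof.
apply: measurable_funM; last exact: measurable_small_pair.
apply: measurable_funM; first exact: measurable_cst.
by apply: measurable_funM; exact: measurable_local_jump.
Qed.

Lemma shift_le k b : `|shift_of b k| <= `|b (inl k)| + `|b (inr k)|.
Proof. exact: ler_normB. Qed.

Lemma local_jump_le (S : {set G}) A k b : (ends k \subset S)%SET ->
  `|local_jump S A k b| <= `|b (inl k)| + `|b (inr k)|.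
Proof.
move=> kS; apply: le_trans (shift_le k b); apply: log_tilt_le.
by rewrite ltW ?occupation_gt0 ?occupation_le1.
Qed.

Lemma local_term_le k b : `|local_term k b| <= K' ^+ 2.
Proof.
have j1 := local_jump_le [set k]%SET b (ends_nb r k).
have j2 := local_jump_le (k |: before k)%SET b (ends_nb r k).
rewrite /local_term /small_pair; case: (leP (_ + _) K') => h; last first.
  by rewrite mulr0 normr0 sqr_ge0.
rewrite mulr1 normrM ger0_norm// normrM.
apply: (@le_trans _ _ (2^-1 * (K' * K'))).
  by rewrite ler_wpM2l// ler_pM// (le_trans _ h).
by rewrite expr2 ler_piMl ?mulr_ge0// invf_le1// ler1n.
Qed.

Lemma local_term_local k : depends_on (window k) (local_term k).
Proof.
move=> b b' bb'.
have kB := ends_nb r k.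
have e1 : b (inl k) = b' (inl k) by apply: bb'; rewrite inE.
have e2 : b (inr k) = b' (inr k) by apply: bb'; rewrite inE.
have eo A : occupation (fun i => b (mix A i)) (B k) k =
            occupation (fun i => b' (mix A i)) (B k) k.
  apply: occupation_ext => // j jB; apply: bb'; rewrite inE /mix.
  by case: ifP.
by rewrite /local_term /local_jump /small_pair /shift_of e1 e2 !eo.
Qed.

Lemma card_window_overlap k :
  (#|[set l | window k :&: window l != finset.set0]%SET|
   <= D.+1 ^ r.+1 * (D.+1 ^ r.+1 * D.+1))%N.
Proof.
apply: leq_trans (card_ball_overlap degD r.+1 k).
apply/subset_leq_card/fintype.subsetP => l; rewrite !inE => /set0Pn[b].
rewrite !inE => /andP[bk bl]; have [x xb] := ends_neq0 (copy_of b).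
apply/set0Pn; exists x; rewrite inE.
by rewrite (fintype.subsetP bk)// (fintype.subsetP bl).
Qed.

Variables (eps tau : R).
Hypothesis occ_close : forall (A : {set I}) k,
  \int[P]_t `|occupation (fun i => X (mix A i) t) finset.setT k -
              occupation (fun i => X (mix A i) t) (B k) k| <= eps.
Hypothesis amp_tail : forall k,
  \int[P]_t (amplitude X k t ^+ 2 * (K' < amplitude X k t)%R%:R) <= tau.

(** Below the amplitude K' the increments are Lipschitz functions of the
    occupation probabilities; above it the exchange term is dominated by the
    squared amplitude. *)
Lemma local_term_close k :
  \int[P]_t `|exchange_term X (@log_partition R G) k t - local_term k (X^~ t)|
  <= tau + K' * expR (2 * K') * (2 * eps).
Proof.
pose Do (A : {set I}) t := `|occupation (fun i => X (mix A i) t) finset.setT k -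
              occupation (fun i => X (mix A i) t) (B k) k|.
have kB := ends_nb r k.
have mX A := measurable_cfg (proj1 (indep_inj (@mix_inj I A) iX)).
have iDo A : itg P (Do A).
  have mo S : measurable_fun setT (fun t => occupation (fun i => X (mix A i) t) S k).
    exact: measurableT_comp (measurable_occupation S k) (mX A).
  have io (S : {set G}) : (ends k \subset S)%SET ->
      itg P (fun t => occupation (fun i => X (mix A i) t) S k).
    move=> kS; apply: (@itg_bounded _ _ _ _ _ 1) => // t.
    by rewrite ger0_norm ?occupation_le1// ltW// occupation_gt0.
  by apply: itg_norm; apply: itgB; apply: io; [exact: finset.subsetT|exact: kB].
set C := K' * expR (2 * K').
have C0 : 0 <= C by rewrite mulr_ge0// expR_ge0.
set A1 := [set k]%SET; set A2 := (k |: before k)%SET.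
apply: (@le_trans _ _ (\int[P]_t (amplitude X k t ^+ 2 * (K' < amplitude X k t)%R%:R
    + C * (Do A1 t + Do A2 t)))).
  apply: ex_le => [||t].
  - apply: itg_norm; apply: itgB.
      exact: (itg_exchange_term iX lX sX (@measurable_log_partition R G) (@log_partition_lipschitz R G)).
    apply: (@itg_bounded _ _ _ _ _ (K' ^+ 2)) => [|t]; last exact: local_term_le.
    exact: measurableT_comp (measurable_local_term k) (measurable_cfg (proj1 iX)).
  - by apply: itgD; [exact: (itg_amplitude_tail sX)|apply: itgZ; exact: itgD].
  rewrite /exchange_term !jump_log_partition ?notin_before ?inE// finset.setU0 -/A1 -/A2.
  rewrite /local_term /small_pair -/(amplitude X k t) -/A1 -/A2.
  set b := X^~ t.
  have j1 : `|local_jump finset.setT A1 k b| <= amplitude X k t.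
    by apply: local_jump_le; exact: finset.subsetT.
  have j2 : `|local_jump finset.setT A2 k b| <= amplitude X k t.
    by apply: local_jump_le; exact: finset.subsetT.
  have l1 : `|local_jump (B k) A1 k b| <= amplitude X k t by exact: local_jump_le.
  have l2 : `|local_jump (B k) A2 k b| <= amplitude X k t by exact: local_jump_le.
  have a0 := amplitude_ge0 X k t.
  have Do0 A : 0 <= Do A t by exact: normr_ge0.
  have D0 : 0 <= C * (Do A1 t + Do A2 t) by rewrite mulr_ge0// addr_ge0.
  case: (leP (amplitude X k t) K') => aK.
    rewrite mulr1 mulr0 add0r -mulrBr.
    have lip A : `|local_jump finset.setT A k b - local_jump (B k) A k b| <=
        expR (2 * K') * Do A t.
      apply: (le_trans (log_tilt_lipschitz _ _ _)).
      - by rewrite ltW ?occupation_gt0 ?occupation_le1 ?finset.subsetT.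
      - by rewrite ltW ?occupation_gt0 ?occupation_le1.
      apply: ler_wpM2r => //; rewrite ler_expR ler_wpM2l//.
      exact: le_trans (shift_le k b) aK.
    set x := local_jump finset.setT A1 k b in j1 *.
    set y := local_jump finset.setT A2 k b in j2 *.
    set x' := local_jump (B k) A1 k b in l1 *.
    set y' := local_jump (B k) A2 k b in l2 *.
    have -> : x * y - x' * y' = (x - x') * y + x' * (y - y') by ring.
    rewrite normrM ger0_norm//.
    apply: (@le_trans _ _ (2^-1 * (C * (Do A1 t + Do A2 t)))); last first.
      by rewrite ler_piMl// invf_le1// ler1n.
    rewrite ler_wpM2l//; apply: (le_trans (ler_normD _ _)).
    rewrite [leRHS]mulrDr lerD//.
      rewrite normrM mulrC /C -mulrA; apply: ler_pM => //; last exact: lip.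
      exact: le_trans j2 aK.
    rewrite normrM /C -mulrA; apply: ler_pM => //; last exact: lip.
    exact: le_trans l1 aK.
  rewrite !mulr0 subr0 mulr1 (@le_trans _ _ (amplitude X k t ^+ 2))//; last by rewrite lerDl.
  rewrite normrM ger0_norm// normrM; apply: (@le_trans _ _ (2^-1 * amplitude X k t ^+ 2)).
    by rewrite ler_wpM2l// expr2 ler_pM.
  by rewrite ler_piMl ?sqr_ge0// invf_le1// ler1n.
rewrite exD; [|exact: (itg_amplitude_tail sX)|by apply: itgZ; exact: itgD].
rewrite lerD// exZ; last exact: itgD.
rewrite ler_wpM2l// exD// mulr_natl mulr2n lerD//; exact: occ_close.
Qed.

End LocalApproximation.

(** * Linear growth of the variance *)

Lemma norm_bool_le1 (R : realType) (b : bool) : `|b%:R : R| <= 1.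
Proof. by case: b; rewrite ?normr1 ?normr0. Qed.

Section EdgeInfluence.
Context {R : realType} {G : sgraph}.
Local Notation I := (edge G + G)%type.
Implicit Types (c : I -> R) (e : edge G).
Variable D : nat.
Hypothesis degD : forall x : G, (degree x <= D)%N.

Definition reset (i : I) c : I -> R := fun j => if j == i then 0 else c j.

Lemma log_tilt_mono (a b p : R) : 0 <= p <= 1 -> b <= a ->
  log_tilt b p <= log_tilt a p.
Proof.
move=> p01 ab; rewrite /log_tilt ler_ln ?posrE ?tilt_gt0// lerD2l.
by case/andP : p01 => p0 _; rewrite ler_wpM2r// lerD2r ler_expR.
Qed.

(** The derivative of [log_tilt] in its first argument increases with the
    second one. *)
Lemma log_tilt_increment (a b p q : R) : 0 <= p <= 1 -> 0 <= q <= 1 ->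
  p <= q -> b <= a ->
  log_tilt a p - log_tilt b p <= log_tilt a q - log_tilt b q.
Proof.
move=> p01 q01 pq ab.
have tap := tilt_gt0 a p01; have tbp := tilt_gt0 b p01.
have taq := tilt_gt0 a q01; have tbq := tilt_gt0 b q01.
rewrite /log_tilt -!ln_div ?posrE// ler_ln ?posrE ?divr_gt0//.
rewrite ler_pdivrMr// mulrAC ler_pdivlMr//.
have : 0 <= (expR a - expR b) * (q - p).
  by rewrite mulr_ge0// subr_ge0// ler_expR.
by nra.
Qed.

Lemma ln_Zsub_reset c c' i : (forall j, j != i -> c j = c' j) ->
  log_partition c - log_partition c' =
  log_tilt (c i) (occupation (reset i c) finset.setT i) -
  log_tilt (c' i) (occupation (reset i c) finset.setT i).
Proof.
move=> cc'; rewrite /log_partition.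
have h b : (forall j, j != i -> b j = c j) ->
    ln (Zsub b finset.setT) = ln (Zsub (reset i c) finset.setT) +
    log_tilt (b i) (occupation (reset i c) finset.setT i).
  move=> bc; have := @ln_Zsub_jump R G b (reset i c) finset.setT i (finset.subsetT _).
  rewrite /reset eqxx subr0 => <-; last by move=> j ji; rewrite (negbTE ji) bc.
  by rewrite addrC subrK.
by rewrite (h c)// (h c') => [|j ji]; [ring|rewrite cc'].
Qed.

Section Good.
Variables (K L : R).
Hypotheses (K0 : 0 <= K) (LE : L = D%:R * expR (3 * K)).

(** A lower bound for the occupation probability of an edge of weight 0 whose
    surroundings carry no extreme weight, see [occupation_reset_ge]. *)
Definition influence : R := (expR K * (1 + L)) ^- 2.

Lemma influence01 : 0 <= influence <= 1.
Proof.
have L0 := L_ge0 LE.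
have h : 1 <= expR K * (1 + L).
  have e1 : 1 <= expR K by rewrite -expR0 ler_expR.
  by rewrite -[X in X <= _]mulr1 ler_pM// lerDl.
have h0 : 0 < expR K * (1 + L) by rewrite (lt_le_trans _ h).
rewrite /influence invr_ge0 sqr_ge0 /= invf_le1 ?exprn_gt0//.
by rewrite -[X in X <= _](expr1n _ 2) lerXn2r ?nnegrE// ltW.
Qed.

Lemma influence_gt0 : 0 < influence.
Proof.
have L0 := L_ge0 LE; rewrite invr_gt0 exprn_gt0// mulr_gt0 ?expR_gt0//.
by rewrite ltr_pwDl.
Qed.

Lemma ratio_good_ge c (S : {set G}) x : x \in S -> good c K x ->
  (expR K * (1 + L))^-1 <= Zratio c S [set x]%SET.
Proof.
move=> xS gx; rewrite ratio_vertex//.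
have d0 := dimer_sum_ge0 c S x; have e0 := expR_gt0 (c (inr x)).
rewrite lef_pV2 ?posrE ?ltr_pwDl//; last first.
  by rewrite mulr_gt0 ?expR_gt0// ltr_pwDl// (L_ge0 LE).
have nx : inr x \in near_weights x.
  by rewrite inE; apply/existsP; exists x; rewrite /= inE !eqxx.
have -> : expR (c (inr x)) + dimer_sum c S x = expR (c (inr x)) * (1 + fugacity c S x).
  by rewrite /fugacity mulrDr mulr1 mulrA -expRD subrr expR0 mul1r.
have f0 := fugacity_ge0 c S x.
apply: ler_pM; [exact: expR_ge0|by rewrite addr_ge0| |].
  by rewrite ler_expR (le_trans (ler_norm _))// (goodP gx).
by rewrite lerD2l (fugacity_le LE degD).
Qed.

(** Both end-vertices of e being good, vacating them costs a bounded factor. *)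
Lemma occupation_reset_ge c e :
  (forall u i, u \in val e -> i \in near_weights u -> ~~ extreme c K i) ->
  influence <= occupation (reset (inl e) c) finset.setT (inl e).
Proof.
move=> ne; have gu u : u \in val e -> good (reset (inl e) c) K u.
  move=> ue; apply/forall_inP => i iu; rewrite /extreme /reset.
  case: eqP => _; last exact: ne ue iu.
  by rewrite normr0 -leNgt.
rewrite /occupation /reset eqxx expR0 mul1r -/(reset (inl e) c).
have [x xe] := ends_neq0 (inl e); have [y [xy eE exE]] := edge_set1 xe.
have ye : y \in val e by rewrite eE !inE eqxx orbT.
have yx : y != x by apply: contraTneq xy => ->; rewrite adj_irr.
have -> : Zratio (reset (inl e) c) finset.setT (ends (inl e)) =
    Zratio (reset (inl e) c) finset.setT [set x]%SET *
    Zratio (reset (inl e) c) (finset.setT :\ x)%SET [set y]%SET.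
  rewrite /Zratio -exE setDD1//.
  by field; rewrite !gt_eqF ?Zsub_gt0.
have L0 := L_ge0 LE.
have h0 : 0 <= (expR K * (1 + L))^-1.
  by rewrite invr_ge0 mulr_ge0 ?expR_ge0// addr_ge0.
rewrite /influence -exprVn expr2; apply: ler_pM => //.
  by apply: ratio_good_ge; [rewrite inE|exact: gu].
by apply: ratio_good_ge; [rewrite !inE yx|exact: gu].
Qed.

End Good.
End EdgeInfluence.

Section VarianceLowerBound.
Context {R : realType} {G : sgraph}.
Local Notation I := (edge G + G)%type.
Variable D : nat.
Hypothesis degD : forall x : G, (degree x <= D)%N.
Context {d : measure_display} {T : measurableType d}.
Variable P : probability T R.
Variable X : I + I -> T -> R.
Hypothesis iX : indep P X.
Hypothesis lX : forall i, same_law P (X (inl i)) P (X (inr i)).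
Hypothesis sX : forall b, sqitg P (X b).
Variables (K L pr s2 : R).
Hypotheses (K0 : 0 <= K) (LE : L = D%:R * expR (3 * K)).
Hypothesis pr_small : pr * (2 * (D.+1 * D.+1))%:R <= 2^-1.
Hypothesis pr0 : 0 <= pr.
Hypothesis tailX : forall b, fine (P (X b @^-1` [set x : R | (K < `|x|)%R])) <= pr.

(** The increase of the free energy when the weight of an edge grows from 0 to w
    and its occupation probability at weight 0 is [influence K L]. *)
Definition edge_stat (w : R) : R := log_tilt w (influence K L).

Hypothesis s2E : forall e : edge G,
  \int[P]_t (edge_stat (X (inl (inl e)) t) - edge_stat (X (inr (inl e)) t)) ^+ 2 = s2.

Definition edge_sum (c : @cfg R I) : R := \sum_(e : edge G) edge_stat (c (inl e)).

Let infl01 := influence01 K0 LE.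

Lemma measurable_edge_stat : measurable_fun setT edge_stat.
Proof.
apply: (measurableT_comp (@measurable_ln R)).
apply: measurable_funD; first exact: measurable_cst.
apply: measurable_funM; last exact: measurable_cst.
by apply: measurable_funB; [exact: measurable_expR|exact: measurable_cst].
Qed.

Lemma measurable_edge_sum : measurable_fun setT edge_sum.
Proof.
apply: measurable_bigsum => e.
exact: measurableT_comp measurable_edge_stat (measurable_coord _).
Qed.

Lemma edge_sum_jump k (A : {set I}) t : k \notin A ->
  at_mix X edge_sum A t - at_mix X edge_sum (k |: A)%SET t =
  match k with
  | inl e => edge_stat (X (inl (inl e)) t) - edge_stat (X (inr (inl e)) t)
  | inr _ => 0
  end.
Proof.
move=> kA; rewrite /at_mix /edge_sum; case: k kA => [e|x] kA.
  rewrite (bigD1 e)//= [X in _ - X](bigD1 e)//= {1 3}/mix (negbTE kA) setU11.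
  rewrite opprD addrACA (eq_bigr (fun i => edge_stat (X (mix (inl e |: A)%SET (inl i)) t))).
    by rewrite subrr addr0.
  by move=> f fe; rewrite mix_out//; apply: contra_neq fe => -[].
rewrite (eq_bigr (fun i => edge_stat (X (mix (inr x |: A)%SET (inl i)) t))) ?subrr//.
by move=> f _; rewrite mix_out.
Qed.

Lemma edge_sum_jump0 k t :
  at_mix X edge_sum finset.set0 t - at_mix X edge_sum [set k]%SET t =
  match k with
  | inl e => edge_stat (X (inl (inl e)) t) - edge_stat (X (inr (inl e)) t)
  | inr _ => 0
  end.
Proof.
have kN : k \notin (finset.set0 : {set I}) by rewrite inE.
by have := edge_sum_jump t kN; rewrite finset.setU0.
Qed.

Lemma sqitg_edge_stat b : sqitg P (fun t => edge_stat (X b t)).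
Proof.
apply: (sqitg_le _ _ (sqitg_norm (sX b))) => [|t]; last exact: log_tilt_le.
exact: measurableT_comp measurable_edge_stat (proj1 iX b).
Qed.

Lemma sqitg_edge_sum : sqitg P (at_mix X edge_sum finset.set0).
Proof. by apply: sqitg_sum => e _; exact: sqitg_edge_stat. Qed.

Lemma ex_edge_sum_var :
  \int[P]_t (at_mix X edge_sum finset.set0 t * at_mix X edge_sum finset.set0 t)
  - (\int[P]_t at_mix X edge_sum finset.set0 t) *
    (\int[P]_t at_mix X edge_sum finset.set0 t) = #|edge G|%:R * (2^-1 * s2).
Proof.
have me := measurable_edge_sum; have se := sqitg_edge_sum.
rewrite (ex_cov_resample iX lX me me se se) big_sumType/=.
rewrite [X in _ + X]big1 ?addr0; last first.
  move=> x _; under eq_Rintegral => t _ do rewrite (edge_sum_jump0 (inr x)) mul0r.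
  by rewrite ex_cst mulr0.
rewrite (eq_bigr (fun=> 2^-1 * s2)); first by rewrite sumr_const -[LHS]mulr_natl.
move=> e _; rewrite -(s2E e); congr (_ * _); apply: eq_Rintegral => t _.
rewrite (edge_sum_jump t (notin_before (inl e))) edge_sum_jump0.
by rewrite expr2.
Qed.

Let F := at_mix X (@log_partition R G) finset.set0.

(** Both increments have the sign of the change of the weight of e, and that of
    the free energy is the larger one when e has a substantial influence. *)
Lemma jump_edge_ge (e : edge G) t :
  let c := fun i => X (mix (before (inl e)) i) t in
  (edge_stat (X (inl (inl e)) t) - edge_stat (X (inr (inl e)) t)) ^+ 2 *
    (influence K L <= occupation (reset (inl e) c) finset.setT (inl e))%R%:R <=
  (edge_stat (X (inl (inl e)) t) - edge_stat (X (inr (inl e)) t)) *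
  jump X (@log_partition R G) (inl e) (before (inl e)) t.
Proof.
set c := fun i => _; cbv zeta.
rewrite /jump /at_mix (@ln_Zsub_reset _ _ c _ (inl e)); last first.
  by move=> j je; rewrite /c mix_out.
have e1 : c (inl e) = X (inl (inl e)) t.
  by rewrite /c /mix (negbTE (notin_before _)).
have e2 : X (mix (inl e |: before (inl e))%SET (inl e)) t = X (inr (inl e)) t.
  by rewrite /mix setU11.
rewrite e1 e2.
set w := X _ t; set w' := X _ t; set q := occupation _ _ _.
have q01 : 0 <= q <= 1 by rewrite ltW ?occupation_gt0 ?occupation_le1 ?finset.subsetT.
case: (leP (influence K L) q) => iq.
  rewrite mulr1 expr2; case: (leP w' w) => ww'.
    have h := log_tilt_increment infl01 q01 iq ww'.
    have m := log_tilt_mono infl01 ww'.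
    by rewrite ler_wpM2l// subr_ge0.
  have h := log_tilt_increment infl01 q01 iq (ltW ww').
  have m := log_tilt_mono infl01 (ltW ww').
  by rewrite ler_wnM2l ?subr_le0//; rewrite /edge_stat; lra.
rewrite mulr0; case: (leP w' w) => ww'.
  by rewrite mulr_ge0// subr_ge0 log_tilt_mono.
by rewrite mulr_le0// subr_le0 log_tilt_mono// ltW.
Qed.

Let good_edge (e : edge G) (b : I + I -> R) : R :=
  (influence K L <= occupation
     (reset (inl e) (fun i => b (mix (before (inl e)) i))) finset.setT (inl e))%R%:R.

Let measurable_good_edge e : measurable_fun setT (good_edge e : @cfg R (I + I)%type -> R).
Proof.
pose h (b : @cfg R (I + I)%type) := occupation
  (reset (inl e) (fun i => b (mix (before (inl e)) i))) finset.setT (inl e).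
have mh : measurable_fun setT h.
  apply: measurableT_comp (measurable_occupation _ _) (measurable_cfg _) => j.
  rewrite /reset; case: eqP => _; [exact: measurable_cst|exact: measurable_coord].
rewrite (_ : good_edge e = \1_(h @^-1` `[influence K L, +oo[)).
  by apply: measurable_indic; rewrite -[X in measurable X]setTI; exact: mh.
apply/funext => b; rewrite indicE; congr (nat_of_bool _)%:R.
by apply/idP/idP; rewrite inE /= in_itv /= andbT.
Qed.

Let itg_good_edge e : itg P (fun t => good_edge e (X^~ t)).
Proof.
apply: (@itg_bounded _ _ _ _ _ 1) => [|t].
  exact: measurableT_comp (measurable_good_edge e) (measurable_cfg (proj1 iX)).
exact: norm_bool_le1.
Qed.

(** A union bound over the weights near the two ends of e. *)
Lemma ex_good_edge_ge (e : edge G) : 2^-1 <= \int[P]_t good_edge e (X^~ t).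
Proof.
pose A := before (inl e : I).
have extremeE i : (fun t => (extreme (fun i => X (mix A i) t) K i)%:R) =
    \1_(X (mix A i) @^-1` [set x : R | (K < `|x|)%R]) :> (T -> R).
  apply/funext => t; rewrite indicE; congr (nat_of_bool _)%:R.
  by apply/idP/idP; rewrite inE.
have mex i : measurable (X (mix A i) @^-1` [set x : R | (K < `|x|)%R]).
  by rewrite -[X in measurable X]setTI; apply: (proj1 iX) => //; exact: measurable_extreme.
have iex i : itg P (fun t => (extreme (fun i => X (mix A i) t) K i)%:R).
  by rewrite extremeE; exact: itg_indic.
pose S t : R := \sum_(u in val e) \sum_(i in near_weights u)
  (extreme (fun i => X (mix A i) t) K i)%:R.
have iS : itg P S by apply: itg_sum => u _; apply: itg_sum => i _; exact: iex.
apply: (@le_trans _ _ (\int[P]_t (1 - S t))).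
  rewrite exB//; last exact: itg_cst.
  rewrite ex_cst.
  suff : \int[P]_t S t <= 2^-1 by lra.
  rewrite /S ex_sum => [|u _]; last by apply: itg_sum => i _; exact: iex.
  apply: le_trans pr_small.
  apply: (@le_trans _ _ (\sum_(u in val e) ((D.+1 * D.+1)%:R * pr))).
    apply: ler_sum => u _; rewrite ex_sum//.
    apply: (@le_trans _ _ (\sum_(i in near_weights u) pr)).
      by apply: ler_sum => i _; rewrite extremeE ex_indic.
    by rewrite sumr_const -[leLHS]mulr_natl ler_wpM2r// ler_nat card_near_weights.
  have -> : pr * (2 * (D.+1 * D.+1))%:R = 2 * ((D.+1 * D.+1)%:R * pr).
    by rewrite (natrM _ 2); ring.
  rewrite sumr_const -[leLHS]mulr_natl ler_wpM2r ?mulr_ge0// ler_nat.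
  exact: card_ends (inl e : I).
apply: ex_le => [||t]; [by apply: itgB => //; exact: itg_cst|exact: itg_good_edge|].
rewrite /good_edge; have S0 : 0 <= S t by do 2 (apply: sumr_ge0 => ? _); rewrite ler0n.
case: (leP (influence K L) _) => h; first by rewrite gerBl.
rewrite subr_le0.
move: h; rewrite ltNge => /negP h.
have [u [i [ue iu ei]]] : exists u i, [/\ u \in val e, i \in near_weights u &
    extreme (fun i => X (mix A i) t) K i].
  apply: contrapT => hN; apply: h; apply: occupation_reset_ge => // u i ue iu.
  by apply/negP => ei; apply: hN; exists u, i.
rewrite /S (bigD1 u)//= (bigD1 i)//= ei -addrA lerDl addr_ge0//.
  by apply: sumr_ge0 => ? _; rewrite ler0n.
by do 2 (apply: sumr_ge0 => ? _); rewrite ler0n.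
Qed.

(** The two copies of the weight of e are independent of the event that e has
    a substantial influence. *)
Lemma ex_edge_cov_ge (e : edge G) : 2^-1 * s2 <=
  \int[P]_t ((edge_stat (X (inl (inl e)) t) - edge_stat (X (inr (inl e)) t)) *
    jump X (@log_partition R G) (inl e) (before (inl e)) t).
Proof.
pose Phi (b : @cfg R (I + I)%type) :=
  (edge_stat (b (inl (inl e))) - edge_stat (b (inr (inl e)))) ^+ 2.
have mPhi : measurable_fun setT Phi.
  apply: measurable_funX; apply: measurable_funB;
    exact: measurableT_comp measurable_edge_stat (measurable_coord _).
have sd : sqitg P (fun t => edge_stat (X (inl (inl e)) t) - edge_stat (X (inr (inl e)) t)).
  by apply: sqitgB; exact: sqitg_edge_stat.
have iPhi : itg P (fun t => Phi (X^~ t)) by case: sd.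
have prodE : \int[P]_t (Phi (X^~ t) * good_edge e (X^~ t)) =
    (\int[P]_t Phi (X^~ t)) * (\int[P]_t good_edge e (X^~ t)).
  apply: (@indep_exM _ _ _ P _ X
    [set b | (b == inl (inl e)) || (b == inr (inl e))]%SET
    [set b | ~~ ((b == inl (inl e)) || (b == inr (inl e)))]%SET) => //.
  - by move=> c c' h; rewrite /Phi !h// inE eqxx ?orbT.
  - move=> c c' h; rewrite /good_edge.
    suff -> : reset (inl e) (fun i => c (mix (before (inl e)) i)) =
              reset (inl e) (fun i => c' (mix (before (inl e)) i)) by [].
    apply/funext => j; rewrite /reset; case: eqP => // /eqP je; apply: h.
    rewrite inE /mix; case: ifP => _; rewrite negb_or;
    by apply/andP; split => //; apply: contra_neq je => -[].
  - by move=> j; rewrite !inE negbK.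
have s20 : 0 <= s2 by rewrite -(s2E e); apply: ex_ge0 => t; exact: sqr_ge0.
apply: (@le_trans _ _ (\int[P]_t (Phi (X^~ t) * good_edge e (X^~ t)))).
  rewrite prodE (s2E e) mulrC ler_wpM2l//; exact: ex_good_edge_ge.
have sJ : sqitg P (jump X (@log_partition R G) (inl e) (before (inl e))).
  apply: sqitg_jump => //; [exact: measurable_log_partition|exact: log_partition_lipschitz].
apply: ex_le => [||t].
- apply: (itg_le _ _ iPhi) => [|t].
    apply: measurable_funM; first exact: itg_meas iPhi.
    exact: itg_meas (itg_good_edge e).
  rewrite normrM ger0_norm ?sqr_ge0// ler_piMr ?sqr_ge0//.
  exact: norm_bool_le1.
- exact: sqitgM.
- exact: jump_edge_ge.
Qed.

Lemma ex_centered_prod (f g : T -> R) : sqitg P f -> sqitg P g ->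
  \int[P]_t ((f t - \int[P]_t f t) * (g t - \int[P]_t g t)) =
  \int[P]_t (f t * g t) - (\int[P]_t f t) * (\int[P]_t g t).
Proof.
move=> hf hg; set a := \int[P]_t f t; set b := \int[P]_t g t.
have if1 := sqitg_itg hf; have ig1 := sqitg_itg hg; have ifg := sqitgM hf hg.
rewrite (_ : (fun t => _) = (fun t => (f t * g t - (b * f t)) - (a * g t - a * b))).
  have i1 := itgZ b if1; have i2 := itgZ a ig1; have i3 := itg_cst P (a * b).
  rewrite (exB (itgB ifg i1) (itgB i2 i3)) (exB ifg i1) (exB i2 i3).
  by rewrite (exZ _ if1) (exZ _ ig1) ex_cst -/a -/b; ring.
by apply/funext => t; ring.
Qed.

(** The Cauchy-Schwarz inequality against the sum of the edge statistics: its
    variance and its covariance with F are of the order of the number of edges. *)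
Lemma variance_ge : 0 < s2 ->
  #|edge G|%:R * (s2 / 8) <= \int[P]_t F t ^+ 2 - (\int[P]_t F t) ^+ 2.
Proof.
move=> s20; set v := _ - _.
have mf := @measurable_log_partition R G.
have sF : sqitg P F.
  apply: sqitg_at_set0 => //; exact: log_partition_lipschitz.
have sg := sqitg_edge_sum; set g := at_mix X edge_sum finset.set0 in sg.
pose Fc t := F t - \int[P]_t F t; pose gc t := g t - \int[P]_t g t.
have sFc : sqitg P Fc by apply: sqitgB => //; exact: sqitg_cst.
have sgc : sqitg P gc by apply: sqitgB => //; exact: sqitg_cst.
have vE : \int[P]_t Fc t ^+ 2 = v.
  rewrite /v expr2 -ex_centered_prod//.
have gE : \int[P]_t gc t ^+ 2 = #|edge G|%:R * (2^-1 * s2).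
  by rewrite -ex_edge_sum_var -ex_centered_prod.
have cE : #|edge G|%:R * (4^-1 * s2) <= \int[P]_t (gc t * Fc t).
  rewrite ex_centered_prod// (ex_cov_resample iX lX mf measurable_edge_sum sF sg).
  rewrite big_sumType/= [X in _ <= _ + X]big1 ?addr0; last first.
    move=> x _; under eq_Rintegral => t _ do rewrite (edge_sum_jump0 (inr x)) mul0r.
    by rewrite ex_cst mulr0.
  rewrite [leLHS](_ : _ = \sum_(e : edge G) 4^-1 * s2); last first.
    by rewrite sumr_const -[RHS]mulr_natl.
  apply: ler_sum => e _.
  under eq_Rintegral => t _ do rewrite (edge_sum_jump0 (inl e)).
  by have := ex_edge_cov_ge e; rewrite /jump; lra.
have v0 : 0 <= v by rewrite -vE; apply: ex_ge0 => t; exact: sqr_ge0.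
have [->|n0] := eqVneq #|edge G| 0%N; first by rewrite mul0r.
have n_gt0 : 0 < #|edge G|%:R :> R by rewrite ltr0n lt0n.
have := ex_cauchy_schwarz sgc sFc; rewrite vE gE.
set Cv := \int[P]_t _ in cE *; set n : R := #|edge G|%:R in n_gt0 cE *.
move=> cs.
have ns : 0 < n * (2^-1 * s2) by rewrite !mulr_gt0.
rewrite -(ler_pM2l ns); apply: le_trans cs.
have -> : n * (2^-1 * s2) * (n * (s2 / 8)) = (n * (4^-1 * s2)) ^+ 2 by field.
by rewrite lerXn2r ?nnegrE ?(le_trans _ cE)// mulr_ge0 ?mulr_ge0// ltW.
Qed.

End VarianceLowerBound.

(** * Moments and tails of the weight distributions *)

Section Laws.
Context {R : realType}.
Implicit Types (Q : probability (measurableTypeR R) R).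

Section Transfer.
Context d1 (T1 : measurableType d1) (P1 : probability T1 R) (X : T1 -> R).
Context d2 (T2 : measurableType d2) (P2 : probability T2 R) (Y : T2 -> R).
Hypotheses (mX : measurable_fun setT X) (mY : measurable_fun setT Y).
Hypothesis XY : same_law P1 X P2 Y.

Let indep1 d (T : measurableType d) (P : probability T R) (Z : T -> R) :
  measurable_fun setT Z -> indep P (fun (_ : unit) => Z).
Proof.
move=> mZ; split=> // A mA; rewrite (bigD1 tt)//= big1 ?mule1; last by case.
by congr (P _); apply/seteqP; split=> t /= => [|h []//]; apply.
Qed.

Lemma same_law_ex (phi : R -> R) : measurable_fun setT phi ->
  \int[P1]_t phi (X t) = \int[P2]_t phi (Y t).
Proof.
move=> mphi.
have := @indep_ex R unit _ _ _ _ P1 P2 _ _ (indep1 P1 mX) (indep1 P2 mY) (fun _ => XY)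
  (fun c => phi (c tt)); apply.
exact: measurableT_comp mphi (measurable_coord _).
Qed.

Lemma same_law_itg (phi : R -> R) : measurable_fun setT phi ->
  itg P1 (fun t => phi (X t)) -> itg P2 (fun t => phi (Y t)).
Proof.
move=> mphi.
have := @indep_itg R unit _ _ _ _ P1 P2 _ _ (indep1 P1 mX) (indep1 P2 mY) (fun _ => XY)
  (fun c => phi (c tt)); apply.
exact: measurableT_comp mphi (measurable_coord _).
Qed.

End Transfer.

Definition tail_sq (K x : R) : R := x ^+ 2 * (K < `|x|)%R%:R.

Lemma measurable_tail_sq K : measurable_fun setT (tail_sq K).
Proof.
apply: measurable_funM; first exact: measurable_funX.
rewrite (_ : (fun x : R => _) = \1_[set x : R | (K < `|x|)%R]).
  by apply: measurable_indic; exact: measurable_extreme.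
by apply/funext => x; rewrite indicE; congr (nat_of_bool _)%:R; apply/idP/idP; rewrite inE.
Qed.

Lemma tail_sq_ge0 K x : 0 <= tail_sq K x.
Proof. by rewrite mulr_ge0 ?sqr_ge0// ler0n. Qed.

Section Moments.
Variables (Q : probability (measurableTypeR R) R) (eps : R).
Hypothesis eps0 : 0 < eps.
Let mom (x : R) : R := `|x| `^ (2 + eps).
Hypothesis imom : itg Q mom.

Lemma powR_split (x : R) : mom x = x ^+ 2 * `|x| `^ eps.
Proof.
rewrite /mom; have [->|x0] := eqVneq x 0.
  by rewrite normr0 powR0 ?expr0n ?mul0r// gt_eqF// addr_gt0.
rewrite powRD; last by rewrite normr_eq0 x0 implybT.
by rewrite powR_mulrn// real_normK ?num_real.
Qed.

Lemma moment_sqitg : sqitg Q (fun x => x).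
Proof.
split; first exact: measurable_id.
apply: (itg_le _ _ (itgD (itg_cst Q 1) imom)) => [|x].
  exact: measurable_funX.
rewrite ger0_norm ?sqr_ge0// powR_split.
case: (leP 1 `|x|) => x1.
  rewrite -[leLHS]mulr1 -[leLHS]add0r lerD// ler_wpM2l ?sqr_ge0//.
  by rewrite -[leLHS](powRr0 `|x|) ler_powR// ltW.
have p0 : 0 <= x ^+ 2 * `|x| `^ eps by apply: mulr_ge0; [exact: sqr_ge0|exact: powR_ge0].
rewrite -[leLHS]addr0 lerD//.
by rewrite -(real_normK (num_real x)) -[leRHS](expr1n _ 2) lerXn2r ?nnegrE// ltW.
Qed.

(** Above K, [x ^+ 2] is at most [K `^ (- eps) * `|x| `^ (2 + eps)]. *)
Lemma moment_tail (eta : R) : 0 < eta -> exists2 K0 : R, 1 <= K0 &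
  forall K, K0 <= K -> \int[Q]_x tail_sq K x <= eta /\
    fine (Q [set x : R | (K < `|x|)%R]) <= eta.
Proof.
move=> eta0; set M := \int[Q]_x mom x.
have M0 : 0 <= M by apply: ex_ge0 => x; exact: powR_ge0.
pose z := (M + 1) / eta; have z0 : 0 < z by rewrite divr_gt0// ltr_wpDl.
exists (1 + z `^ eps^-1); first by rewrite lerDl powR_ge0.
move=> K KK; have K1 : 1 <= K by rewrite (le_trans _ KK)// lerDl powR_ge0.
have Kz : z <= K `^ eps.
  have -> : z = (z `^ eps^-1) `^ eps.
    by rewrite -powRrM mulVf ?gt_eqF// powRr1// ltW.
  rewrite ge0_ler_powR ?nnegrE ?powR_ge0//; [exact: ltW|by rewrite (le_trans ler01)|].
  by rewrite (le_trans _ KK)// lerDr.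
have Ke0 : 0 < K `^ eps by rewrite (lt_le_trans z0).
have [mid _] := moment_sqitg.
have it : itg Q (tail_sq K).
  apply: (itg_le _ _ (proj2 moment_sqitg)) => [|x]; first exact: measurable_tail_sq.
  rewrite ger0_norm ?tail_sq_ge0// ler_piMr ?sqr_ge0//.
  by case: (_ < _)%R.
have t1 : \int[Q]_x tail_sq K x <= eta.
  apply: (@le_trans _ _ (\int[Q]_x ((K `^ eps)^-1 * mom x))).
    apply: ex_le => [||x]; [by []|exact: itgZ|].
    rewrite /tail_sq; case: (ltP K `|x|) => Kx; last first.
      by rewrite mulr0 mulr_ge0 ?powR_ge0// invr_ge0 ltW.
    rewrite mulr1 powR_split mulrCA -[leLHS]mulr1 ler_wpM2l ?sqr_ge0//.
    rewrite mulrC ler_pdivlMr// mul1r ge0_ler_powR ?nnegrE//; [exact: ltW| |exact: ltW].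
    by rewrite (le_trans ler01).
  rewrite exZ// mulrC ler_pdivrMr//.
  apply: (@le_trans _ _ (eta * z)); last by rewrite ler_pM2l.
  by rewrite /z mulrCA divff ?gt_eqF// mulr1 lerDl.
split => //; have mE := @measurable_extreme R K.
rewrite -ex_indic//; apply: le_trans t1; apply: ex_le => [||x].
- exact: itg_indic.
- by [].
rewrite indicE /tail_sq (_ : (x \in _) = (K < `|x|)%R); last first.
  by apply/idP/idP; rewrite inE.
case: (ltP K `|x|) => Kx; last by rewrite mulr0.
rewrite mulr1 -(real_normK (num_real x)) -[leLHS](expr1n _ 2) lerXn2r ?nnegrE//.
by rewrite (le_trans K1)// ltW.
Qed.

End Moments.

Lemma moment_itg Q (eps : R) : 0 < eps ->
  ('E_Q[fun x : R => (`|x| `^ (2 + eps))%R] < +oo)%E ->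
  itg Q (fun x : R => `|x| `^ (2 + eps)).
Proof.
move=> eps0; rewrite unlock => h; apply/integrableP; split.
  have mn : measurable_fun setT (fun x : R => `|x|) by exact: measurableT_comp.
  have mp : measurable_fun setT (fun x : R => `|x| `^ (2 + eps)).
    apply: (@measurableT_comp _ _ _ _ _ _ (@powR R ^~ (2 + eps))) mn.
    exact: measurable_powR.
  exact/measurable_EFinP.
by under eq_integral => x _ do rewrite /= ger0_norm ?powR_ge0//.
Qed.

(** If the variance vanished, u would be almost surely constant, hence Q would
    be concentrated on the single point of its fibre. *)
Lemma injective_var_gt0 Q (u : R -> R) : ~ point_mass Q ->
  injective u -> sqitg Q u ->
  0 < \int[Q]_x u x ^+ 2 - (\int[Q]_x u x) ^+ 2.
Proof.
move=> nd uI su; set m := \int[Q]_x u x.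
have [mu iu2] := su; have iu := sqitg_itg su.
have sc : sqitg Q (fun x => u x - m) by apply: sqitgB => //; exact: sqitg_cst.
have e : \int[Q]_x (u x - m) ^+ 2 = \int[Q]_x u x ^+ 2 - m ^+ 2.
  rewrite (_ : (fun x => _) = (fun x => u x ^+ 2 - (2 * m * u x - m ^+ 2))).
    rewrite exB//; last by apply: itgB; [exact: itgZ|exact: itg_cst].
    rewrite exB; [|exact: itgZ|exact: itg_cst].
    by rewrite exZ// ex_cst -/m; ring.
  by apply/funext => x; ring.
rewrite -e lt_neqAle ex_ge0 ?andbT => [|x]; last exact: sqr_ge0.
apply/eqP => /esym h0; apply: nd.
have mE : measurable (u @^-1` [set m]).
  by rewrite -[X in measurable X]setTI; exact: mu.
have QE : Q (u @^-1` [set m]) = 1%E.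
  have [msc isc] := sc.
  have f0 : (\int[Q]_x `|((u x - m) ^+ 2)%:E| = 0)%E.
    transitivity (\int[Q]_x ((u x - m) ^+ 2)%:E)%E.
      by apply: eq_integral => x _ /=; rewrite ger0_norm ?sqr_ge0.
    rewrite -[LHS]fineK; last exact: integrable_fin_num isc.
    by congr EFin.
  have mf : measurable_fun setT (fun x => ((u x - m) ^+ 2)%:E).
    by apply/measurable_EFinP; exact: measurable_funX.
  have /(ae_eq_integral_abs Q measurableT mf) [N [mN QN0 hN]] := f0.
  have Q0 : Q (~` (u @^-1` [set m])) = 0%E.
    apply: (subset_measure0 _ _ _ QN0) => //; first exact: measurableC.
    move=> x /= ux; apply: hN => /= /(_ I) [] /eqP.
    by rewrite sqrf_eq0 subr_eq0 => /eqP.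
  by rewrite -[X in Q X]setCK (probability_setC Q (measurableC mE)) Q0 sube0.
have [c uc] : exists c, u c = m.
  apply: contrapT => hN; move: QE.
  rewrite (_ : u @^-1` [set m] = set0) ?measure0; last first.
    by apply/seteqP; split=> // x /= ux; apply: hN; exists x.
  by move/eqP; rewrite eq_sym onee_eq0.
have EE : u @^-1` [set m] = [set c].
  by apply/seteqP; split=> x /=; [rewrite -uc => /uI|move=> ->].
exists c => A mA; rewrite diracE; case: (boolP (c \in A)); rewrite ?inE => cA.
  apply/eqP; rewrite eq_le probability_le1//= -QE EE le_measure ?inE//.
    by move=> x /= ->.
have : Q (~` A) = 1%E.
  apply/eqP; rewrite eq_le; apply/andP; split.
    by apply: probability_le1; exact: measurableC.
  rewrite -QE EE; apply: le_measure; rewrite ?inE.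
  - by rewrite -EE.
  - exact: measurableC.
  - by move=> x /= -> Ac; move/negP : cA; apply; rewrite inE.
move=> QA; rewrite -[X in Q X]setCK (probability_setC Q (measurableC mA)).
by rewrite QA subee.
Qed.

End Laws.

(** * The central limit theorem *)

Section WeightModel.
Context {R : realType}.
Variables (law_w law_nu : probability (measurableTypeR R) R) (eps : R) (D : nat).
Hypothesis eps0 : 0 < eps.
Hypothesis mom_w : itg law_w (fun x : R => `|x| `^ (2 + eps)).
Hypothesis mom_nu : itg law_nu (fun x : R => `|x| `^ (2 + eps)).

Definition law_of (G : sgraph) (i : edge G + G) : probability (measurableTypeR R) R :=
  match i with inl _ => law_w | inr _ => law_nu end.

Definition weight_pair (G : sgraph) d (T : measurableType d) (P : probability T R)
    (X : (edge G + G) + (edge G + G) -> T -> R) :=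
  indep P X /\ forall b, same_law P (X b) (law_of (copy_of b)) (fun x => x).

Let mom_of (G : sgraph) (i : edge G + G) :
  itg (law_of i) (fun x : R => `|x| `^ (2 + eps)).
Proof. by case: i. Qed.

Lemma laws_tail (eta : R) : 0 < eta -> exists2 K0 : R, 1 <= K0 &
  forall K, K0 <= K -> forall (G : sgraph) (i : edge G + G),
    \int[law_of i]_x tail_sq K x <= eta /\
    fine (law_of i [set x : R | (K < `|x|)%R]) <= eta.
Proof.
move=> eta0; have [K1 K11 h1] := moment_tail eps0 mom_w eta0.
have [K2 K21 h2] := moment_tail eps0 mom_nu eta0.
exists (K1 + K2) => [|K KK G [e|x]]; first by lra.
  by apply: h1; lra.
by apply: h2; lra.
Qed.

Section Pair.
Context {G : sgraph} {d : measure_display} {T : measurableType d}.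
Variables (P : probability T R) (X : (edge G + G) + (edge G + G) -> T -> R).
Hypothesis hX : weight_pair P X.
Local Notation I := (edge G + G)%type.

Let mX b : measurable_fun setT (X b) := proj1 (proj1 hX) b.

Lemma pair_ex (phi : R -> R) b : measurable_fun setT phi ->
  \int[P]_t phi (X b t) = \int[law_of (copy_of b)]_x phi x.
Proof. by move=> mphi; apply: same_law_ex => //; exact: (proj2 hX). Qed.

Lemma pair_itg (phi : R -> R) b : measurable_fun setT phi ->
  itg (law_of (copy_of b)) phi -> itg P (fun t => phi (X b t)).
Proof.
move=> mphi iphi.
have h : same_law (law_of (copy_of b)) (fun x : R => x) P (X b).
  by move=> A mA; rewrite (proj2 hX b A mA).
have mid : measurable_fun setT ((fun x => x) : measurableTypeR R -> R).
  exact: measurable_id.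
exact: (same_law_itg mid (mX b) h mphi iphi).
Qed.

Lemma pair_sqitg b : sqitg P (X b).
Proof.
split=> //; apply: (pair_itg (phi := fun x => x ^+ 2)).
  exact: measurable_funX.
exact: (proj2 (moment_sqitg eps0 (mom_of (copy_of b)))).
Qed.

Lemma pair_same i : same_law P (X (inl i)) P (X (inr i)).
Proof. by move=> A mA; rewrite (proj2 hX (inl i) A mA) (proj2 hX (inr i) A mA). Qed.

Lemma pair_tail (K pr : R) b :
  fine (law_of (copy_of b) [set x : R | (K < `|x|)%R]) <= pr ->
  fine (P (X b @^-1` [set x : R | (K < `|x|)%R])) <= pr.
Proof. by rewrite (proj2 hX b _ (measurable_extreme K)). Qed.

Lemma amplitude_tail (K eta : R) k : 0 <= K ->
  \int[law_of k]_x tail_sq (K / 2) x <= eta ->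
  \int[P]_t (amplitude X k t ^+ 2 * (K < amplitude X k t)%R%:R) <= 8 * eta.
Proof.
move=> K0 hK.
have it b : itg P (fun t => tail_sq (K / 2) (X b t)).
  apply: (itg_le _ _ (proj2 (pair_sqitg b))) => [|t].
    exact: measurableT_comp (measurable_tail_sq _) (mX b).
  rewrite ger0_norm ?tail_sq_ge0// ler_piMr ?sqr_ge0//.
  by case: (_ < _)%R.
apply: (@le_trans _ _ (\int[P]_t (4 * tail_sq (K / 2) (X (inl k) t) +
    4 * tail_sq (K / 2) (X (inr k) t)))); last first.
  rewrite exD; [|exact: itgZ..]; rewrite !exZ//.
  rewrite (pair_ex (inl k) (measurable_tail_sq _)) (pair_ex (inr k) (measurable_tail_sq _)).
  by rewrite /=; lra.
apply: ex_le => [||t].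
- exact: (itg_amplitude_tail pair_sqitg).
- by apply: itgD; exact: itgZ.
rewrite /amplitude /tail_sq -(real_normK (num_real (X (inl k) t))).
rewrite -(real_normK (num_real (X (inr k) t))).
have := normr_ge0 (X (inl k) t); have := normr_ge0 (X (inr k) t).
move: (`|X (inl k) t|) (`|X (inr k) t|) => x y y0 x0.
case: (ltP K (x + y)) => Kxy; last first.
  by rewrite mulr0 addr_ge0// mulr_ge0// mulr_ge0 ?sqr_ge0// ler0n.
rewrite mulr1; case: (leP x y) => xy.
  have -> : (K / 2 < y)%R by lra.
  have : 0 <= 4 * (x ^+ 2 * (K / 2 < x)%R%:R).
    by rewrite mulr_ge0// mulr_ge0 ?sqr_ge0// ler0n.
  move: (_ * _) => z z0; rewrite mulr1.
  have := ler_pM (addr_ge0 x0 y0) (addr_ge0 x0 y0) (lerD xy (lexx y)) (lerD xy (lexx y)).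
  by move=> h; nra.
have -> : (K / 2 < x)%R by lra.
have : 0 <= 4 * (y ^+ 2 * (K / 2 < y)%R%:R).
  by rewrite mulr_ge0// mulr_ge0 ?sqr_ge0// ler0n.
move: (4 * (y ^+ 2 * _)) => z z0; rewrite mulr1.
have yx := ltW xy.
have := ler_pM (addr_ge0 x0 y0) (addr_ge0 x0 y0) (lerD (lexx x) yx) (lerD (lexx x) yx).
by move=> h; nra.
Qed.

Definition second_moments : R :=
  \int[law_w]_x x ^+ 2 + \int[law_nu]_x x ^+ 2.

Lemma second_moment_le (k : I) : \int[law_of k]_x x ^+ 2 <= second_moments.
Proof.
rewrite /second_moments; case: k => [e|x] /=.
  by rewrite lerDl; apply: ex_ge0 => x; exact: sqr_ge0.
by rewrite lerDr; apply: ex_ge0 => z; exact: sqr_ge0.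
Qed.

Lemma amplitude_second (k : I) : \int[P]_t amplitude X k t ^+ 2 <= 4 * second_moments.
Proof.
have i2 b := proj2 (pair_sqitg b).
have m2 : measurable_fun setT (fun x : R => x ^+ 2) by exact: measurable_funX.
apply: (@le_trans _ _ (\int[P]_t (2 * X (inl k) t ^+ 2 + 2 * X (inr k) t ^+ 2))).
  apply: ex_le => [||t].
  - exact: (proj2 (sqitg_amplitude pair_sqitg k)).
  - by apply: itgD; exact: itgZ.
  rewrite /amplitude -(real_normK (num_real (X (inl k) t))).
  rewrite -(real_normK (num_real (X (inr k) t))).
  by have := sqr_ge0 (`|X (inl k) t| - `|X (inr k) t|); lra.
rewrite exD; [|exact: itgZ..]; rewrite !exZ//.
rewrite (pair_ex (inl k) m2) (pair_ex (inr k) m2) /=.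
by have := second_moment_le k; lra.
Qed.

End Pair.

Definition variance_of (G : sgraph) d (T : measurableType d) (P : probability T R)
    (X : (edge G + G) + (edge G + G) -> T -> R) : R :=
  \int[P]_t at_mix X (@log_partition R G) finset.set0 t ^+ 2 -
  (\int[P]_t at_mix X (@log_partition R G) finset.set0 t) ^+ 2.

(** All the error terms of the normal approximation are negligible for large
    graphs, uniformly over the graphs of bounded degree whose free energy has
    a variance of linear order. *)
Lemma stein_negligible (c C e : R) : 0 < c -> 0 <= C -> 0 < e ->
  exists n0 : nat, forall (G : sgraph) d (T : measurableType d)
    (P : probability T R) (X : (edge G + G) + (edge G + G) -> T -> R),
  (forall x : G, (degree x <= D)%N) -> weight_pair P X ->
  (n0 <= #|{: edge G + G}|)%N ->
  c * #|{: edge G + G}|%:R <= variance_of P X ->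
  forall (g g' : R -> R), continuous g -> continuous g' ->
  (forall x, `|g x| <= C) -> (forall x, `|g' x| <= C) ->
  (forall x y, `|g x - g y| <= C * `|x - y|) ->
  (forall x y, `|g x - g y - g' x * (x - y)| <= C * (x - y) ^+ 2) ->
  `|\int[P]_t (g' (standardized P X (@log_partition R G) t) -
     standardized P X (@log_partition R G) t *
     g (standardized P X (@log_partition R G) t))| <= e.
Proof.
move=> c0 C0 e0.
(* Half of e is spent on the terms of order eta, half on those of order
   n ^ (-1/2), where n is the number of weights. *)
pose eta := e * c / (8 * (C + 1)).
have eta0 : 0 < eta by rewrite divr_gt0 ?mulr_gt0// ltr_wpDl.
have [K1 K11 hK1] := laws_tail (eta := eta / 16) ltac:(by rewrite divr_gt0).
pose K' := 2 * K1; have K'0 : 0 <= K' by rewrite /K'; lra.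
have [p0 p00 hp0] := @decay_rate R D.
have [K2 K21 hK2] := laws_tail p00.
pose occ_eps := eta / (4 * (K' * expR (2 * K') + 1)).
have B0 : 0 <= K' * expR (2 * K') by rewrite mulr_ge0 ?expR_ge0.
have occ_eps0 : 0 < occ_eps by rewrite divr_gt0// mulr_gt0// ltr_wpDl.
have [k [t [q [kE hk]]]] := hp0 K2 _ _ erefl occ_eps0.
pose B := (D.+1 ^ k.+1 * (D.+1 ^ k.+1 * D.+1))%N.
pose M := 4 * second_moments.
have M0 : 0 <= M.
  by rewrite /M /second_moments mulr_ge0// addr_ge0// ex_ge0// => x; exact: sqr_ge0.
pose Z := C * (2 * K' ^+ 2 * Num.sqrt B%:R / c + K' * M / (c * Num.sqrt c)).
have sc0 : 0 < Num.sqrt c by rewrite sqrtr_gt0.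
have Z0 : 0 <= Z.
  apply: mulr_ge0 => //; apply: addr_ge0; apply: divr_ge0.
  - apply: mulr_ge0; last exact: sqrtr_ge0.
    by apply: mulr_ge0 => //; exact: sqr_ge0.
  - exact: ltW.
  - exact: mulr_ge0.
  - by apply: mulr_ge0; exact: ltW.
pose n0 := (Num.truncn ((2 * Z / e) ^+ 2)).+1.
exists n0 => G d T P X degD hX nn0 vc g g' cg cg' gC g'C gL g2.
set n := #|{: edge G + G}| in nn0 vc.
have n_gt0 : (0 < n)%N by exact: leq_trans nn0.
have nR : 0 < n%:R :> R by rewrite ltr0n.
have sX := pair_sqitg hX; have lX := pair_same hX; have [iX _] := hX.
set v := variance_of P X in vc.
have cn0 : 0 < c * n%:R by rewrite mulr_gt0.
have v0 : 0 < v by exact: lt_le_trans vc.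
have occ_close (A : {set edge G + G}) kk :
    \int[P]_s `|occupation (fun i => X (mix A i) s) finset.setT kk -
       occupation (fun i => X (mix A i) s) (nb k.+1 (center kk)) kk| <= occ_eps.
  have p0' : 0 <= p0 by exact: ltW.
  have p01 : 0 <= p0 <= p0 by rewrite p0' lexx.
  apply: le_trans (hk p0 p01).
  apply: (@ex_occupation_close R G D degD _ _ P _ K2 p0 (indep_inj (@mix_inj _ A) iX) p0') => //.
  move=> i; apply: (pair_tail hX).
  by have [] := hK2 K2 (lexx _) G (copy_of (mix A i)).
have amp_tail kk : \int[P]_s (amplitude X kk s ^+ 2 * (K' < amplitude X kk s)%R%:R)
    <= eta / 2.
  apply: (le_trans (amplitude_tail hX (eta := eta / 16) K'0 _)); last by lra.
  have -> : K' / 2 = K1 by rewrite /K'; field.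
  by have [] := hK1 K1 (lexx _) G kk.
have u_close kk : \int[P]_s `|exchange_term X (@log_partition R G) kk s -
    local_term K' k kk (X^~ s)| <= eta.
  apply: (le_trans (local_term_close iX lX sX K'0 (r := k) (fun A kk => occ_close A kk) amp_tail kk)).
  have : K' * expR (2 * K') * (2 * occ_eps) <= eta / 2.
    have -> : eta / 2 = (K' * expR (2 * K') + 1) * (2 * occ_eps).
      by rewrite /occ_eps; field; rewrite gt_eqF// ltr_wpDl.
    rewrite ler_wpM2r//; last by rewrite lerDl.
    by rewrite mulr_ge0// ltW.
  by lra.
have amp_tail' kk : \int[P]_s (amplitude X kk s ^+ 2 * (K' < amplitude X kk s)%R%:R)
    <= eta by apply: le_trans (amp_tail kk) _; lra.
have := @stein_bound R d T P _ X iX lX sX _ (@measurable_log_partition R G)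
  (@log_partition_lipschitz R G) eta c K' M (K' ^+ 2) B (local_term K' k) (window k)
  (ltW eta0) c0 K'0 (sqr_ge0 _) n_gt0 vc (amplitude_second hX) amp_tail'
  (measurable_local_term K' k) (@local_term_le R G K' k K'0) (@local_term_local R G K' k)
  (@card_window_overlap G D degD k) u_close g g' C cg cg' gC g'C gL g2.
move=> hS; apply: (le_trans hS).
rewrite -/v -/n.
set rn := Num.sqrt (n%:R : R).
have rn0 : 0 < rn by rewrite sqrtr_gt0.
have rn2 : rn * rn = n%:R by rewrite -expr2 sqr_sqrtr// ltW.
have sv0 : 0 < Num.sqrt v by rewrite sqrtr_gt0.
have svE : Num.sqrt c * rn <= Num.sqrt v.
  by rewrite -sqrtrM; [exact: ler_wsqrtr|exact: ltW].
have -> : Num.sqrt (n * B)%:R = rn * Num.sqrt B%:R.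
  by rewrite natrM sqrtrM.
have h1 : n%:R / v <= c^-1.
  by rewrite ler_pdivrMr// mulrC ler_pdivlMr// mulrC.
have h2 : rn / v <= (c * rn)^-1.
  rewrite ler_pdivrMr// mulrC ler_pdivlMr ?mulr_gt0//.
  by rewrite mulrCA rn2.
have h3 : n%:R / (v * Num.sqrt v) <= (c * Num.sqrt c * rn)^-1.
  rewrite ler_pdivrMr ?mulr_gt0// mulrC ler_pdivlMr ?mulr_gt0//.
  have -> : n%:R * (c * Num.sqrt c * rn) = (c * n%:R) * (Num.sqrt c * rn) by ring.
  by apply: ler_pM => //; [exact: ltW|rewrite mulr_ge0// ltW].
have -> : (2 * eta * n%:R + 2 * K' ^+ 2 * (rn * Num.sqrt B%:R)) / v +
    n%:R * (K' * M / Num.sqrt v + 2 * eta) / v =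
    4 * eta * (n%:R / v) + 2 * K' ^+ 2 * Num.sqrt B%:R * (rn / v) +
    K' * M * (n%:R / (v * Num.sqrt v)).
  by field; rewrite !gt_eqF.
have sB0 : 0 <= Num.sqrt (B%:R : R) by exact: sqrtr_ge0.
have k0 : 0 <= 2 * K' ^+ 2 * Num.sqrt B%:R.
  by apply: mulr_ge0 => //; apply: mulr_ge0 => //; exact: sqr_ge0.
have e40 : 0 <= 4 * eta by rewrite mulr_ge0// ltW.
have km0 : 0 <= K' * M by exact: mulr_ge0.
apply: (@le_trans _ _ (C * (4 * eta * c^-1) + Z / rn)).
  have -> : C * (4 * eta * c^-1) + Z / rn = C * (4 * eta * c^-1 +
      2 * K' ^+ 2 * Num.sqrt B%:R * (c * rn)^-1 +
      K' * M * (c * Num.sqrt c * rn)^-1).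
    by rewrite /Z; field; rewrite !gt_eqF.
  by apply: ler_wpM2l => //; rewrite !lerD// ler_wpM2l.
have hA : C * (4 * eta * c^-1) <= e / 2.
  have -> : C * (4 * eta * c^-1) = e / 2 * (C / (C + 1)).
    by rewrite /eta; field; rewrite !gt_eqF// ltr_wpDl.
  rewrite -[leRHS]mulr1 ler_wpM2l//; first by rewrite divr_ge0// ltW.
  by rewrite ler_pdivrMr ?mul1r ?lerDl// ltr_wpDl.
have hZ : Z / rn <= e / 2.
  rewrite ler_pdivrMr//.
  have : 2 * Z / e <= rn.
    have z0 : 0 <= 2 * Z / e by apply: divr_ge0; [exact: mulr_ge0|exact: ltW].
    rewrite -(ger0_norm z0) -sqrtr_sqr ler_wsqrtr//.
    apply: ltW; apply: (lt_le_trans (truncnS_gt _)).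
    by rewrite ler_nat.
  by rewrite ler_pdivrMr//; lra.
by lra.
Qed.

End WeightModel.

Section VarianceOrder.
Context {R : realType}.
Variables (law_w law_nu : probability (measurableTypeR R) R) (eps : R) (D : nat).
Hypothesis eps0 : 0 < eps.
Hypothesis mom_w : itg law_w (fun x : R => `|x| `^ (2 + eps)).
Hypothesis mom_nu : itg law_nu (fun x : R => `|x| `^ (2 + eps)).
Hypothesis nondeg : ~ point_mass law_w.

Lemma log_tilt_inj (p : R) : 0 < p -> 0 <= p <= 1 -> injective (log_tilt ^~ p).
Proof.
move=> p0 p01 a b /(ln_inj _ _).
rewrite !posrE !tilt_gt0// => /(_ erefl erefl) /addrI /(mulIf (lt0r_neq0 p0)).
by move/addIr/expR_inj.
Qed.

(** The threshold K, the influence of an edge with moderate surroundings and the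
    variance of the edge statistic depend on the two distributions and on the
    maximal degree alone. *)
Lemma variance_linear (delta : R) : 0 < delta -> exists2 c : R, 0 < c &
  forall (G : sgraph) d (T : measurableType d) (P : probability T R)
    (X : (edge G + G) + (edge G + G) -> T -> R),
  (forall x : G, (degree x <= D)%N) -> weight_pair law_w law_nu P X ->
  delta * #|G|%:R <= #|edges G|%:R ->
  c * #|{: edge G + G}|%:R <= variance_of P X.
Proof.
move=> delta0.
pose pr : R := (2 * (2 * (D.+1 * D.+1))%:R)^-1.
have pr_gt0 : 0 < pr by rewrite invr_gt0 mulr_gt0// ltr0n.
have pr_small : pr * (2 * (D.+1 * D.+1))%:R <= 2^-1.
  have n0 : (2 * (D.+1 * D.+1))%:R != 0 :> R by rewrite pnatr_eq0.
  by rewrite /pr invfM -mulrA mulVf// mulr1.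
have [K K1 hK] := laws_tail eps0 mom_w mom_nu pr_gt0.
have K0 : 0 <= K by lra.
pose L := D%:R * expR (3 * K).
pose u : measurableTypeR R -> R := edge_stat K L.
have infl01 := influence01 K0 (erefl L).
have infl0 := influence_gt0 (K := K) (erefl L).
have mu : measurable_fun setT u by exact: measurable_edge_stat.
have su : sqitg law_w u.
  by apply: (sqitg_le _ _ (sqitg_norm (moment_sqitg eps0 mom_w))) => // t; exact: log_tilt_le.
pose var := \int[law_w]_x u x ^+ 2 - (\int[law_w]_x u x) ^+ 2.
have var0 : 0 < var.
  apply: injective_var_gt0 => //; exact: log_tilt_inj.
pose s2 := 2 * var; have s20 : 0 < s2 by rewrite mulr_gt0.
pose c := s2 / 8 / (1 + delta^-1).
have d10 : 0 < 1 + delta^-1 by rewrite addr_gt0// invr_gt0.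
exists c; first by rewrite !divr_gt0.
move=> G d T P X degD hX many.
have sX := pair_sqitg eps0 mom_w mom_nu hX; have lX := pair_same hX.
have iX := proj1 hX.
have sE b : sqitg P (fun t => u (X b t)).
  apply: (sqitg_le _ _ (sqitg_norm (sX b))) => [|t]; last exact: log_tilt_le.
  exact: measurableT_comp mu (proj1 iX b).
have s2E (e : edge G) : \int[P]_t (edge_stat K L (X (inl (inl e)) t) -
    edge_stat K L (X (inr (inl e)) t)) ^+ 2 = s2.
  pose a := inl (inl e) : (edge G + G) + (edge G + G).
  pose b := inr (inl e) : (edge G + G) + (edge G + G).
  have mu2 : measurable_fun setT (fun x => u x ^+ 2) by exact: measurable_funX.
  have ea := pair_ex hX a mu; have eb := pair_ex hX b mu.
  have ea2 := pair_ex hX a mu2; have eb2 := pair_ex hX b mu2.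
  have eab : \int[P]_t (u (X a t) * u (X b t)) =
      (\int[P]_t u (X a t)) * (\int[P]_t u (X b t)).
    apply: (@indep_exM _ _ _ P _ X [set a]%SET [set b]%SET
      (fun z => u (z a)) (fun z => u (z b)) iX).
    - exact: measurableT_comp mu (measurable_coord _).
    - exact: measurableT_comp mu (measurable_coord _).
    - by move=> z z' h; rewrite h// inE.
    - by move=> z z' h; rewrite h// inE.
    - by move=> j; rewrite !inE => /eqP ->.
    - exact: sqitg_itg (sE a).
    - exact: sqitg_itg (sE b).
  rewrite (_ : (fun t => _) = (fun t => u (X a t) ^+ 2 + u (X b t) ^+ 2 -
      2 * (u (X a t) * u (X b t)))); last first.
    by apply/funext => t; rewrite /u /a /b; ring.
  have ia := proj2 (sE a); have ib := proj2 (sE b); have iab := sqitgM (sE a) (sE b).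
  rewrite (exB (itgD ia ib) (itgZ 2 iab)) (exD ia ib) (exZ _ iab) eab ea eb ea2 eb2.
  by rewrite /= /s2 /var; ring.
have tailX b : fine (P (X b @^-1` [set x : R | (K < `|x|)%R])) <= pr.
  by apply: (pair_tail hX); have [] := hK K (lexx _) G (copy_of b).
have := @variance_ge R G D degD d T P X iX lX sX K L pr s2 K0 erefl pr_small
  (ltW pr_gt0) tailX s2E s20.
apply: le_trans.
have eE : #|edge G| = #|edges G| by rewrite card_sig; apply: eq_card.
rewrite card_sum natrD eE; set E : R := #|edges G|%:R.
have VE : #|G|%:R <= E / delta by rewrite ler_pdivlMr// mulrC.
have -> : E * (s2 / 8) = c * (E + E / delta).
  by rewrite /c; field; apply/andP; split; rewrite gt_eqF//; lra.
rewrite ler_wpM2l ?lerD2l//.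
by rewrite ltW// !divr_gt0.
Qed.

End VarianceOrder.

Section Transport.
Context {R : realType} {G : sgraph} {d : measure_display} {T : measurableType d}.
Variable P : probability T R.
Variables (w : edge G -> {RV P >-> R}) (nu : G -> {RV P >-> R}).
Hypothesis hind : mutually_independent P (weights w nu).

Let X0 (i : edge G + G) : T -> R := weights w nu i.
Let F := free_energy w nu.

Lemma weights_indep : indep P X0.
Proof.
split=> [j|A mA]; first exact: measurable_funPT.
have := hind [set: edge G + G]%SET mA.
rewrite (_ : \bigcap_(i in _) _ = [set t | forall j, A j (X0 j t)]).
  by move=> ->; apply: eq_bigl => i; rewrite inE.
apply/seteqP; split=> t /= h j; first by apply: h; rewrite /= inE.
by move=> _; exact: h.
Qed.

Lemma free_energyE t : F t = log_partition (fun i => X0 i t).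
Proof.
rewrite /F /free_energy /log_partition partition_functionE.
by congr (ln (Zsub _ _)); apply/funext => -[].
Qed.

Lemma doubled_weights_ex (Phi : @cfg R (edge G + G)%type -> R) :
  measurable_fun setT Phi ->
  \int[P]_t Phi (X0^~ t) = \int[squareP P]_u at_mix (doubled X0) Phi finset.set0 u.
Proof.
move=> mPhi.
have iD := indep_inj (@mix_inj (edge G + G)%type finset.set0) (doubled_indep weights_indep).
apply: (indep_ex weights_indep iD) => // j A mA; rewrite mix_set0.
by rewrite (@doubled_law _ _ _ P _ _ (proj1 weights_indep) j (inl j))//; left.
Qed.

Variables (law_w law_nu : probability (measurableTypeR R) R).
Hypothesis hw : forall e, has_law P (w e) law_w.
Hypothesis hnu : forall x, has_law P (nu x) law_nu.

Lemma doubled_weight_pair : weight_pair law_w law_nu (squareP P) (doubled X0).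
Proof.
split=> [|b A mA]; first exact: doubled_indep weights_indep.
rewrite (@doubled_law _ _ _ P _ _ (proj1 weights_indep) (copy_of b) b)//; last first.
  by case: b => j; [left|right].
by rewrite /X0; case: (copy_of b) => [e|x]; [exact: hw|exact: hnu].
Qed.

Let m := \int[squareP P]_u at_mix (doubled X0) (@log_partition R G) finset.set0 u.
Let v := variance_of (squareP P) (doubled X0).

Let mF := @measurable_log_partition R G.

Lemma mean_free_energy : fine 'E_P[F] = m.
Proof.
rewrite /m -(doubled_weights_ex mF) unlock.
by apply: eq_Rintegral => t _; exact: free_energyE.
Qed.

Hypothesis sD : sqitg (squareP P)
  (at_mix (doubled X0) (@log_partition R G) finset.set0).

Lemma variance_free_energy : fine 'V_P[F] = v.
Proof.
rewrite /variance unlock.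
transitivity (\int[P]_t ((F t - m) ^+ 2)).
  rewrite unlock; apply: eq_Rintegral => t _.
  by rewrite /= -mean_free_energy unlock expr2.
have mPhi : measurable_fun setT
    (fun c : @cfg R (edge G + G)%type => (log_partition c - m) ^+ 2).
  by apply: measurable_funX; apply: measurable_funB => //; exact: measurable_cst.
transitivity (\int[P]_t ((log_partition (X0^~ t) - m) ^+ 2)).
  by apply: eq_Rintegral => t _; rewrite free_energyE.
rewrite (doubled_weights_ex mPhi) /at_mix.
under eq_Rintegral => u _ do rewrite expr2.
by rewrite (ex_centered_prod sD sD) /v /variance_of expr2; congr (_ - _); rewrite -expr2.
Qed.

(** The resampling argument takes place on the square of the probability space,
    where two independent copies of the weights live. *)
Lemma standardize_law (A : set R) : measurable A ->
  P (standardize P F @^-1` A) =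
  squareP P (standardized (squareP P) (doubled X0) (@log_partition R G) @^-1` A).
Proof.
move=> mA.
pose Phi (c : @cfg R (edge G + G)%type) := (log_partition c - m) / Num.sqrt v.
have mPhi : measurable_fun setT Phi.
  apply: measurable_funM; last exact: measurable_cst.
  by apply: measurable_funB => //; exact: measurable_cst.
have mE : measurable (Phi @^-1` A) by rewrite -[X in measurable X]setTI; exact: mPhi.
have iD := indep_inj (@mix_inj (edge G + G)%type finset.set0) (doubled_indep weights_indep).
have := indep_law weights_indep iD _ mE.
have e0 t : standardize P F t = Phi (X0^~ t).
  rewrite /standardize mean_free_energy variance_free_energy /Phi -free_energyE.
  by [].
have e1 : [set t | (Phi @^-1` A) (X0^~ t)] = standardize P F @^-1` A.
  by apply/seteqP; split=> t /=; rewrite e0.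
rewrite e1 => -> // j B mB; rewrite mix_set0.
by rewrite (@doubled_law _ _ _ P _ _ (proj1 weights_indep) j (inl j))//; left.
Qed.

End Transport.

Section GaussianLimit.
Context {R : realType}.
Variables (law_w law_nu : probability (measurableTypeR R) R) (eps : R) (D : nat).
Hypothesis eps0 : 0 < eps.
Hypothesis mom_w : itg law_w (fun x : R => `|x| `^ (2 + eps)).
Hypothesis mom_nu : itg law_nu (fun x : R => `|x| `^ (2 + eps)).

Lemma test_fun_negligible (c e : R) (h : R -> R) : 0 < c -> 0 < e ->
  test_fun h -> gauss_ex h = 0 ->
  exists n0 : nat, forall (G : sgraph) d (T : measurableType d)
    (P : probability T R) (X : (edge G + G) + (edge G + G) -> T -> R),
  (forall x : G, (degree x <= D)%N) -> weight_pair law_w law_nu P X ->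
  (n0 <= #|{: edge G + G}|)%N ->
  c * #|{: edge G + G}|%:R <= variance_of P X ->
  `|\int[P]_t h (standardized P X (@log_partition R G) t)| <= e.
Proof.
move=> c0 e0 [B [L [B0 L0 hB hL hl]]] hg.
have [g [g' [C [cg cg' gE [gC g'C gL g2]]]]] := stein_solution B0 L0 hB hL hl hg.
have C0 : 0 <= C by rewrite (le_trans _ (gC 0)).
have [n0 hn] := @stein_negligible R law_w law_nu eps D eps0 mom_w mom_nu c C e c0 C0 e0.
exists n0 => G d T P X degD hX nn0 vc.
have := hn G d T P X degD hX nn0 vc g g' cg cg' gC g'C gL g2.
by under eq_Rintegral => t _ do rewrite gE.
Qed.

(** Of the error e, five sixths go to the comparison with test functions and
    one sixth to the means of the test functions. *)
Lemma standardized_cdf (c e x : R) : 0 < c -> 0 < e ->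
  exists n0 : nat, forall (G : sgraph) d (T : measurableType d)
    (P : probability T R) (X : (edge G + G) + (edge G + G) -> T -> R),
  (forall x : G, (degree x <= D)%N) -> weight_pair law_w law_nu P X ->
  (n0 <= #|{: edge G + G}|)%N -> (0 < #|{: edge G + G}|)%N ->
  c * #|{: edge G + G}|%:R <= variance_of P X ->
  `|fine (normal_prob 0 1 `]-oo, x]) -
    fine (P (standardized P X (@log_partition R G) @^-1` `]-oo, x]))| <= e.
Proof.
move=> c0 e0; pose e1 := Num.min (4^-1) (e / 6).
have e10 : 0 < e1 by rewrite lt_min divr_gt0// invr_gt0 ltr0n.
have e14 : e1 <= 4^-1 by rewrite ge_min lexx.
have e16 : e1 <= e / 6 by rewrite ge_min lexx orbT.
have e1P : 0 < e1 <= 4^-1 by rewrite e10.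
have [h1 [h2 [t1 t2 g1 g2 hcmp]]] := cdf_comparison x e1P.
have [n1 hn1] := test_fun_negligible c0 e10 t1 g1.
have [n2 hn2] := test_fun_negligible c0 e10 t2 g2.
exists (maxn n1 n2) => G d T P X degD hX; rewrite geq_max => /andP[nn1 nn2] n_gt0 vc.
have sX := pair_sqitg eps0 mom_w mom_nu hX; have lX := pair_same hX.
have iX := proj1 hX.
set F := at_mix X (@log_partition R G) finset.set0.
have sF : sqitg P F.
  by apply: sqitg_at_set0 => //; [exact: measurable_log_partition|exact: log_partition_lipschitz].
set v := variance_of P X in vc *; set m := \int[P]_t F t.
have v0 : 0 < v by rewrite (lt_le_trans _ vc)// mulr_gt0// ltr0n.
have sFc : sqitg P (fun t => F t - m) by apply: sqitgB => //; exact: sqitg_cst.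
have sW : sqitg P (standardized P X (@log_partition R G)).
  rewrite (_ : standardized _ _ _ = (fun t => (Num.sqrt v)^-1 * (F t - m))).
    exact: sqitgZ.
  by apply/funext => t; rewrite /standardized mulrC.
have W1 : \int[P]_t standardized P X (@log_partition R G) t ^+ 2 <= 1.
  rewrite (_ : (fun t => _) = (fun t => v^-1 * ((F t - m) * (F t - m)))); last first.
    by apply/funext => t; rewrite /standardized exprMn mulrC exprVn sqr_sqrtr ?ltW//.
  rewrite exZ; last exact: sqitgM.
  rewrite ex_centered_prod//.
  have -> : \int[P]_t (F t * F t) - m * m = v by rewrite /v /variance_of expr2.
  by rewrite mulVf ?gt_eqF.
have := hcmp _ _ P _ sW W1.
have := hn1 G d T P X degD hX nn1 vc; have := hn2 G d T P X degD hX nn2 vc.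
set a := \int[P]_t _; set b := \int[P]_t _; set p := fine (P _).
rewrite !ler_norml => /andP[a1 a2] /andP[b1 b2] /andP[q1 q2].
by apply/andP; split; lra.
Qed.

End GaussianLimit.

Theorem theorem1p3 (R : realType) (G : nat -> sgraph)
    (delta : R) (D : nat) (eps : R)
    (d : nat -> measure_display) (Omega : forall n, measurableType (d n))
    (P : forall n, probability (Omega n) R)
    (w : forall n, edge (G n) -> {RV (P n) >-> R})
    (nu : forall n, G n -> {RV (P n) >-> R})
    (law_w law_nu : probability (measurableTypeR R) R)
    (vertices_infty : #|G n| @[n --> \oo] --> \oo)
    (delta_gt0 : 0 < delta)
    (many_edges :
      \forall n \near \oo, delta * #|G n|%:R <= #|edges (G n)|%:R)
    (bounded_degree : forall n, (max_degree (G n) <= D)%N)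
    (subexp_growth : forall alpha : R, 0 < alpha ->
      exists K : R, forall n r : nat, (1 <= r)%N ->
        (volume_growth (G n) r)%:R <= K * expR (alpha * r%:R))
    (weights_independent :
      forall n, mutually_independent (P n) (weights (w n) (nu n)))
    (edge_law : forall n e, has_law (P n) (w n e) law_w)
    (vertex_law : forall n x, has_law (P n) (nu n x) law_nu)
    (eps_gt0 : 0 < eps)
    (moments : ('E_law_w[fun x : R => (`|x| `^ (2 + eps))%R]
      + 'E_law_nu[fun x : R => (`|x| `^ (2 + eps))%R] < +oo)%E)
    (nondegenerate : ~ point_mass law_w) :
  cvg_in_distribution P (fun n => standardize (P n) (free_energy (w n) (nu n)))
    (normal_prob 0 1).
Proof.
have [Ew0 En0] : (0 <= 'E_law_w[fun x : R => (`|x| `^ (2 + eps))%R])%E /\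
    (0 <= 'E_law_nu[fun x : R => (`|x| `^ (2 + eps))%R])%E.
  by split; rewrite unlock; apply: integral_ge0 => x _; rewrite lee_fin powR_ge0.
have mom_w : itg law_w (fun x : R => `|x| `^ (2 + eps)).
  by apply: moment_itg => //; apply: le_lt_trans moments; rewrite leeDl.
have mom_nu : itg law_nu (fun x : R => `|x| `^ (2 + eps)).
  by apply: moment_itg => //; apply: le_lt_trans moments; rewrite leeDr.
have degD n (x : G n) : (degree x <= D)%N.
  by apply: leq_trans (bounded_degree n); exact: leq_bigmax.
have [c c0 hc] := @variance_linear R law_w law_nu eps D eps_gt0 mom_w mom_nu
  nondegenerate delta delta_gt0.
move=> x _.
have fin_cdf n : cdf (standardize (P n) (free_energy (w n) (nu n))) x \is a fin_num.
  exact: fin_num_measure.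
rewrite -[X in _ --> X]fineK; last exact: fin_num_measure.
apply/fine_cvgP; split; first by apply: nearW.
apply/cvgrPdist_le => /= e e0.
have [n0 hn0] := @standardized_cdf R law_w law_nu eps D eps_gt0 mom_w mom_nu c e x c0 e0.
have /cvgnyPge/(_ n0.+1) big_vertices := vertices_infty.
near=> n.
have hX := doubled_weight_pair (weights_independent n) (edge_law n) (vertex_law n).
have vc : c * #|{: edge (G n) + G n}|%:R <= variance_of (squareP (P n)) (doubled (weights (w n) (nu n))).
  by apply: hc => //; near: n.
have nG : (n0.+1 <= #|{: edge (G n) + G n}|)%N.
  rewrite card_sum; apply: leq_trans (leq_addl _ _).
  by near: n; exact: big_vertices.
have sD : sqitg (squareP (P n)) (at_mix (doubled (weights (w n) (nu n)))
    (@log_partition R (G n)) finset.set0).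
  have sX := pair_sqitg eps_gt0 mom_w mom_nu hX; have iX := proj1 hX.
  by apply: sqitg_at_set0 => //; [exact: measurable_log_partition|exact: log_partition_lipschitz].
have lawE := standardize_law (weights_independent n) sD (measurable_itv `]-oo, x]).
have := hn0 (G n) _ _ _ _ (degD n) hX (ltnW nG) (leq_ltn_trans (leq0n _) nG) vc.
by rewrite -lawE.
Unshelve. all: by end_near.
Qed.
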